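(* Let $n\geq 1$ be an integer and let $0<p\leq 1$. Let $L=-\Delta+|x|^2$ be the Hermite operator on $\mathbb{R}^n$, with Hermite functions $\Phi_\mu$, $\mu\in\mathbb{N}^n$. Then there exists a constant $C>0$ such that for all $f\in H^p_L(\mathbb{R}^n)$, $$\sum_{\mu\in\mathbb{N}^n}\frac{|\langle f,\Phi_\mu\rangle|^p}{(2|\mu|+n)^{\frac{3n}{4}(2-p)}}\leq C\,\|f\|^p_{H^p_L(\mathbb{R}^n)}.$$ As a consequence, there is a constant $C>0$ such that for any $f\in H^p(\mathbb{R}^n)$, $$\sum_{\mu\in\mathbb{N}^n}\frac{|\langle f,\Phi_\mu\rangle|^p}{(2|\mu|+n)^{\frac{3n}{4}(2-p)}}\leq C\,\|f\|^p_{H^p(\mathbb{R}^n)}.$$ In both inequalities $C$ is independent of $f$.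
   Context: $\mathbb{N}=\{0,1,2,\dots\}$, and for $\mu=(\mu_1,\dots,\mu_n)\in\mathbb{N}^n$, $|\mu|=\mu_1+\cdots+\mu_n$. Hermite functions: for $k\in\mathbb{N}$ and $t\in\mathbb{R}$, let $H_k(t)=(-1)^k e^{t^2}\frac{d^k}{dt^k}(e^{-t^2})$ and $h_k(t)=(2^k k!\sqrt{\pi})^{-1/2}H_k(t)e^{-t^2/2}$. For $\mu\in\mathbb{N}^n$ and $x\in\mathbb{R}^n$, $\Phi_\mu(x)=\prod_{i=1}^n h_{\mu_i}(x_i)$. The functions $\Phi_\mu$ are real-valued Schwartz functions, form an orthonormal basis of $L^2(\mathbb{R}^n)$, and satisfy $L\Phi_\mu=(2|\mu|+n)\Phi_\mu$, where $L=-\Delta+|x|^2=-\sum_{i=1}^n\frac{\partial^2}{\partial x_i^2}+|x|^2$ is the (non-negative, self-adjoint) Hermite operator. For a tempered distribution $f$ on $\mathbb{R}^n$, $\langle f,\Phi_\mu\rangle$ denotes the pairing of $f$ with the Schwartz function $\Phi_\mu$ (equal to $\int f\,\Phi_\mu\,dx$ when $f\in L^2(\mathbb{R}^n)$). Heat semigroups: for $t>0$ and a tempered distribution $f$, $e^{t\Delta}f$ is the convolution of $f$ with the Gaussian $(4\pi t)^{-n/2}e^{-|x|^2/(4t)}$, and $e^{-tL}f(x)=\sum_{\mu\in\mathbb{N}^n}e^{-t(2|\mu|+n)}\langle f,\Phi_\mu\rangle\Phi_\mu(x)$. Classical Hardy space, $0<p\le 1$: $H^p(\mathbb{R}^n)$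 is the set of tempered distributions $f$ such that $\mathcal{M}_\Delta f(x)=\sup_{t>0}|e^{t\Delta}f(x)|$ belongs to $L^p(\mathbb{R}^n)$, with $\|f\|_{H^p(\mathbb{R}^n)}=\|\mathcal{M}_\Delta f\|_{L^p(\mathbb{R}^n)}$. Hardy space associated with $L$, $0<p\le 1$: $H^p_L(\mathbb{R}^n)$ is the set of tempered distributions $f$ such that $\mathcal{M}_Lf(x)=\sup_{t>0}|e^{-tL}f(x)|$ belongs to $L^p(\mathbb{R}^n)$, with $\|f\|_{H^p_L(\mathbb{R}^n)}=\|\mathcal{M}_Lf\|_{L^p(\mathbb{R}^n)}$. *)

(* Defs.v *)
From HB Require Import structures.
From mathcomp Require Import all_boot all_order all_algebra complex.
From mathcomp Require Import all_classical all_reals all_analysis.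
From mathcomp Require Import measurable_realfun.

Set Implicit Arguments.
Unset Strict Implicit.
Unset Printing Implicit Defensive.

Import Order.TTheory GRing.Theory Num.Theory.
Import numFieldNormedType.Exports.

Local Open Scope classical_set_scope.
Local Open Scope ring_scope.
Local Open Scope complex_scope.

Section lebesgue_tuple_step.
Context {R : realType} (n : nat).

Definition cons_tuple_pair (xu : measurableTypeR R * n.-tuple (measurableTypeR R))
  : n.+1.-tuple (measurableTypeR R) := [tuple of xu.1 :: xu.2].

Lemma measurable_cons_tuple_pair : measurable_fun setT cons_tuple_pair.
Proof. exact: measurable_cons. Qed.

Lemma behead_cons_tuple_pair (x : measurableTypeR R)
    (u : n.-tuple (measurableTypeR R)) :
  [tuple of behead (cons_tuple_pair (x, u))] = u.
Proof. exact/val_inj. Qed.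

Variable m : {sigma_finite_measure set (n.-tuple (measurableTypeR R)) -> \bar R}.

Definition cons_measure : set (n.+1.-tuple (measurableTypeR R)) -> \bar R :=
  pushforward (@lebesgue_measure R \x m)%E cons_tuple_pair.

Lemma cons_measure0 : cons_measure set0 = 0%E.
Proof. by rewrite /cons_measure /pushforward preimage_set0 measure0. Qed.

Lemma cons_measure_ge0 A : (0 <= cons_measure A)%E.
Proof. by rewrite /cons_measure /pushforward measure_ge0. Qed.

Lemma cons_measure_sigma_additive : semi_sigma_additive cons_measure.
Proof.
exact: (@measure_semi_sigma_additive _ _ _
  (measure_function_pushforward__canonical__measure_function_Measure
    (@lebesgue_measure R \x m)%E measurable_cons_tuple_pair)).
Qed.

HB.instance Definition _ := isMeasure.Build _ _ _ cons_measure
  cons_measure0 cons_measure_ge0 cons_measure_sigma_additive.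

Lemma cons_measureX (A : set (measurableTypeR R))
    (B : set (n.-tuple (measurableTypeR R))) :
  measurable A -> measurable B ->
  cons_measure [set u | A (thead u) /\ B [tuple of behead u]] =
  (lebesgue_measure A * m B)%E.
Proof.
move=> mA mB; rewrite -product_measure1E// /cons_measure /pushforward.
congr (product_measure1 _ _ _); apply/seteqP.
by split=> -[x u] /=; rewrite theadE behead_cons_tuple_pair.
Qed.

Lemma cons_measure_sigma_finite : sigma_finite setT cons_measure.
Proof.
have /sigma_finiteP[F [TF ndF Foo]] := sigma_finiteT (@lebesgue_measure R).
have /sigma_finiteP[G [TG ndG Goo]] := sigma_finiteT m.
pose uncons (u : n.+1.-tuple (measurableTypeR R)) :=
  (thead u, [tuple of behead u]).
exists (fun k => uncons @^-1` (F k `*` G k)).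
  rewrite -preimage_bigcup (_ : \bigcup_k _ = setT) ?preimage_setT//.
  rewrite -setXTT TF TG; apply/seteqP; split=> -[x u].
    by move=> [k _ []] /= Fkx Gku; split; exists k.
  move=> [[i _ /= Fix] [j _ /= Gju]]; exists (maxn i j) => //; split.
  - by move: x Fix; exact/subsetPset/ndF/leq_maxl.
  - by move: u Gju; exact/subsetPset/ndG/leq_maxr.
move=> k; have [mF Fk] := Foo k; have [mG Gk] := Goo k; split; last first.
  have -> : uncons @^-1` (F k `*` G k) =
    [set u | F k (thead u) /\ G k [tuple of behead u]] by [].
  by rewrite cons_measureX// lte_mul_pinfty// ge0_fin_numE.
rewrite -[X in measurable X]setTI.
have : measurable_fun setT uncons.
  apply/measurable_fun_pair => /=; last exact: measurable_behead.
  exact: measurable_tnth.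
by apply => //; exact: measurableX.
Qed.

HB.instance Definition _ := @Measure_isSigmaFinite.Build _ _ _
  cons_measure cons_measure_sigma_finite.

End lebesgue_tuple_step.

Section lebesgue_tuple.
Context {R : realType}.

Fixpoint lebesgue_tuple (n : nat) :
    {sigma_finite_measure set (n.-tuple (measurableTypeR R)) -> \bar R} :=
  if n is n'.+1 then cons_measure (lebesgue_tuple n')
  else \d_ [tuple].

Lemma lebesgue_tuple_box (n : nat) (A : 'I_n -> set (measurableTypeR R)) :
  (forall i, measurable (A i)) ->
  lebesgue_tuple n [set u | forall i, A i (tnth u i)] =
  (\prod_(i < n) lebesgue_measure (A i))%E.
Proof.
elim: n A => [|n IH] A mA.
  rewrite big_ord0 /= diracE mem_set//=; by case.
rewrite big_ord_recl -IH// -cons_measureX//=; last first.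
  rewrite [X in measurable X](_ : _ = \bigcap_(i in [set: 'I_n]) 
      ((fun u : n.-tuple (measurableTypeR R) => tnth u i) @^-1` A (lift ord0 i))).
    apply: fin_bigcap_measurable => // i _; rewrite -[X in measurable X]setTI.
    exact: measurable_tnth.
  by apply/seteqP; split=> u /= h i; [move=> _; exact: h|exact: h].
have tnth_tail (u : n.+1.-tuple (measurableTypeR R)) (j : 'I_n) :
    tnth [tuple of behead u] j = tnth u (lift ord0 j).
  rewrite tnth_behead; congr tnth.
  by apply/val_inj; rewrite /= inordK// ltnS.
congr (cons_measure _ _); apply/seteqP; split=> u /=.
  by move=> h; split=> [|j]; [exact: h|rewrite tnth_tail; exact: h].
move=> [h0 h] i; have [j ->|->] := unliftP ord0 i; last exact: h0.
by rewrite -tnth_tail; exact: h.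
Qed.

End lebesgue_tuple.

(* Summation of a (not necessarily nonnegative) family over an arbitrary index
   type, without any order on the indices; meaningful when the family is
   absolutely summable. *)
Definition real_usum {R : realType} {I : choiceType} (a : I -> R) : R :=
  fine (\esum_(i in setT) (Num.max (a i) 0)%:E) -
  fine (\esum_(i in setT) (Num.max (- a i) 0)%:E).

Definition complex_usum {R : realType} {I : choiceType} (a : I -> R[i]) : R[i] :=
  real_usum (fun i => complex.Re (a i)) +i* real_usum (fun i => complex.Im (a i)).

Notation modc := ComplexField.Normc.normc.

Section tempered_distributions.
Context {R : realType} {n : nat}.
Implicit Types (g : 'rV[R]_n -> R) (phi psi : 'rV[R]_n -> R[i]).

Definition partial (i : 'I_n) g : 'rV[R]_n -> R :=
  fun x => 'D_(delta_mx 0 i) g x.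

(* partial derivative along a word: [s] lists the directions, and every
   multi-index is realised by some word *)
Definition partials (s : seq 'I_n) g : 'rV[R]_n -> R := foldr partial g s.

Definition smooth g : Prop := forall s : seq 'I_n,
  continuous (partials s g) /\
  forall (i : 'I_n) (x : 'rV[R]_n), derivable (partials s g) x (delta_mx 0 i).

Definition smoothC phi : Prop :=
  smooth (fun x => complex.Re (phi x)) /\ smooth (fun x => complex.Im (phi x)).

Definition partialsC (s : seq 'I_n) phi : 'rV[R]_n -> R[i] := fun x =>
  partials s (fun y => complex.Re (phi y)) x +i*
  partials s (fun y => complex.Im (phi y)) x.

Definition mdeg (mu : {ffun 'I_n -> nat}) : nat := (\sum_(i < n) mu i)%N.

Definition monomial (al : {ffun 'I_n -> nat}) (x : 'rV[R]_n) : R :=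
  \prod_(i < n) x 0 i ^+ al i.

(* sup of |x^al (d^s phi)(x)| over x, |al| <= N and words s of length <= N *)
Definition schwartz_norm (N : nat) phi : \bar R :=
  ereal_sup [set (`|monomial q.1.1 q.2| * modc (partialsC q.1.2 phi q.2))%:E
    | q in [set q : ({ffun 'I_n -> nat} * seq 'I_n) * 'rV[R]_n |
             (mdeg q.1.1 <= N)%N /\ (size q.1.2 <= N)%N]].

Definition schwartz phi : Prop :=
  smoothC phi /\ forall N, (schwartz_norm N phi < +oo)%E.

(* A tempered distribution is a functional on Schwartz functions. It is encoded
   as a total function; its values outside the Schwartz space are unconstrained
   and never used. *)
Definition tempered (f : ('rV[R]_n -> R[i]) -> R[i]) : Prop :=
  (forall (c : R[i]) phi psi, schwartz phi -> schwartz psi ->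
     f (fun x => c * phi x + psi x) = c * f phi + f psi) /\
  (exists (N : nat) (C : R), forall phi, schwartz phi ->
     ((modc (f phi))%:E <= C%:E * schwartz_norm N phi)%E).

End tempered_distributions.

Section hermite.
Context {R : realType}.

Definition hermite_poly (k : nat) (t : R) : R :=
  (-1) ^+ k * expR (t ^+ 2) * derive1n k (fun s : R => expR (- s ^+ 2)) t.

Definition hermite_fun (k : nat) (t : R) : R :=
  (Num.sqrt (2 ^+ k * k`!%:R * Num.sqrt pi))^-1 *
  hermite_poly k t * expR (- (t ^+ 2) / 2).

Definition Phi {n : nat} (mu : {ffun 'I_n -> nat}) (x : 'rV[R]_n) : R :=
  \prod_(i < n) hermite_fun (mu i) (x 0 i).

End hermite.

Section hardy_spaces.
Context {R : realType} {n : nat}.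
Implicit Types (f : ('rV[R]_n -> R[i]) -> R[i]) (t : R) (x : 'rV[R]_n).

Definition hermite_coef f (mu : {ffun 'I_n -> nat}) : R[i] :=
  f (fun x => (Phi mu x)%:C).

(* The library norm on ['rV_n] is the sup norm, hence the explicit sum. *)
Definition euclid_sq (x : 'rV[R]_n) : R := \sum_(i < n) x 0 i ^+ 2.

Definition gaussian t x : R :=
  (4 * pi * t) `^ (- (n%:R / 2)) * expR (- (euclid_sq x / (4 * t))).

(* The convolution of the distribution f with the Gaussian is, at x, the pairing
   of f with the Schwartz function y |-> gaussian t (x - y). *)
Definition heat t f x : R[i] := f (fun y => (gaussian t (x - y))%:C).

Definition heatL t f x : R[i] :=
  complex_usum (fun mu : {ffun 'I_n -> nat} =>
    (expR (- (t * (2 * mdeg mu + n)%N%:R)))%:C * hermite_coef f mu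
      * (Phi mu x)%:C).

Definition max_heat f x : \bar R :=
  ereal_sup [set (modc (heat t f x))%:E | t in [set t : R | 0 < t]].

Definition max_heatL f x : \bar R :=
  ereal_sup [set (modc (heatL t f x))%:E | t in [set t : R | 0 < t]].

Definition row_of_tuple (u : n.-tuple (measurableTypeR R)) : 'rV[R]_n :=
  \row_i tnth u i.

Definition Lp_norm (p : R) (M : 'rV[R]_n -> \bar R) : \bar R :=
  ('N[lebesgue_tuple n]_p%:E[M \o row_of_tuple])%E.

Definition in_Lp (p : R) (M : 'rV[R]_n -> \bar R) : Prop :=
  measurable_fun setT (M \o row_of_tuple) /\ (Lp_norm p M < +oo)%E.

Definition in_Hp (p : R) f : Prop := tempered f /\ in_Lp p (max_heat f).
Definition Hp_norm (p : R) f : \bar R := Lp_norm p (max_heat f).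

Definition in_HpL (p : R) f : Prop := tempered f /\ in_Lp p (max_heatL f).
Definition HpL_norm (p : R) f : \bar R := Lp_norm p (max_heatL f).

End hardy_spaces.

(* Main.v *)
Require Import Defs.
From mathcomp Require Import all_boot all_order all_algebra complex.
From mathcomp Require Import all_classical all_reals all_analysis.
From mathcomp Require Import measurable_realfun.
From mathcomp Require Import ring lra.
Set Implicit Arguments.
Unset Strict Implicit.
Unset Printing Implicit Defensive.
Import Order.TTheory GRing.Theory Num.Theory.
Import numFieldNormedType.Exports.
Local Open Scope classical_set_scope.
Local Open Scope ring_scope.

(** Let a be the family of real (or of imaginary) parts of the Hermite coefficients of f, and let
    v_t = sum_mu e^(-t(2|mu|+n)) a_mu Phi_mu be its heat sum.
    One piece of information on f is used: for 0 < t <= 1 and l > 0 the set where |v_t| > l has measure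
    at most om(l), where om is a multiple of the distribution function of the maximal function. The
    p-th power of the norm of f then dominates W, the sum of l^p om(l) over the dyadic levels l, and it
    remains to bound the coefficient sum by a multiple of W ([hardy_of_superlevel]).

    The kernel of e^(-tL) is explicit (Mehler's formula, [mehler]): it is nonnegative, of mass at
    most 1, and at most t^(-n/2) for t <= 1. Hence its integral over a set of measure w is at most
    min(1, t^(-n/2) w). Put q = p/2. Cutting |v_(t/2)|^q into dyadic layers and applying the kernel gives
    sup |v_t| <= (sup |v_(t/2)|)^(1-q) A, where A is the sum over the levels of (2l)^q times the minimum
    of 1 and (t/2)^(-n/2) om(l) ([sup_improve]).
    Since f is tempered, sup |v_t| grows at most like a power of 1/t; iterating along t, t/2, t/4, ...
    raises this growth to the powers (1-q)^k and so removes it, and there remains an upper bound M_t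
    with M_t^q comparable to the sum of l^q min(1, t^(-n/2) om(l)) ([heat_sum_sup_le]). Knowing the
    supremum, the integral of v_t^2 is at most a constant times the sum of l^2 om(l) over the levels
    below M_t ([heat_sum_sq_le]). By Bessel's inequality ([heat_sum_bessel]) at t = 2^-i this controls the
    sum of a_mu^2 over the block 2^i <= 2|mu|+n < 2^(i+1), where the exponential is bounded below.
    Hoelder's inequality passes from squares to p-th powers on the block ([block_le]), and what is left
    is a numerical inequality between sums over times and levels, proved by summing geometric series
    ([sum_capped_sum_sqr], [sum_level_le]). The exponent 3n/4 (2-p) is the one that makes the powers of
    2^i match.

    For the maximal function of L, v_t is a component of e^(-tL) f itself. For the classical one,
    completing the square in Mehler's formula shows that the kernel of e^(-tL) at x is a weight at
    most 1 times the Gaussian at time tanh(2t)/2 centred at x / cosh(2t) ([heat_kernel_gaussian]). As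
    the Hermite expansion of the kernel converges in the Schwartz seminorms ([pairing_heat_kernel]),
    |v_t(x)| is at most the classical maximal function at x / cosh(2t), and for t <= 1 this dilation
    costs only a constant factor in measure. So both inequalities follow from the same theorem.

    Mehler's formula itself is obtained from the recurrences: as a function of r, the series
    sum_k r^k h_k(x) h_k(y) satisfies a first-order linear differential equation ([mehler_ode]). *)

Lemma le_of_eq {d} {T : porderType d} (x y : T) : x = y -> (x <= y)%O.
Proof. by move=> ->. Qed.

(** * Hermite polynomials and the ladder relations *)

Section HermiteOneDim.
Context {R : realType}.
Implicit Types (k : nat) (t x y : R).

(** Consecutive values of the three-term recurrence, so that the recursion is structural. *)
Fixpoint herm_pair k t : R * R :=
  if k is k'.+1 then
    ((herm_pair k' t).2,
     2 * t * (herm_pair k' t).2 - 2 * k'.+1%:R * (herm_pair k' t).1)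
  else (1, 2 * t).

Definition herm k t : R := (herm_pair k t).1.

Lemma herm0 t : herm 0 t = 1. Proof. by []. Qed.

Lemma hermS k t : herm k.+1 t = 2 * t * herm k t - 2 * k%:R * herm k.-1 t.
Proof. by case: k => [|k] //; rewrite /herm /= mulr0 mul0r subr0 mulr1. Qed.

(** The cases k and k+1 go together: differentiating the recurrence for H_(k+2)
    calls for both. *)
Lemma is_derive_herm k t : is_derive t 1 (herm k) (2 * k%:R * herm k.-1 t).
Proof.
suff : is_derive t 1 (herm k) (2 * k%:R * herm k.-1 t) /\
          is_derive t 1 (herm k.+1) (2 * k.+1%:R * herm k t) by case.
elim: k => [|k [IH1 IH2]].
  split.
    rewrite mulr0 mul0r (_ : herm 0 = cst 1) //; exact: is_derive_cst.
  rewrite (_ : herm 1 = fun t => 2 * t); last first.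
    by apply/funext => s; rewrite hermS herm0 mulr1 mulr0 mul0r subr0.
  apply: (@is_derive_eq _ _ _ _ _ _ _ _ (is_deriveZ 2 (is_derive_id t 1))).
  by rewrite herm0 /GRing.scale /= !mulr1.
split => //.
rewrite (_ : herm k.+2 = (fun t => 2 * t * herm k.+1 t - 2 * k.+1%:R * herm k t));
  last by apply/funext => s; rewrite hermS.
apply: is_derive_eq.
rewrite /GRing.scale /= ?mulr1 !(hermS k).
rewrite -[k.+2%:R]natr1 -[k.+1%:R]natr1.
ring.
Qed.

Lemma derive1n_gauss k :
  derive1n k (fun s : R => expR (- s ^+ 2)) =
  fun t => (-1) ^+ k * herm k t * expR (- t ^+ 2).
Proof.
elim: k => [|k IH]; first by apply/funext => t; rewrite /= expr0 !mul1r.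
rewrite derive1nS IH; apply/funext => t; rewrite derive1E.
apply: derive_val.
have dE : is_derive t 1 (fun s : R => expR (- s ^+ 2)) (- (2 * t) * expR (- t ^+ 2)).
  apply: is_derive_eq; rewrite /GRing.scale /= ?mulr1; ring.
have dH := is_derive_herm k t.
apply: is_derive_eq.
rewrite /GRing.scale /= hermS (exprS (-1)); ring.
Qed.

Lemma hermite_polyE k t : hermite_poly k t = herm k t.
Proof.
rewrite /hermite_poly derive1n_gauss.
have sgn : (-1) ^+ k * (-1) ^+ k = 1 :> R by rewrite -exprD addnn -mul2n exprM sqrrN !expr1n.
have E : expR (t ^+ 2) * expR (- t ^+ 2) = 1 by rewrite -expRD subrr expR0.
rewrite (_ : _ * _ = ((-1) ^+ k * (-1) ^+ k) * (expR (t ^+ 2) * expR (- t ^+ 2)) * herm k t); last by ring.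
by rewrite sgn E !mul1r.
Qed.

(** The entries of the raising and lowering operators in the basis of Hermite functions. *)
Definition ladder k : R := Num.sqrt (k%:R / 2).

Definition hermite_norm k : R := (Num.sqrt (2 ^+ k * k`!%:R * Num.sqrt pi))^-1.

Lemma hermite_funE k t :
  hermite_fun k t = hermite_norm k * herm k t * expR (- (t ^+ 2) / 2).
Proof. by rewrite /hermite_fun hermite_polyE. Qed.

Lemma ladder_sqr k : ladder k ^+ 2 = k%:R / 2.
Proof. by rewrite sqr_sqrtr// divr_ge0. Qed.

Lemma ladder0 : ladder 0 = 0. Proof. by rewrite /ladder mul0r sqrtr0. Qed.

Lemma ladder_ge0 k : 0 <= ladder k. Proof. exact: sqrtr_ge0. Qed.

Lemma ladder_gt0 k : 0 < ladder k.+1.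
Proof. by rewrite sqrtr_gt0 divr_gt0. Qed.

Lemma hermite_normS k : hermite_norm k = 2 * ladder k.+1 * hermite_norm k.+1.
Proof.
have -> : 2 * ladder k.+1 = Num.sqrt (2 * k.+1%:R).
  have -> : 2 * ladder k.+1 = Num.sqrt (2 ^+ 2) * ladder k.+1 by rewrite sqrtr_sqr ger0_norm.
  rewrite /ladder -sqrtrM ?exprn_ge0//; congr Num.sqrt; by field.
rewrite /hermite_norm factS (exprS 2) natrM.
have -> : 2 * 2 ^+ k * (k.+1%:R * k`!%:R) * Num.sqrt pi =
  (2 * k.+1%:R) * (2 ^+ k * k`!%:R * Num.sqrt pi) :> R by ring.
rewrite (sqrtrM (2 ^+ k * k`!%:R * Num.sqrt pi)) ?mulr_ge0// invfM mulrA mulfV ?mul1r//.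
Qed.

(** Multiplication by t and differentiation act on the Hermite functions as tridiagonal
    matrices with entries of size sqrt k; all bounds on derivatives and moments of h_k come from
    iterating these two relations. At k = 0 the value chosen for k.-1 is harmless since
    ladder 0 = 0. *)
Lemma hermite_fun_mulX k t :
  t * hermite_fun k t = ladder k * hermite_fun k.-1 t + ladder k.+1 * hermite_fun k.+1 t.
Proof.
rewrite !hermite_funE hermS.
case: k => [|k].
  rewrite /= ladder0 !mul0r add0r mulr0 mul0r subr0 herm0 (hermite_normS 0); ring.
rewrite /= [in LHS](hermite_normS k.+1) (hermite_normS k).
have -> : ladder k.+1 * (2 * ladder k.+1 * hermite_norm k.+1 * herm k t * expR (- t ^+ 2 / 2)) =
  ladder k.+1 ^+ 2 * 2 * (hermite_norm k.+1 * herm k t * expR (- t ^+ 2 / 2)) by ring.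
rewrite ladder_sqr (hermite_normS k.+1).
rewrite divfK//; ring.
Qed.

Lemma is_derive_hermite_fun k t :
  is_derive t 1 (hermite_fun k)
    (ladder k * hermite_fun k.-1 t - ladder k.+1 * hermite_fun k.+1 t).
Proof.
rewrite (_ : hermite_fun k = fun t => hermite_norm k * herm k t * expR (- (t ^+ 2) / 2));
  last by apply/funext => s; rewrite hermite_funE.
have dE : is_derive t 1 (fun s : R => expR (- s ^+ 2 / 2)) (- t * expR (- t ^+ 2 / 2)).
  apply: is_derive_eq; rewrite /GRing.scale /= ?mulr1.
  by rewrite mulrC; congr (_ * _); by field.
have dH := is_derive_herm k t.
apply: is_derive_eq.
have := hermite_fun_mulX k t; rewrite !hermite_funE /GRing.scale /= => E.
case: k dH E => [|k] dH E.
  rewrite ladder0 !mul0r add0r in E *.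
  rewrite -E herm0; ring.
rewrite /= in E *.
have -> : ladder k.+1 * (hermite_norm k * herm k t * expR (- t ^+ 2 / 2)) =
   k.+1%:R * hermite_norm k.+1 * herm k t * expR (- t ^+ 2 / 2).
  rewrite hermite_normS (_ : k.+1%:R = ladder k.+1 ^+ 2 * 2); first by ring.
  by rewrite ladder_sqr divfK.
have {}E : ladder k.+2 * (hermite_norm k.+2 * herm k.+2 t * expR (- t ^+ 2 / 2)) =
  t * (hermite_norm k.+1 * herm k.+1 t * expR (- t ^+ 2 / 2)) -
   ladder k.+1 * (hermite_norm k * herm k t * expR (- t ^+ 2 / 2)) by rewrite E; ring.
rewrite E (hermite_normS k).
have -> : ladder k.+1 * (2 * ladder k.+1 * hermite_norm k.+1 * herm k t * expR (- t ^+ 2 / 2)) =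
   k.+1%:R * hermite_norm k.+1 * herm k t * expR (- t ^+ 2 / 2).
  rewrite (_ : k.+1%:R = ladder k.+1 ^+ 2 * 2); first by ring.
  by rewrite ladder_sqr divfK.
ring.
Qed.

End HermiteOneDim.

(** * Power series on the open unit disc *)

Section PowerSeries.
Context {R : realType}.
Implicit Types (u v : nat -> R) (k : nat) (r s : R).

(** Growth slower than every exponential: the power series then converges on the whole open
    unit disc, and the class is stable under products and under formal derivation. *)
Definition subexp u := forall s, 1 < s -> exists C, forall k, `|u k| <= C * s ^+ k.

Lemma subexp_le u v : subexp v -> (forall k, `|u k| <= `|v k|) -> subexp u.
Proof.
by move=> sv uv s s1; have [C H] := sv s s1; exists C => k; apply: le_trans (H k).
Qed.

Lemma subexpD u v : subexp u -> subexp v -> subexp (fun k => u k + v k).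
Proof.
move=> su sv s s1; have [C H] := su s s1; have [D K] := sv s s1.
exists (C + D) => k; rewrite mulrDl; apply: le_trans (ler_normD _ _) _.
exact: lerD.
Qed.

Lemma subexpZ a u : subexp u -> subexp (fun k => a * u k).
Proof.
move=> su s s1; have [C H] := su s s1; exists (`|a| * C) => k.
by rewrite normrM -mulrA ler_wpM2l.
Qed.

Lemma subexpS u : subexp u -> subexp (fun k => u k.+1).
Proof.
move=> su s s1; have [C H] := su s s1; exists (C * s) => k.
by rewrite -mulrA -exprS.
Qed.

Lemma subexp_nat : subexp (fun k => k.+1%:R).
Proof.
move=> s s1; have s0 : 0 < s - 1 by rewrite subr_gt0.
exists (1 + (s - 1)^-1) => k; rewrite ger0_norm//.
have H : 1 + k%:R * (s - 1) <= s ^+ k.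
  elim: k => [|k IH]; first by rewrite mul0r addr0 expr0.
  rewrite exprS -natr1.
  have : s * (1 + k%:R * (s - 1)) <= s * s ^+ k by rewrite ler_wpM2l// ltW// (lt_trans _ s1).
  apply: le_trans; rewrite -subr_ge0.
  rewrite (_ : _ - _ = k%:R * (s - 1) ^+ 2); last by ring.
  by rewrite mulr_ge0 ?sqr_ge0.
apply: (@le_trans _ _ ((1 + (s - 1)^-1) * (1 + k%:R * (s - 1)))); last first.
  by rewrite ler_wpM2l// addr_ge0 // invr_ge0 ltW.
rewrite -natr1 (_ : _ * _ = k%:R + 1 + (s - 1)^-1 + k%:R * (s - 1)); last first.
  by field; rewrite gt_eqF.
by rewrite -addrA lerDl addr_ge0 ?invr_ge0 ?(ltW s0)// mulr_ge0// ltW.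
Qed.

(** Each factor is measured against powers of sqrt s. *)
Lemma subexpM u v : subexp u -> subexp v -> subexp (fun k => u k * v k).
Proof.
move=> su sv s s1; have r1 : 1 < Num.sqrt s by rewrite -sqrtr1 ltr_sqrt// (lt_trans ltr01 s1).
have [C H] := su _ r1; have [D K] := sv _ r1.
exists (C * D) => k; rewrite normrM.
have -> : s ^+ k = Num.sqrt s ^+ k * Num.sqrt s ^+ k.
  by rewrite -exprMn -expr2 sqr_sqrtr// (le_trans _ (ltW s1)).
by rewrite mulrACA ler_pM.
Qed.

Lemma subexp_diffs u : subexp u -> subexp (pseries_diffs u).
Proof. by move=> su; apply: subexpM subexp_nat (subexpS su). Qed.

(** For 0 < |r| < 1 the growth rate |r|^(-1/2) is allowed, and leaves a geometric series of
    ratio |r|^(1/2). *)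
Lemma subexp_cvg u r : subexp u -> `|r| < 1 -> cvgn (pseries u r).
Proof.
move=> su r1; case: (eqVneq r 0) => [->|r0].
  apply: normed_cvg; apply: (@series_le_cvg _ _ (geometric `|u 0%N| 0)) => //.
  - by move=> k /=.
  - by move=> k /=; rewrite mulr_ge0// exprn_ge0.
  - by move=> k /=; rewrite normrM normrX normr0; case: k => [|k] //; rewrite expr0n /= !mulr0.
  - by apply: is_cvg_geometric_series; rewrite normr0.
have r0' : 0 < `|r| by rewrite normr_gt0.
have t1 : `|r| < Num.sqrt `|r|.
  by rewrite -{1}(@sqr_sqrtr _ `|r|)// expr2 gtr_pMl ?sqrtr_gt0// -sqrtr1 ltr_sqrt.
have : 1 < (Num.sqrt `|r|)^-1 by rewrite invf_gt1 ?sqrtr_gt0// -sqrtr1 ltr_sqrt.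
move/su => [C H]; apply: normed_cvg.
apply: (@series_le_cvg _ _ (geometric C (Num.sqrt `|r|))) => //.
- by move=> k /=.
- move=> k /=; rewrite mulr_ge0 ?exprn_ge0 ?sqrtr_ge0//; have := H 0%N; rewrite expr0 mulr1; apply: le_trans; exact: normr_ge0.
- move=> k /=; rewrite normrM normrX.
  apply: (@le_trans _ _ (C * (Num.sqrt `|r|)^-1 ^+ k * `|r| ^+ k)).
    by rewrite ler_wpM2r// exprn_ge0.
  rewrite -mulrA -exprMn -{2}(@sqr_sqrtr _ `|r|)// expr2 mulrA mulVf ?mul1r//.
  by rewrite gt_eqF// sqrtr_gt0.
- by apply: is_cvg_geometric_series; rewrite ger0_norm ?sqrtr_ge0// -sqrtr1 ltr_sqrt.
Qed.

Definition power_sum u r := limn (pseries u r).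

Lemma power_sum_derive u r : subexp u -> `|r| < 1 ->
  is_derive r 1 (power_sum u) (power_sum (pseries_diffs u) r).
Proof.
move=> su r1; have K1 : `|(1 + `|r|) / 2| < 1.
  rewrite ger0_norm ?divr_ge0 ?addr_ge0//; lra.
apply: (@pseries_snd_diffs _ u ((1 + `|r|) / 2)).
- exact: subexp_cvg.
- by apply: subexp_cvg => //; exact: subexp_diffs.
- by apply: subexp_cvg => //; do 2!apply: subexp_diffs.
- rewrite [X in _ < X]ger0_norm ?divr_ge0 ?addr_ge0//; lra.
Qed.

Lemma power_sum_cvg u r : subexp u -> `|r| < 1 ->
  (fun n => \sum_(0 <= k < n) u k * r ^+ k) @ \oo --> power_sum u r.
Proof. move=> su r1; exact: (subexp_cvg su r1). Qed.

Lemma power_sumD u v r : subexp u -> subexp v -> `|r| < 1 ->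
  power_sum (fun k => u k + v k) r = power_sum u r + power_sum v r.
Proof.
move=> su sv r1; apply/cvg_lim => //.
rewrite (_ : pseries _ _ = (fun n => \sum_(0 <= k < n) u k * r ^+ k + \sum_(0 <= k < n) v k * r ^+ k)).
  by apply: cvgD; exact: power_sum_cvg.
apply/funext => k; rewrite /pseries /series /= -big_split /=.
by apply: eq_bigr => i _; rewrite mulrDl.
Qed.

Lemma power_sumZ a u r : subexp u -> `|r| < 1 -> power_sum (fun k => a * u k) r = a * power_sum u r.
Proof.
move=> su r1; apply/cvg_lim => //.
rewrite (_ : pseries _ _ = (fun n => a * \sum_(0 <= k < n) u k * r ^+ k)).
  by apply: cvgMl_tmp; exact: power_sum_cvg.
apply/funext => k; rewrite /pseries /series /= mulr_sumr /=.
by apply: eq_bigr => i _; rewrite mulrA.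
Qed.

Lemma power_sum_shift u r : subexp u -> `|r| < 1 ->
  power_sum (fun k => if k is k'.+1 then u k' else 0) r = r * power_sum u r.
Proof.
move=> su r1; apply/cvg_lim => //; rewrite -cvg_shiftS.
rewrite (_ : (fun _ => _) = (fun n => r * \sum_(0 <= k < n) u k * r ^+ k)).
  by apply: cvgMl_tmp; exact: power_sum_cvg.
apply/funext => k; rewrite /pseries /series /= big_nat_recl//= mul0r add0r mulr_sumr.
by apply: eq_bigr => i _; rewrite exprS mulrCA.
Qed.

Lemma power_sum0 u : power_sum u 0 = u 0%N.
Proof.
apply/cvg_lim => //; rewrite -cvg_shiftS.
rewrite (_ : (fun _ => _) = cst (u 0%N)); first exact: cvg_cst.
apply/funext => k; rewrite /pseries /series /= big_nat_recl//= expr0 mulr1 big1 ?addr0//.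
by move=> i _; rewrite expr0n mulr0.
Qed.

End PowerSeries.

(** * The differential equation behind Mehler's formula *)

Section Mehler.
Context {R : realType}.
Implicit Types (k : nat) (r s x y : R).

(** With 1 + 2d = s^2, once k is so large that the last term is at most d times the bound for
    a k, two steps multiply the bound by s^2. This is what the three-term recurrence gives for
    H_k(x)^2 / (2^k k!), after (u - v)^2 <= (1+d) v^2 + (1+1/d) u^2. *)
Lemma subexp_rec (a : nat -> R) (b : R) : 0 <= b -> (forall k, 0 <= a k) ->
  (forall k d, 0 < d ->
    a k.+2 <= (1 + d) * a k + (1 + d^-1) * b / k.+2%:R * a k.+1) -> subexp a.
Proof.
move=> b0 a0 H s s1; pose d := (s ^+ 2 - 1) / 2.
have d0 : 0 < d by rewrite /d divr_gt0// subr_gt0 exprn_egt1.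
have s0 : 0 < s by rewrite (lt_trans ltr01).
have [k0 Hk0] : exists k0 : nat, (1 + d^-1) * b * s / d <= k0%:R.
  exists (Num.bound ((1 + d^-1) * b * s / d)); apply: ltW.
  by apply: archi_boundP; rewrite !mulr_ge0 ?addr_ge0 ?invr_ge0// ltW.
pose C := \sum_(i < k0.+2) a i.
have C0 : 0 <= C by apply: sumr_ge0.
have small i : (i < k0.+2)%N -> a i <= C * s ^+ i.
  move=> ik; apply: (@le_trans _ _ C).
    by rewrite /C (bigD1 (Ordinal ik)) //= lerDl sumr_ge0.
  by rewrite ler_peMr// exprn_ege1// ltW.
exists C => k; rewrite ger0_norm//.
suff : a k <= C * s ^+ k /\ a k.+1 <= C * s ^+ k.+1 by case.
elim: k => [|k [IH1 IH2]]; first by split; apply: small.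
split=> //; have [kk|kk] := ltnP k k0; first exact: small.
apply: le_trans (H k d d0) _.
have -> : C * s ^+ k.+2 = (1 + d) * (C * s ^+ k) + d * (C * s ^+ k).
  by rewrite !exprS /d; field.
apply: lerD; first by rewrite ler_wpM2l// addr_ge0// ltW.
apply: (@le_trans _ _ ((1 + d^-1) * b / k.+2%:R * (C * s ^+ k.+1))).
  by rewrite ler_wpM2l// !mulr_ge0 ?addr_ge0 ?invr_ge0// ltW.
have -> : (1 + d^-1) * b / k.+2%:R * (C * s ^+ k.+1) =
   ((1 + d^-1) * b / k.+2%:R * s) * (C * s ^+ k) by rewrite exprS; ring.
rewrite ler_wpM2r ?mulr_ge0 ?exprn_ge0 ?(ltW s0)//.
rewrite mulrAC ler_pdivrMr// -ler_pdivrMl// mulrC.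
by apply: le_trans Hk0 _; rewrite ler_nat (leq_trans kk)// -addn2 leq_addr.
Qed.

(** Up to Gaussian factors and sqrt pi, h_k(x) h_k(y) is this weight times H_k(x) H_k(y). *)
Definition mehler_wt k : R := (2 ^+ k * k`!%:R)^-1.

Lemma mehler_wt_gt0 k : 0 < mehler_wt k.
Proof. by rewrite invr_gt0 mulr_gt0 ?exprn_gt0 ?ltr0n ?fact_gt0. Qed.

Lemma mehler_wtS k : mehler_wt k = 2 * k.+1%:R * mehler_wt k.+1.
Proof.
rewrite /mehler_wt factS (exprS 2) natrM; field.
by rewrite expf_neq0 ?pnatr_eq0 //= -?lt0n ?fact_gt0 //= addrC natr1 pnatr_eq0.
Qed.

Lemma subexp_herm_sqr x : subexp (fun k => mehler_wt k * herm k x ^+ 2).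
Proof.
apply: (@subexp_rec _ (2 * x ^+ 2)).
- by rewrite mulr_ge0// sqr_ge0.
- by move=> k; rewrite mulr_ge0 ?sqr_ge0// ltW// mehler_wt_gt0.
move=> k d d0; rewrite [herm k.+2 x]hermS /= (mehler_wtS k) (mehler_wtS k.+1).
set A := herm k x; set B := herm k.+1 x.
have w0 : 0 <= mehler_wt k.+2 by rewrite ltW// mehler_wt_gt0.
have K : (2 * x * B - 2 * k.+1%:R * A) ^+ 2 <=
   (1 + d) * (2 * k.+1%:R * A) ^+ 2 + (1 + d^-1) * (2 * x * B) ^+ 2.
  rewrite -subr_ge0.
  rewrite (_ : _ - _ = d^-1 * (2 * x * B + d * (2 * k.+1%:R * A)) ^+ 2).
    by rewrite mulr_ge0 ?sqr_ge0// invr_ge0 ltW.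
  by field; rewrite gt_eqF.
apply: le_trans (ler_wpM2l w0 K) _.
rewrite mulrDr; apply: lerD.
  have -> : (1 + d) * (2 * k.+1%:R * (2 * k.+2%:R * mehler_wt k.+2) * A ^+ 2) =
    mehler_wt k.+2 * ((1 + d) * (2 * k.+1%:R * (2 * k.+2%:R) * A ^+ 2)) by ring.
  apply: ler_wpM2l => //; apply: ler_wpM2l; first by rewrite addr_ge0// ltW.
  rewrite exprMn ler_wpM2r ?sqr_ge0// expr2 ler_wpM2l ?mulr_ge0// ler_wpM2l//.
  by rewrite ler_nat.
apply: le_of_eq.
field; rewrite (gt_eqF d0) /=.
by rewrite andbT -natrD pnatr_eq0.
Qed.

Section fixed_points.
Variables x y : R.
Let A k := herm k x.
Let B k := herm k y.

(** The coefficients of Mehler's series; in mehler_coefl and mehler_coefr one of the two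
    polynomials is shifted. The recurrences make the three series a closed linear system. *)
Definition mehler_coef k := mehler_wt k * A k * B k.
Definition mehler_coefl k := mehler_wt k * A k.+1 * B k.
Definition mehler_coefr k := mehler_wt k * A k * B k.+1.

Lemma subexp_am (u : nat -> R) (a b : nat -> R) : subexp a -> subexp b ->
  (forall k, `|u k| <= a k + b k) -> subexp u.
Proof.
move=> sa sb H; apply: subexp_le (subexpD sa sb) _ => k.
by apply: le_trans (H k) _; exact: ler_norm.
Qed.

Lemma amgm (w a b : R) : 0 <= w -> `|w * a * b| <= w * a ^+ 2 + w * b ^+ 2.
Proof.
move=> w0; rewrite -mulrA normrM (ger0_norm w0) -mulrDr ler_wpM2l//.
rewrite ler_norml; apply/andP; split.
  rewrite -subr_ge0 (_ : _ - _ = ((a + b) ^+ 2 + a ^+ 2 + b ^+ 2) / 2); last by field.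
  by rewrite divr_ge0// !addr_ge0 ?sqr_ge0.
rewrite -subr_ge0 (_ : _ - _ = ((a - b) ^+ 2 + a ^+ 2 + b ^+ 2) / 2); last by field.
by rewrite divr_ge0// !addr_ge0 ?sqr_ge0.
Qed.

Lemma subexp_herm_sqrS z : subexp (fun k => mehler_wt k * herm k.+1 z ^+ 2).
Proof.
apply: subexp_le (subexpZ 2 (subexpM (@subexp_nat R) (subexpS (subexp_herm_sqr z)))) _ => k.
by rewrite (mehler_wtS k) /= !mulrA.
Qed.

Lemma subexp_mehler_coef : subexp mehler_coef.
Proof.
apply: subexp_am (subexp_herm_sqr x) (subexp_herm_sqr y) _ => k.
by apply: amgm; rewrite ltW// mehler_wt_gt0.
Qed.

Lemma subexp_mehler_coefl : subexp mehler_coefl.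
Proof.
apply: subexp_am (subexp_herm_sqrS x) (subexp_herm_sqr y) _ => k.
by apply: amgm; rewrite ltW// mehler_wt_gt0.
Qed.

Lemma subexp_mehler_coefr : subexp mehler_coefr.
Proof.
apply: subexp_am (subexp_herm_sqr x) (subexp_herm_sqrS y) _ => k.
by apply: amgm; rewrite ltW// mehler_wt_gt0.
Qed.

Let shift (u : nat -> R) k := if k is k'.+1 then u k' else 0.

Lemma subexp_shift u : subexp u -> subexp (shift u).
Proof.
move=> su s s1; have [C H] := su s s1; exists `|C| => -[|k] /=.
  by rewrite normr0 mulr_ge0// exprn_ge0// (le_trans _ (ltW s1)).
apply: le_trans (H k) _; rewrite exprS mulrA ler_wpM2r ?exprn_ge0 ?(le_trans _ (ltW s1))//.
by apply: le_trans (ler_norm _) _; rewrite ler_peMr// ltW.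
Qed.

Variable r : R.
Hypothesis r1 : `|r| < 1.

Let S := power_sum mehler_coef r.
Let P := power_sum mehler_coefl r.
Let Q := power_sum mehler_coefr r.
Let E := power_sum (pseries_diffs mehler_coef) r.

Lemma mehler_P : P = 2 * x * S - r * Q.
Proof.
rewrite /P; have -> : mehler_coefl = fun k => 2 * x * mehler_coef k + (-1) * shift mehler_coefr k.
  apply/funext => -[|k]; rewrite /mehler_coefl /mehler_coef /mehler_coefr /shift /A /B hermS.
    by rewrite mulr0 mul0r subr0 mulr0 addr0; ring.
  rewrite /= (mehler_wtS k); ring.
rewrite power_sumD ?power_sumZ ?power_sum_shift ?mulN1r//.
- exact: subexp_mehler_coefr.
- exact/subexp_shift/subexp_mehler_coefr.
- exact: subexp_mehler_coef.
- exact/subexpZ/subexp_mehler_coef.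
- exact/subexpZ/subexp_shift/subexp_mehler_coefr.
Qed.

Lemma mehler_Q : Q = 2 * y * S - r * P.
Proof.
have -> : Q = power_sum (fun k => 2 * y * mehler_coef k + (-1) * shift mehler_coefl k) r.
  congr power_sum; apply/funext => -[|k]; rewrite /mehler_coefl /mehler_coef /mehler_coefr /shift /A /B [herm _.+1 y]hermS.
    by rewrite mulr0 mul0r subr0 mulr0 addr0; ring.
  rewrite /= (mehler_wtS k); ring.
rewrite power_sumD ?power_sumZ ?power_sum_shift ?mulN1r//.
- exact: subexp_mehler_coefl.
- exact/subexp_shift/subexp_mehler_coefl.
- exact: subexp_mehler_coef.
- exact/subexpZ/subexp_mehler_coef.
- exact/subexpZ/subexp_shift/subexp_mehler_coefl.
Qed.

(** The two recurrences, applied to the factor in x and to the factor in y, express the formal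
    derivative of the series through the shifted series and through itself. *)
Lemma mehler_E : E = x * Q - r * (y * Q - S - r * E).
Proof.
have sE := subexp_diffs subexp_mehler_coef.
have H : pseries_diffs mehler_coef = fun k => x * mehler_coefr k +
    shift (fun k => (- y) * mehler_coefr k + (mehler_coef k + shift (pseries_diffs mehler_coef) k)) k.
  apply/funext => -[|k]; rewrite /pseries_diffs /mehler_coef /mehler_coefr /shift /A /B.
    by rewrite !hermS !herm0 /= (mehler_wtS 0); ring.
  case: k => [|k].
    rewrite (hermS 1) (hermS 1 y) /= !hermS !herm0 /= (mehler_wtS 0) (mehler_wtS 1); ring.
  rewrite (hermS k.+2 x) (hermS k.+2 y) /=.
  rewrite (hermS k.+1 x) (hermS k.+1 y) /= (mehler_wtS k.+1) (mehler_wtS k.+2).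
  rewrite -[k.+3%:R]natr1 -[k.+2%:R]natr1; ring.
rewrite /E [in LHS]H.
have s1 : subexp (fun k => mehler_coef k + shift (pseries_diffs mehler_coef) k).
  by apply: subexpD subexp_mehler_coef _; exact: subexp_shift.
have s2 : subexp (fun k => - y * mehler_coefr k + (mehler_coef k + shift (pseries_diffs mehler_coef) k)).
  by apply: subexpD s1; exact/subexpZ/subexp_mehler_coefr.
rewrite power_sumD ?power_sum_shift ?power_sumD ?power_sumZ ?power_sum_shift//.
- by rewrite -/Q -/S -/E; ring.
- exact: subexp_mehler_coefr.
- exact: subexp_mehler_coefr.
- exact: subexp_mehler_coef.
- exact: subexp_shift.
- exact/subexpZ/subexp_mehler_coefr.
- exact/subexpZ/subexp_mehler_coefr.
- exact/subexp_shift.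
Qed.

(** Eliminating the two shifted series leaves a first-order linear equation in r. *)
Lemma mehler_ode : (1 - r ^+ 2) ^+ 2 * E =
  (r * (1 - r ^+ 2) + 2 * (x - r * y) * (y - r * x)) * S.
Proof.
have hQ : (1 - r ^+ 2) * Q = 2 * (y - r * x) * S.
  have := mehler_Q; rewrite mehler_P => H.
  rewrite mulrBl mul1r [in X in X - _]H; ring.
have hE : (1 - r ^+ 2) * E = (x - r * y) * Q + r * S.
  rewrite mulrBl mul1r [in X in X - _]mehler_E; ring.
rewrite expr2 -mulrA hE mulrDr mulrCA hQ; ring.
Qed.

End fixed_points.

End Mehler.

(** * Mehler's formula and the size of the Hermite functions *)

Section MehlerFormula.
Context {R : realType}.
Implicit Types (k : nat) (r s x y : R).

(** By mehler_ode the product of the series with the inverse of the claimed closed form has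
    zero derivative, and it equals 1 at r = 0. *)
Lemma mehler_power_sum x y r : 0 <= r < 1 ->
  power_sum (mehler_coef x y) r =
  (Num.sqrt (1 - r ^+ 2))^-1 * expR ((2 * r * x * y - r ^+ 2 * (x ^+ 2 + y ^+ 2)) / (1 - r ^+ 2)).
Proof.
move=> /andP[r0 r1].
pose ph s := (2 * s * x * y - s ^+ 2 * (x ^+ 2 + y ^+ 2)) / (1 - s ^+ 2).
pose F s := power_sum (mehler_coef x y) s * (Num.sqrt (1 - s ^+ 2) * expR (- ph s)).
have pos s : `|s| < 1 -> 0 < 1 - s ^+ 2.
  by move=> s1; rewrite subr_gt0 -real_normK ?num_real// exprn_ilt1.
have dF s : `|s| < 1 -> is_derive s 1 F 0.
  move=> s1; have q0 := pos s s1; have q0' : 1 - s ^+ 2 != 0 by rewrite gt_eqF.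
  have dS := power_sum_derive (subexp_mehler_coef x y) s1.
  have dq : is_derive s 1 (fun s : R => 1 - s ^+ 2) (- (2 * s)).
    apply: is_derive_eq; rewrite /GRing.scale /= ?mulr1; ring.
  have dqs : is_derive s 1 (fun s : R => Num.sqrt (1 - s ^+ 2)) (- s / Num.sqrt (1 - s ^+ 2)).
    have := @is_derive1_comp _ (@Num.sqrt R) (fun s : R => 1 - s ^+ 2) s _ _ (is_derive1_sqrt q0) dq.
    move/@is_derive_eq; apply.
    rewrite invfM; field.
    by rewrite gt_eqF// sqrtr_gt0.
  have dph : is_derive s 1 ph (2 * (x - s * y) * (y - s * x) / (1 - s ^+ 2) ^+ 2).
    have dV : is_derive s 1 (fun s : R => (1 - s ^+ 2)^-1) (2 * s / (1 - s ^+ 2) ^+ 2).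
      have := @is_deriveV _ (fun s : R => 1 - s ^+ 2) s _ _ q0' dq; move/@is_derive_eq; apply.
      by rewrite /GRing.scale /=; field.
    rewrite /ph; apply: is_derive_eq; rewrite /GRing.scale /= ?mulr1; by field.
  have dE : is_derive s 1 (fun s => expR (- ph s))
      (- (2 * (x - s * y) * (y - s * x) / (1 - s ^+ 2) ^+ 2) * expR (- ph s)).
    apply: is_derive_eq; rewrite /GRing.scale /=; ring.
  rewrite /F; apply: is_derive_eq; rewrite /GRing.scale /=.
  set S := power_sum (mehler_coef x y) s; set E := power_sum _ _; set w := Num.sqrt _; set e := expR _.
  have w0 : w != 0 by rewrite gt_eqF// sqrtr_gt0.
  have w2 : w ^+ 2 = 1 - s ^+ 2 by rewrite sqr_sqrtr// ltW.
  have O := mehler_ode x y s1; rewrite -/S -/E -w2 in O.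
  rewrite -w2.
  have -> : E = (s * w ^+ 2 + 2 * (x - s * y) * (y - s * x)) * S / w ^+ 4.
    by rewrite -O -exprM mulrAC mulfV ?mul1r// expf_neq0.
  by field.
have F0 : F 0 = 1.
  rewrite /F power_sum0 /ph /mehler_coef !herm0 /mehler_wt expr0n /= subr0 sqrtr1 !mulr0 !mul0r subrr mul0r oppr0 expR0.
  by rewrite fact0 expr0 !mulr1 invr1.
have Fr : F r = 1.
  rewrite -F0; case: (eqVneq r 0) => [->//|rn0].
  have rp : 0 < r by rewrite lt_neqAle eq_sym rn0.
  have inside s : 0 <= s <= r -> `|s| < 1.
    by move=> /andP[s0 sr]; rewrite ger0_norm// (le_lt_trans sr).
  have [||c _] := @MVT _ F (fun=> 0) 0 r rp.
  - by move=> s; rewrite in_itv /= => /andP[s0 sr]; apply: dF; apply: inside; rewrite !ltW.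
  - apply: derivable_within_continuous => s; rewrite in_itv /= => sr.
    by have [] := dF s (inside s sr).
  - by rewrite mul0r => /eqP; rewrite subr_eq0 => /eqP.
have q0 : 0 < 1 - r ^+ 2 by apply: pos; rewrite ger0_norm.
have w0 : Num.sqrt (1 - r ^+ 2) != 0 by rewrite gt_eqF// sqrtr_gt0.
move: Fr; rewrite /F expRN => Fr.
rewrite -/(ph r); have e0 : expR (ph r) != 0 by rewrite gt_eqF ?expR_gt0.
apply: (@mulIf _ (Num.sqrt (1 - r ^+ 2) * (expR (ph r))^-1)).
  by rewrite mulf_neq0 ?invr_eq0.
by rewrite Fr mulrACA mulVf// mulfV// mulr1.
Qed.

Definition mehler_kernel r x y : R :=
  (Num.sqrt (pi * (1 - r ^+ 2)))^-1 *
  expR (- (x ^+ 2 + y ^+ 2) / 2 + (2 * r * x * y - r ^+ 2 * (x ^+ 2 + y ^+ 2)) / (1 - r ^+ 2)).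

Lemma hermite_norm_sqr k : @hermite_norm R k ^+ 2 = mehler_wt k / Num.sqrt pi.
Proof.
rewrite /hermite_norm exprVn sqr_sqrtr; first by rewrite invfM.
by rewrite !mulr_ge0 ?exprn_ge0 ?sqrtr_ge0.
Qed.

Lemma mehler r x y : 0 <= r < 1 ->
  (fun n => \sum_(0 <= k < n) r ^+ k * (hermite_fun k x * hermite_fun k y)) @ \oo
    --> mehler_kernel r x y.
Proof.
move=> r01; have r1 : `|r| < 1 by case/andP: r01 => r0 r1; rewrite ger0_norm.
have H := power_sum_cvg (subexp_mehler_coef x y) r1.
have q0 : 0 <= 1 - r ^+ 2.
  by case/andP: r01 => r0 ?; rewrite subr_ge0 exprn_ile1// ltW.
have := cvgMl_tmp (a := (Num.sqrt pi)^-1 * expR (- (x ^+ 2 + y ^+ 2) / 2)) H.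
rewrite (mehler_power_sum x y r01).
rewrite (_ : (Num.sqrt pi)^-1 * expR (- (x ^+ 2 + y ^+ 2) / 2) * _ = mehler_kernel r x y); last first.
  rewrite /mehler_kernel sqrtrM ?pi_ge0// invfM expRD; ring.
move=> {}H.
rewrite (_ : (fun n => _) = (fun n => (Num.sqrt pi)^-1 * expR (- (x ^+ 2 + y ^+ 2) / 2) *
  \sum_(0 <= k < n) mehler_coef x y k * r ^+ k)); first exact: H.
apply/funext => n; rewrite mulr_sumr; apply: eq_bigr => k _.
rewrite !hermite_funE /mehler_coef.
have -> : expR (- (x ^+ 2 + y ^+ 2) / 2) = expR (- x ^+ 2 / 2) * expR (- y ^+ 2 / 2) :> R.
  by rewrite -expRD; congr expR; field.
have E : mehler_wt k = hermite_norm k ^+ 2 * Num.sqrt pi :> R.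
  by rewrite hermite_norm_sqr divfK// gt_eqF// sqrtr_gt0 pi_gt0.
rewrite E; field.
by rewrite gt_eqF// sqrtr_gt0 pi_gt0.
Qed.

(** On the diagonal all terms of Mehler's series are nonnegative, so each is at most the sum. *)
Lemma mehler_diag k x r : 0 <= r < 1 ->
  r ^+ k * hermite_fun k x ^+ 2 <=
  (Num.sqrt (pi * (1 - r ^+ 2)))^-1 * expR (- (x ^+ 2 * (1 - r) ^+ 2 / (1 - r ^+ 2))).
Proof.
move=> r01; have H := @mehler r x x r01.
have /andP[r0 r1] := r01.
have q0 : 0 < 1 - r ^+ 2 by rewrite subr_gt0 exprn_ilt1.
have -> : (Num.sqrt (pi * (1 - r ^+ 2)))^-1 * expR (- (x ^+ 2 * (1 - r) ^+ 2 / (1 - r ^+ 2))) =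
    mehler_kernel r x x.
  by rewrite /mehler_kernel; congr (_ * expR _); field; rewrite gt_eqF.
rewrite -(cvg_lim _ H)//.
apply: (@le_trans _ _ (\sum_(0 <= j < k.+1) r ^+ j * (hermite_fun j x * hermite_fun j x))).
  rewrite big_nat_recr //= -expr2 lerDr; apply: sumr_ge0 => j _.
  by rewrite mulr_ge0 ?exprn_ge0// -expr2 sqr_ge0.
apply: (@nondecreasing_cvgn_le _ (fun n => \sum_(0 <= j < n) r ^+ j * (hermite_fun j x * hermite_fun j x))).
  apply: nondecreasing_series => j _ _.
  by rewrite mulr_ge0 ?exprn_ge0// -expr2 sqr_ge0.
by apply/cvg_ex; eexists; exact: H.
Qed.

Lemma mehler_diag_le k x r : 0 <= r < 1 ->
  r ^+ k * hermite_fun k x ^+ 2 <= (Num.sqrt (pi * (1 - r ^+ 2)))^-1.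
Proof.
move=> r01; apply: le_trans (mehler_diag k x r01) _.
have /andP[r0 r1] := r01.
rewrite ler_piMr ?invr_ge0 ?sqrtr_ge0// -[leRHS]expR0 ler_expR oppr_le0.
apply: divr_ge0; first by rewrite mulr_ge0 ?sqr_ge0.
by rewrite subr_ge0 exprn_ile1// ltW.
Qed.

(** Mehler's formula at r = 1 - 1/(2(k+1)): by Bernoulli's inequality r^k >= 1/2, while
    1 - r^2 >= 1/(2(k+1)). *)
Lemma hermite_fun_le k x : `|hermite_fun k x| <= 2 * k.+1%:R :> R.
Proof.
pose r : R := 1 - (2 * k.+1%:R)^-1.
have c0 : 0 < 2 * k.+1%:R :> R by rewrite mulr_gt0.
have r0 : 2^-1 <= r.
  have : (2 * k.+1%:R)^-1 <= 2^-1 :> R by rewrite lef_pV2 ?posrE// ler_peMr// ler1n.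
  rewrite /r; set z := (_)^-1; lra.
have r1 : r < 1 by rewrite /r ltrBlDr ltrDl invr_gt0.
have r0' : 0 <= r by apply: le_trans r0.
have rk : 2^-1 <= r ^+ k.
  have B j : 1 - j%:R * (2 * k.+1%:R)^-1 <= r ^+ j.
    elim: j => [|j IH]; first by rewrite mul0r subr0 expr0.
    rewrite exprS -natr1; apply: le_trans (ler_wpM2l r0' IH).
    rewrite /r -subr_ge0 (_ : _ - _ = j%:R * (2 * k.+1%:R)^-1 ^+ 2); last by ring.
    by rewrite mulr_ge0 ?sqr_ge0.
  apply: le_trans (B k).
  have : k%:R / (2 * k.+1%:R) <= 2^-1 :> R.
    by rewrite ler_pdivrMr// mulrA mulVf// mul1r ler_nat.
  set z := (_ / _); lra.
have := @mehler_diag_le k x r; rewrite r1 r0' => /(_ isT) H.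
have H2 : 2^-1 * hermite_fun k x ^+ 2 <= (Num.sqrt (pi * (1 - r ^+ 2)))^-1.
  by apply: le_trans H; rewrite ler_wpM2r// sqr_ge0.
have s1 : (2 * k.+1%:R)^-1 <= Num.sqrt (pi * (1 - r ^+ 2)).
  rewrite -[leLHS]ger0_norm ?invr_ge0 ?(ltW c0)// -sqrtr_sqr ler_sqrt; last first.
    by rewrite mulr_ge0 ?pi_ge0// subr_ge0 exprn_ile1// ltW.
  have p1 : 1 <= pi :> R by rewrite (le_trans _ (pi_ge2 R)) // ler1n.
  have q1 : (2 * k.+1%:R)^-1 <= 1 - r ^+ 2.
    have : r ^+ 2 <= r by rewrite expr2 ger_pMl // ?(ltW r1) // (lt_le_trans _ r0).
    rewrite {2}/r; set z := (_)^-1; lra.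
  apply: (@le_trans _ _ (1 - r ^+ 2)); last first.
    by rewrite ler_peMl// subr_ge0 exprn_ile1// ltW.
  apply: le_trans q1; rewrite expr2 ger_pMl ?invr_gt0// invf_le1//.
  by rewrite -natrM ler1n.
have H3 : hermite_fun k x ^+ 2 <= (2 * k.+1%:R) ^+ 2.
  have : (Num.sqrt (pi * (1 - r ^+ 2)))^-1 <= 2 * k.+1%:R.
    rewrite -[leRHS]invrK lef_pV2// posrE ?invr_gt0//.
    by apply: lt_le_trans s1; rewrite invr_gt0.
  move=> H4; have : hermite_fun k x ^+ 2 <= 2 * (2 * k.+1%:R).
    rewrite -ler_pdivrMl//; exact: le_trans H4.
  move=> /le_trans; apply; rewrite [leRHS]expr2 ler_wpM2r ?(ltW c0)//.
  by rewrite -natrM ler_nat mulnS leq_addr.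
by rewrite -ler_sqr ?nnegrE ?(ltW c0)// real_normK ?num_real.
Qed.

End MehlerFormula.

(** * Derivatives of Hermite functions and inverse-square series *)

Section Ladder.
Context {R : realType}.
Implicit Types (k m : nat) (x y : R).

(** The m-th derivative of h_k. *)
Fixpoint hermite_der m k y : R :=
  if m is m'.+1 then ladder k * hermite_der m' k.-1 y - ladder k.+1 * hermite_der m' k.+1 y
  else hermite_fun k y.

Lemma is_derive_hermite_der m k y : is_derive y 1 (hermite_der m k) (hermite_der m.+1 k y).
Proof.
elim: m k => [|m IH] k; first exact: is_derive_hermite_fun.
rewrite (_ : hermite_der m.+1 k = (fun y => ladder k * hermite_der m k.-1 y - ladder k.+1 * hermite_der m k.+1 y))//.
have d1 := IH k.-1; have d2 := IH k.+1.
by apply: is_derive_eq.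
Qed.

Lemma ladder_le k : ladder k <= k.+1%:R :> R.
Proof.
rewrite /ladder -[leRHS]ger0_norm// -sqrtr_sqr ler_sqrt ?sqr_ge0//.
rewrite -natrX ler_pdivrMr// -natrM ler_nat.
by rewrite expnS expn1 (leq_trans (leqnSn k))// -mulnA leq_pmulr.
Qed.

Lemma ladder_bound (C : R) (B : nat) (g : nat -> R -> R) : 0 <= C ->
  (forall k y, `|g k y| <= C * k.+1%:R ^+ B) ->
  exists D B', 0 <= D /\ forall k y,
    ladder k * `|g k.-1 y| + ladder k.+1 * `|g k.+1 y| <= D * k.+1%:R ^+ B' :> R.
Proof.
move=> C0 H; exists (2 * C * 2 ^+ B.+1), B.+1; split.
  by rewrite !mulr_ge0 ?exprn_ge0.
move=> k y.
have K j : (j <= k.+1)%N -> `|g j y| <= C * k.+2%:R ^+ B.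
  move=> jk; apply: le_trans (H j y) _; rewrite ler_wpM2l//.
  by rewrite lerXn2r ?nnegrE// ler_nat.
have L j : (j <= k.+1)%N -> ladder j <= k.+2%:R :> R.
  by move=> jk; apply: le_trans (ladder_le j) _; rewrite ler_nat.
have k1 : (k.-1 <= k.+1)%N by case: k {K L} => //= k; rewrite -addn2 leq_addr.
apply: (@le_trans _ _ (k.+2%:R * (C * k.+2%:R ^+ B) + k.+2%:R * (C * k.+2%:R ^+ B))).
  by apply: lerD; apply: ler_pM; rewrite ?ladder_ge0 ?L ?K.
apply: (@le_trans _ _ (2 * C * k.+2%:R ^+ B.+1)).
  by rewrite exprS; apply: le_of_eq; ring.
rewrite -!mulrA -exprMn !ler_wpM2l// lerXn2r ?nnegrE ?mulr_ge0//.
by rewrite -natrM ler_nat mul2n -addnn addnS ltnS ltnS leq_addr.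
Qed.

(** Each multiplication by y and each derivative costs one power of k through the ladder
    relations. *)
Lemma hermite_der_bound al m : exists C B, 0 <= C /\ forall k y,
  `|y ^+ al * hermite_der m k y| <= C * k.+1%:R ^+ B :> R.
Proof.
elim: m al => [|m IH] al.
  elim: al => [|al [C [B [C0 IH]]]].
    by exists 2, 1%N; split => // k y; rewrite expr0 mul1r hermite_fun_le.
  have [D [B' [D0 H]]] := @ladder_bound C B (fun k y => y ^+ al * hermite_fun k y) C0 IH.
  exists D, B'; split => // k y; apply: le_trans (H k y).
  rewrite exprSr -mulrA /= hermite_fun_mulX mulrDr !(mulrCA (y ^+ al)).
  by apply: le_trans (ler_normD _ _) _; rewrite !normrM !(ger0_norm (ladder_ge0 _)).
have [C [B [C0 H]]] := IH al.
have [D [B' [D0 K]]] := @ladder_bound C B (fun k y => y ^+ al * hermite_der m k y) C0 H.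
exists D, B'; split => // k y; apply: le_trans (K k y).
rewrite [hermite_der _ _ _]/= mulrBr !(mulrCA (y ^+ al)).
by apply: le_trans (ler_normB _ _) _; rewrite !normrM !(ger0_norm (ladder_ge0 _)).
Qed.

End Ladder.

Section InverseSquareSeries.
Context {R : realType}.
Implicit Types (k N : nat) (C : R) (u : nat -> R).

Definition inv_sqr k : R := (k.+1%:R ^+ 2)^-1.

Lemma inv_sqr_gt0 k : 0 < inv_sqr k. Proof. by rewrite invr_gt0 exprn_gt0. Qed.

(** Telescoping, from 1/(k+1)^2 <= 2/(k+1) - 2/(k+2). *)
Lemma sum_inv_sqr_le N M : (N <= M)%N -> \sum_(N <= k < M) inv_sqr k <= 2 / N.+1%:R.
Proof.
move=> NM; suff : \sum_(N <= k < M) inv_sqr k <= 2 / N.+1%:R - 2 / M.+1%:R.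
  by move/le_trans; apply; rewrite gerBl divr_ge0.
elim: M NM => [|M IH]; first by rewrite leqn0 => /eqP ->; rewrite big_nil subrr.
rewrite leq_eqVlt => /predU1P[->|]; first by rewrite big_geq// subrr.
rewrite ltnS => NM; rewrite big_nat_recr//=.
apply: le_trans (lerD (IH NM) (lexx _)) _.
rewrite -subr_ge0 /inv_sqr.
rewrite (_ : _ - _ = M%:R / (M.+1%:R ^+ 2 * M.+2%:R)).
  by rewrite divr_ge0// mulr_ge0// exprn_ge0.
by field; rewrite !nat1r -natrD !pnatr_eq0.
Qed.

Definition series_sum u := limn (fun N => \sum_(0 <= k < N) u k).

Lemma inv_sqr_cvg C u : (forall k, `|u k| <= C * inv_sqr k) ->
  (fun N => \sum_(0 <= k < N) u k) @ \oo --> series_sum u.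
Proof.
move=> H; have C0 : 0 <= C.
  by have := H 0%N; rewrite /inv_sqr expr1n invr1 mulr1; apply: le_trans.
suff : cvgn (series u) by [].
apply: normed_cvg; apply: (@series_le_cvg _ _ (fun k => C * inv_sqr k)) => //.
- by move=> k /=.
- by move=> k; rewrite mulr_ge0// ltW// inv_sqr_gt0.
apply: nondecreasing_is_cvgn.
  by apply: nondecreasing_series => k _ _; rewrite mulr_ge0// ltW// inv_sqr_gt0.
exists (C * 2) => _ [N _ <-]; rewrite /series /= -mulr_sumr ler_wpM2l//.
by have := sum_inv_sqr_le (leq0n N); rewrite divr1.
Qed.

Lemma inv_sqr_tail C u N : (forall k, `|u k| <= C * inv_sqr k) ->
  `|series_sum u - \sum_(0 <= k < N) u k| <= C * (2 / N.+1%:R).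
Proof.
move=> H; have C0 : 0 <= C.
  by have := H 0%N; rewrite /inv_sqr expr1n invr1 mulr1; apply: le_trans.
have cv := inv_sqr_cvg H.
have L : (fun M => `|\sum_(0 <= k < M) u k - \sum_(0 <= k < N) u k|) @ \oo -->
    `|series_sum u - \sum_(0 <= k < N) u k|.
  by apply: cvg_norm; apply: cvgB => //; exact: cvg_cst.
apply: (cvgr_to_le L); exists N => // M /= NM.
rewrite (big_cat_nat (n := N))//= addrAC subrr add0r.
apply: le_trans (ler_norm_sum _ _ _) _.
apply: (@le_trans _ _ (C * \sum_(N <= k < M) inv_sqr k)).
  by rewrite mulr_sumr ler_sum.
by rewrite ler_wpM2l// sum_inv_sqr_le.
Qed.

Lemma lipschitz_deriv (f f1 : R -> R) (B : R) : (forall y : R, is_derive y 1 f (f1 y)) ->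
  (forall y, `|f1 y| <= B) -> forall a b, `|f b - f a| <= B * `|b - a|.
Proof.
move=> df bd a b; wlog ab : a b / a <= b.
  move=> H; have [|/ltW ba] := leP a b; first exact: H.
  by rewrite distrC (distrC b) H.
have cf : {within `[a, b], continuous f}.
  by apply: derivable_within_continuous => x _; have [] := df x.
have [c _ ->] := MVT_segment ab (fun x _ => df x) cf.
by rewrite normrM ler_wpM2r.
Qed.

Lemma taylor1_le (f f1 f2 : R -> R) (B : R) : (forall y : R, is_derive y 1 f (f1 y)) ->
  (forall y : R, is_derive y 1 f1 (f2 y)) -> (forall y, `|f2 y| <= B) ->
  forall y h, `|f (y + h) - f y - h * f1 y| <= B * h ^+ 2.
Proof.
move=> df df1 bd y h.
pose g z := f z - f1 y * z; pose g1 z := f1 z - f1 y.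
have dg (z : R) : is_derive z 1 g (g1 z).
  have d := df z; rewrite /g; apply: is_derive_eq.
  by rewrite /GRing.scale /= mulr1.
have B0 : 0 <= B by apply: le_trans (bd 0).
have -> : f (y + h) - f y - h * f1 y = g (y + h) - g y by rewrite /g; ring.
have key a b : a <= b -> a <= y <= b -> `|g b - g a| <= B * (b - a) ^+ 2.
  move=> ab /andP[ay yb].
  have cg : {within `[a, b], continuous g}.
    by apply: derivable_within_continuous => x _; have [] := dg x.
  have [c + ->] := MVT_segment ab (fun x _ => dg x) cg.
  rewrite in_itv /= => /andP[ac cb].
  rewrite normrM (ger0_norm (_ : 0 <= b - a)) ?subr_ge0// expr2 mulrA ler_wpM2r ?subr_ge0//.
  apply: le_trans (lipschitz_deriv df1 bd y c) _; rewrite ler_wpM2l//.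
  by rewrite ler_norml; apply/andP; split; lra.
have e : y + h - y = h by ring.
have e' : y - (y + h) = - h by ring.
have [h0|h0] := leP 0 h.
  have := @key y (y + h); rewrite e; apply; lra.
have := @key (y + h) y; rewrite distrC e' sqrrN; apply; lra.
Qed.

Lemma is_derive_quadratic (F : R -> R) (y F1 B : R) :
  (forall h, `|F (y + h) - F y - h * F1| <= B * h ^+ 2) -> is_derive y 1 F F1.
Proof.
move=> H; have B0 : 0 <= B.
  by have := H 1; rewrite expr1n mulr1; apply: le_trans.
have cv : h^-1 *: ((F \o shift y) (h *: (1 : R)) - F y) @[h --> 0^'] --> F1.
  apply/cvgrPdist_le => e e0; near=> h.
  have h0 : h != 0 by near: h; exact: nbhs_dnbhs_neq.
  have he : `|h| <= e / (B + 1).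
    near: h; apply: dnbhs0_le; by rewrite divr_gt0// ltr_wpDl.
  rewrite /= /GRing.scale /= mulr1 distrC (addrC h).
  rewrite (_ : _ - F1 = h^-1 * (F (y + h) - F y - h * F1)); last first.
    by rewrite addrC; field.
  rewrite normrM normfV ler_pdivrMl ?normr_gt0//.
  apply: le_trans (H h) _; rewrite -real_normK ?num_real// expr2 mulrA mulrC ler_wpM2l//.
  rewrite mulrC; move: he; rewrite ler_pdivlMr ?ltr_wpDl//; apply: le_trans.
  by rewrite ler_wpM2l// lerDl.
apply: DeriveDef; first by apply/cvg_ex; exists F1.
exact/cvg_lim.
Unshelve. all: by end_near. Qed.

(** The first-order Taylor remainders of the terms are bounded by summable multiples of h^2,
    which survives the summation and is enough for differentiability. *)
Lemma is_derive_series_sum (f f1 f2 : nat -> R -> R) C :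
  (forall k (y : R), is_derive y 1 (f k) (f1 k y)) ->
  (forall k (y : R), is_derive y 1 (f1 k) (f2 k y)) ->
  (forall k y, `|f k y| <= C * inv_sqr k) ->
  (forall k y, `|f1 k y| <= C * inv_sqr k) ->
  (forall k y, `|f2 k y| <= C * inv_sqr k) ->
  forall y : R, is_derive y 1 (fun y => series_sum (f ^~ y)) (series_sum (f1 ^~ y)).
Proof.
move=> df df1 b b1 b2 y; apply: (@is_derive_quadratic _ _ _ (C * 2)) => h.
have C0 : 0 <= C.
  by have := b 0%N 0; rewrite /inv_sqr expr1n invr1 mulr1; apply: le_trans.
have L : (fun N => `|\sum_(0 <= k < N) f k (y + h) -
   \sum_(0 <= k < N) f k y - h * \sum_(0 <= k < N) f1 k y|) @ \oo -->
   `|series_sum (f ^~ (y + h)) - series_sum (f ^~ y) - h * series_sum (f1 ^~ y)|.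
  apply: cvg_norm; apply: cvgB; first apply: cvgB.
  - exact: (inv_sqr_cvg (b ^~ _)).
  - exact: (inv_sqr_cvg (b ^~ _)).
  - by apply: cvgMl_tmp; exact: (inv_sqr_cvg (b1 ^~ _)).
apply: (cvgr_to_le L); near=> N; rewrite mulr_sumr -!sumrB.
apply: le_trans (ler_norm_sum _ _ _) _.
apply: (@le_trans _ _ (\sum_(0 <= k < N) C * inv_sqr k * h ^+ 2)).
  by apply: ler_sum => k _; apply: taylor1_le (df k) (df1 k) (b2 k) _ _.
rewrite -mulr_suml -mulr_sumr ler_wpM2r ?sqr_ge0// ler_wpM2l//.
by have := sum_inv_sqr_le (leq0n N); rewrite divr1.
Unshelve. all: by end_near. Qed.

End InverseSquareSeries.

Section HeatDecay.
Context {R : realType}.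

(** From (z/m) <= exp (z/m), raised to the power m. *)
Lemma expR_ge_pow (z : R) m : 0 <= z -> z ^+ m <= m%:R ^+ m * expR z.
Proof.
move=> z0; case: m => [|m].
  by rewrite !expr0 mul1r -[leLHS]expR0 ler_expR.
have -> : expR z = expR (z / m.+1%:R) ^+ m.+1.
  by rewrite -expRM_natl mulrC divfK.
rewrite -exprMn lerXn2r ?nnegrE ?mulr_ge0 ?expR_ge0//.
rewrite -ler_pdivrMl// mulrC.
by apply: le_trans (expR_ge1Dx _); rewrite lerDr.
Qed.

Definition decay (t : R) k := expR (- (t * (2 * k + 1)%N%:R)).

Lemma decay_ge0 t k : 0 <= decay t k. Proof. exact: expR_ge0. Qed.

(** The exponential beats every power of k, at a polynomial price in 1/t. Only polynomial losses
    in 1/t can be afforded later, where they are absorbed by iteration. *)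
Lemma decay_le B : exists C : R, 0 <= C /\ forall t k, 0 < t <= 1 ->
  decay t k * k.+1%:R ^+ B <= C / t ^+ B.+2 * inv_sqr k.
Proof.
exists (expR 1 * B.+2%:R ^+ B.+2); split; first by rewrite mulr_ge0 ?expR_ge0 ?exprn_ge0.
move=> t k /andP[t0 t1].
have z0 : 0 <= t * k.+1%:R by rewrite mulr_ge0// ltW.
have E := expR_ge_pow B.+2 z0.
rewrite /inv_sqr ler_pdivlMr ?exprn_gt0// ler_pdivlMr ?exprn_gt0//.
have -> : decay t k * k.+1%:R ^+ B * k.+1%:R ^+ 2 * t ^+ B.+2 = decay t k * (t * k.+1%:R) ^+ B.+2.
  rewrite exprMn (_ : k.+1%:R ^+ B.+2 = k.+1%:R ^+ B * k.+1%:R ^+ 2); last by rewrite -exprD addn2.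
  by set T := t ^+ _; set K := k.+1%:R ^+ B; ring.
apply: le_trans (ler_wpM2l (decay_ge0 t k) E) _.
rewrite (mulrC (expR 1)) mulrCA ler_wpM2l ?exprn_ge0// -expRD ler_expR.
have : 0 <= t * k%:R by rewrite mulr_ge0// ltW.
rewrite natrD natrM -natr1; lra.
Qed.

End HeatDecay.

(** * The heat kernel on the line *)

Section HermiteKernel.
Context {R : realType}.
Implicit Types (t x y : R) (k m N : nat).

(** The closed form, given by Mehler's formula, of the series with terms
    e^(-t(2k+1)) h_k(x) h_k(y). *)
Definition heat1 t x y : R := expR (- t) * mehler_kernel (expR (- (2 * t))) x y.

Lemma decayE t k : decay t k = expR (- t) * expR (- (2 * t)) ^+ k.
Proof.
rewrite /decay -expRM_natl -expRD; congr expR; rewrite natrD natrM; ring.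
Qed.

Lemma rho_itv t : 0 < t -> 0 <= expR (- (2 * t)) < 1.
Proof. by move=> t0; rewrite expR_ge0 expR_lt1 oppr_lt0 mulr_gt0. Qed.

Lemma heat1_cvg t x y : 0 < t ->
  (fun N => \sum_(0 <= k < N) decay t k * hermite_fun k x * hermite_fun k y) @ \oo --> heat1 t x y.
Proof.
move=> t0; have H := @mehler _ _ x y (rho_itv t0).
have := cvgMl_tmp (a := expR (- t)) H; rewrite -/(heat1 t x y) => {}H.
suff -> : (fun N => \sum_(0 <= k < N) decay t k * hermite_fun k x * hermite_fun k y) =
  (fun N => expR (- t) *
  \sum_(0 <= k < N) expR (- (2 * t)) ^+ k * (hermite_fun k x * hermite_fun k y)) by exact: H.
apply/funext => N; rewrite mulr_sumr; apply: eq_bigr => k _.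
by rewrite decayE !mulrA.
Qed.

Lemma heat1_der_term_bound al m : exists (C : R) B, 0 <= C /\ forall t x y k, 0 < t <= 1 ->
  `|y ^+ al * (decay t k * hermite_fun k x * hermite_der m k y)| <= C / t ^+ B * inv_sqr k.
Proof.
have [C [B [C0 H]]] := @hermite_der_bound R al m.
have [D [D0 K]] := @decay_le R B.+1.
exists (2 * C * D), B.+3; split; first by rewrite !mulr_ge0.
move=> t x y k t01.
have -> : y ^+ al * (decay t k * hermite_fun k x * hermite_der m k y) =
  decay t k * ((y ^+ al * hermite_der m k y) * hermite_fun k x) by ring.
rewrite normrM (ger0_norm (decay_ge0 t k)) normrM.
apply: (@le_trans _ _ (decay t k * (C * k.+1%:R ^+ B * (2 * k.+1%:R)))).
  rewrite ler_wpM2l ?decay_ge0//.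
  by apply: ler_pM => //; rewrite ?H ?hermite_fun_le.
have -> : decay t k * (C * k.+1%:R ^+ B * (2 * k.+1%:R)) = 2 * C * (decay t k * k.+1%:R ^+ B.+1).
  by rewrite exprS; ring.
rewrite -!mulrA !ler_wpM2l//; have := K t k t01; by rewrite mulrA.
Qed.

(** The m-th derivative in y of the kernel, as a series: the ladder relations make it easy to
    bound, which the closed form does not. *)
Definition heat1_der t x m y : R := series_sum (fun k => decay t k * hermite_fun k x * hermite_der m k y).

Lemma heat1_der0 t x y : 0 < t -> heat1_der t x 0 y = heat1 t x y.
Proof. move=> t0; apply/cvg_lim => //; exact: heat1_cvg. Qed.

Lemma is_derive_heat1_der t x m y : 0 < t <= 1 -> is_derive y 1 (heat1_der t x m) (heat1_der t x m.+1 y).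
Proof.
move=> t01.
have bd m' : exists C : R, forall k y, `|decay t k * hermite_fun k x * hermite_der m' k y| <= C * inv_sqr k.
  have [C [B [_ H]]] := heat1_der_term_bound 0 m'; exists (C / t ^+ B) => k z.
  by have := H t x z k t01; rewrite expr0 mul1r.
have [C0 H0] := bd m; have [C1 H1] := bd m.+1; have [C2 H2] := bd m.+2.
pose C := `|C0| + `|C1| + `|C2|.
have inC c k : c = C0 \/ c = C1 \/ c = C2 -> c * inv_sqr k <= C * inv_sqr k.
  move=> cc; rewrite ler_wpM2r ?(ltW (inv_sqr_gt0 _))// (le_trans (ler_norm _))// /C.
  by case: cc => [|[|]] ->; rewrite ?lerDr ?addr_ge0//; [rewrite -addrA lerDl addr_ge0|rewrite addrAC lerDr addr_ge0].
apply: (@is_derive_series_sum _ (fun k y => decay t k * hermite_fun k x * hermite_der m k y)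
  (fun k y => decay t k * hermite_fun k x * hermite_der m.+1 k y)
  (fun k y => decay t k * hermite_fun k x * hermite_der m.+2 k y) C).
- move=> k z; have d := is_derive_hermite_der m k z; apply: is_derive_eq.
  by rewrite /GRing.scale /= ?mulr0 ?addr0.
- move=> k z; have d := is_derive_hermite_der m.+1 k z; apply: is_derive_eq.
  by rewrite /GRing.scale /= ?mulr0 ?addr0.
- by move=> k z; apply: le_trans (H0 k z) _; apply: inC; left.
- by move=> k z; apply: le_trans (H1 k z) _; apply: inC; right; left.
- by move=> k z; apply: le_trans (H2 k z) _; apply: inC; right; right.
Qed.

(** The remainder after N terms is small uniformly in x and y, also after multiplication by
    powers of y: one-dimensional convergence in every Schwartz seminorm. *)
Lemma heat1_der_tail al m : exists (C : R) B, 0 <= C /\ forall t x y N, 0 < t <= 1 ->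
  `|y ^+ al * heat1_der t x m y - y ^+ al * \sum_(0 <= k < N) decay t k * hermite_fun k x * hermite_der m k y|
    <= C / t ^+ B / N.+1%:R.
Proof.
have [C [B [C0 H]]] := heat1_der_term_bound al m; exists (C * 2), B; split; first by rewrite mulr_ge0.
move=> t x y N t01.
have [D [B' [_ H']]] := heat1_der_term_bound 0 m.
have cv : (fun N => \sum_(0 <= k < N) decay t k * hermite_fun k x * hermite_der m k y) @ \oo --> heat1_der t x m y.
  apply: (@inv_sqr_cvg _ (D / t ^+ B')) => k.
  by have := H' t x y k t01; rewrite expr0 mul1r.
have E : y ^+ al * heat1_der t x m y = series_sum (fun k => y ^+ al * (decay t k * hermite_fun k x * hermite_der m k y)).
  apply/esym/cvg_lim => //; have := cvgMl_tmp (a := y ^+ al) cv.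
  suff -> : (fun N => \sum_(0 <= k < N) y ^+ al * (decay t k * hermite_fun k x * hermite_der m k y)) =
    (fun N => y ^+ al * \sum_(0 <= k < N) decay t k * hermite_fun k x * hermite_der m k y) by exact.
  by apply/funext => M; rewrite mulr_sumr.
rewrite E mulr_sumr; have := inv_sqr_tail N (fun k => H t x y k t01).
by move/le_trans; apply; apply: le_of_eq; ring.
Qed.

(** 1 / cosh (2 t). *)
Definition sech2 t : R := 2 * expR (- (2 * t)) / (1 + expR (- (2 * t)) ^+ 2).
(** tanh (2 t). *)
Definition tanh2 t : R := (1 - expR (- (2 * t)) ^+ 2) / (1 + expR (- (2 * t)) ^+ 2).

Lemma sech2_gt0 t : 0 < sech2 t.
Proof. by rewrite divr_gt0 ?mulr_gt0 ?expR_gt0// ltr_wpDr ?sqr_ge0. Qed.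

Lemma sech2_le1 t : sech2 t <= 1.
Proof.
rewrite ler_pdivrMr ?ltr_wpDr ?sqr_ge0// mul1r -subr_ge0.
by rewrite (_ : _ - _ = (1 - expR (- (2 * t))) ^+ 2) ?sqr_ge0//; ring.
Qed.

Lemma tanh2_ge t : 0 < t <= 1 -> 2 / 5 * t <= tanh2 t.
Proof.
move=> /andP[t0 t1].
set r := expR (- (2 * t)).
have r0 : 0 < r by exact: expR_gt0.
have r4 : r ^+ 2 <= (1 + 4 * t)^-1.
  rewrite /r -expRM_natl (_ : _ * _ = - (4 * t)); last by ring.
  rewrite expRN lef_pV2 ?posrE ?expR_gt0 ?expR_ge1Dx//.
  by rewrite ltr_wpDr// mulr_ge0// ltW.
have r5 : (1 + 4 * t)^-1 <= 1 - 4 / 5 * t.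
  rewrite -[leLHS]mul1r ler_pdivrMr; last by lra.
  rewrite -subr_ge0 (_ : _ - _ = 16 / 5 * t * (1 - t)); last by field.
  by rewrite !mulr_ge0// ?subr_ge0// ltW.
rewrite /tanh2 -/r ler_pdivlMr ?ltr_wpDr ?sqr_ge0//.
have : r ^+ 2 <= 1 by lra.
move=> r6; have : 0 <= t * (1 - r ^+ 2) by rewrite mulr_ge0 ?subr_ge0// ltW.
lra.
Qed.

Lemma tanh2_gt0 t : 0 < t -> 0 < tanh2 t.
Proof.
move=> t0; apply: divr_gt0; last by rewrite ltr_wpDr ?sqr_ge0.
by rewrite subr_gt0; have /andP[a b] := rho_itv t0; rewrite exprn_ilt1.
Qed.

Definition gauss_pdf (v z : R) : R := (Num.sqrt (2 * pi * v))^-1 * expR (- (z ^+ 2 / (2 * v))).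

(** Completing the square in y: the kernel is a weight at most 1 times the Gaussian of variance
    tanh (2t) centred at x / cosh (2t). Positivity, mass, size and the comparison with the
    classical heat flow all come from this form. *)
Lemma heat1_gauss t x y : 0 < t -> heat1 t x y =
  Num.sqrt (sech2 t) * expR (- (x ^+ 2 * tanh2 t / 2)) * gauss_pdf (tanh2 t) (sech2 t * x - y).
Proof.
move=> t0; have v0 := tanh2_gt0 t0; have k0 := sech2_gt0 t.
have /andP[_ r1] := rho_itv t0.
rewrite /heat1 /gauss_pdf /mehler_kernel.
set r := expR (- (2 * t)) in r1 *.
have r0 : 0 < r by exact: expR_gt0.
have d0 : 0 < 1 + r ^+ 2 by rewrite ltr_wpDr ?sqr_ge0.
have q0 : 0 < 1 - r ^+ 2 by rewrite subr_gt0 exprn_ilt1// ltW.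
have -> : expR (- t) = Num.sqrt r.
  by rewrite -[LHS]ger0_norm ?expR_ge0// -sqrtr_sqr -expRM_natl /r; congr (Num.sqrt (expR _)); ring.
have E : Num.sqrt r / Num.sqrt (pi * (1 - r ^+ 2)) = Num.sqrt (sech2 t) / Num.sqrt (2 * pi * tanh2 t).
  rewrite -!sqrtrV ?mulr_ge0 ?pi_ge0 ?(ltW q0) ?(ltW v0)//.
  rewrite -!sqrtrM ?(ltW r0) ?(ltW k0)//; congr Num.sqrt.
  rewrite /sech2 /tanh2 -/r; have := @pi_gt0 R; move: pi => p p0; field.
  by rewrite !gt_eqF.
rewrite mulrA E -!mulrA; congr (_ * _); rewrite [RHS]mulrCA; congr (_ * _).
rewrite -expRD; congr expR; rewrite /sech2 /tanh2 -/r; field.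
by rewrite !gt_eqF.
Qed.

Lemma gauss_pdfE v z a : 0 < v -> gauss_pdf v (a - z) = normal_pdf a (Num.sqrt v) z.
Proof.
move=> v0; rewrite normal_pdfE ?gt_eqF ?sqrtr_gt0//.
rewrite /normal_peak /normal_fun sqr_sqrtr ?(ltW v0)// /gauss_pdf; congr ((Num.sqrt _)^-1 * expR _).
  by rewrite -mulr_natr; ring.
by rewrite -[in RHS]mulr_natr; field; rewrite gt_eqF.
Qed.

Lemma heat1_ge0 t x y : 0 <= heat1 t x y.
Proof. by rewrite /heat1 !mulr_ge0 ?expR_ge0 ?invr_ge0 ?sqrtr_ge0. Qed.

Lemma gauss_factor_le1 t x : 0 < t -> Num.sqrt (sech2 t) * expR (- (x ^+ 2 * tanh2 t / 2)) <= 1.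
Proof.
move=> t0; rewrite mulr_ile1 ?sqrtr_ge0 ?expR_ge0//.
  by rewrite -sqrtr1 ler_sqrt ?sech2_le1.
by rewrite -[leRHS]expR0 ler_expR oppr_le0 divr_ge0// mulr_ge0 ?sqr_ge0// ltW ?tanh2_gt0.
Qed.

(** The peak of the Gaussian, since tanh (2t) is at least a multiple of t for t <= 1. *)
Lemma heat1_le t x y : 0 < t <= 1 -> heat1 t x y <= (Num.sqrt t)^-1.
Proof.
move=> /[dup] t01 /andP[t0 t1]; rewrite heat1_gauss//.
have v0 := tanh2_gt0 t0.
apply: (@le_trans _ _ (1 * gauss_pdf (tanh2 t) (sech2 t * x - y))).
  by rewrite ler_wpM2r ?gauss_factor_le1// mulr_ge0 ?invr_ge0 ?expR_ge0.
rewrite mul1r /gauss_pdf -[leRHS]mulr1 ler_pM ?invr_ge0 ?expR_ge0//.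
  have p0 : 0 < 2 * pi * tanh2 t.
    by apply: mulr_gt0 => //; apply: mulr_gt0 => //; exact: pi_gt0.
  rewrite lef_pV2 ?posrE ?sqrtr_gt0// ler_sqrt ?(ltW p0)//.
  have := tanh2_ge t01; have := pi_ge2 R => p2 vs.
  have : 2 * 2 * (2 / 5 * t) <= 2 * pi * tanh2 t.
    by apply: ler_pM => //; [rewrite mulr_ge0 ?divr_ge0 ?(ltW t0)|rewrite ler_wpM2l].
  lra.
by rewrite -[leRHS]expR0 ler_expR oppr_le0 divr_ge0 ?sqr_ge0// mulr_ge0// ltW.
Qed.

Lemma measurable_heat1 t x : 0 < t -> measurable_fun setT (heat1 t x).
Proof.
move=> t0; rewrite (_ : heat1 t x = (fun y => Num.sqrt (sech2 t) * expR (- (x ^+ 2 * tanh2 t / 2)) *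
   normal_pdf (sech2 t * x) (Num.sqrt (tanh2 t)) y)); last first.
  by apply/funext => y; rewrite heat1_gauss// gauss_pdfE// tanh2_gt0.
by apply: measurable_funM => //; exact: measurable_normal_pdf.
Qed.

Lemma integral_heat1_le1 t x : 0 < t ->
  (\int[lebesgue_measure]_y (heat1 t x y)%:E <= 1%:E)%E.
Proof.
move=> t0; have v0 := tanh2_gt0 t0.
rewrite -((integral_normal_pdf (sech2 t * x) (Num.sqrt (tanh2 t)))); apply: ge0_le_integral => //.
- by move=> y _; rewrite lee_fin heat1_ge0.
- by apply/measurable_EFinP; exact: measurable_heat1.
- by apply/measurable_EFinP; exact: measurable_normal_pdf.
- move=> y _; rewrite lee_fin heat1_gauss// gauss_pdfE// ler_piMl ?normal_pdf_ge0//.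
  exact: gauss_factor_le1.
Qed.

End HermiteKernel.

(** * Orthonormality of the Hermite functions *)

Section Orthonormality.
Context {R : realType}.
Local Notation mu := (@lebesgue_measure R).
Implicit Types (j k : nat) (x : R).

Lemma continuous_hermite_fun k : continuous (@hermite_fun R k).
Proof.
move=> x; apply/differentiable_continuous/derivable1_diffP.
by have [] := is_derive_hermite_fun k x.
Qed.

Lemma measurable_hermite_fun k : measurable_fun setT (@hermite_fun R k).
Proof. by apply: continuous_measurable_fun; exact: continuous_hermite_fun. Qed.

(** Mehler's formula on the diagonal, at r = 1/2. *)
Lemma hermite_fun_gauss k : exists C : R, 0 <= C /\ forall x,
  `|hermite_fun k x| <= C * expR (- (x ^+ 2 / 6)).
Proof.
pose A : R := 2 ^+ k * (Num.sqrt (pi * (1 - 2^-1 ^+ 2)))^-1.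
have A0 : 0 <= A by rewrite mulr_ge0 ?exprn_ge0// invr_ge0 sqrtr_ge0.
exists (Num.sqrt A); split; first exact: sqrtr_ge0.
move=> x; rewrite -ler_sqr ?nnegrE ?mulr_ge0 ?sqrtr_ge0 ?expR_ge0//.
rewrite real_normK ?num_real// [leRHS]exprMn sqr_sqrtr// -expRM_natl.
have := @mehler_diag R k x 2^-1; rewrite invr_ge0 ler0n invf_lt1// ltr1n => /(_ isT) H.
rewrite /A -mulrA -ler_pdivrMl ?exprn_gt0// -exprVn.
apply: le_trans H _; rewrite ler_wpM2l ?invr_ge0 ?sqrtr_ge0// ler_expR.
by apply: le_of_eq; field.
Qed.

Lemma integrable_gauss6 : mu.-integrable setT (fun x => (expR (- (x ^+ 2 / 6)))%:E).
Proof.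
have s0 : Num.sqrt 3 != 0 :> R by rewrite gt_eqF// sqrtr_gt0.
have I := integrable_normal_pdf 0 (Num.sqrt 3 : R).
have := @integrableZl _ _ _ mu setT measurableT (normal_peak (Num.sqrt 3 : R))^-1 _ I.
apply: eq_integrable => // x _.
rewrite -EFinM normal_pdfE// mulrA mulVf ?mul1r; last by rewrite gt_eqF// normal_peak_gt0.
rewrite /normal_fun sqr_sqrtr// subr0; congr (expR _)%:E.
by rewrite -[3 *+ 2]mulr_natr; field.
Qed.

Lemma integrable_le_gauss6 (g : R -> R) (C : R) : measurable_fun setT g ->
  (forall x, `|g x| <= C * expR (- (x ^+ 2 / 6))) -> mu.-integrable setT (EFin \o g).
Proof.
move=> mg H; have := @integrableZl _ _ _ mu setT measurableT C _ integrable_gauss6.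
apply: le_integrable => //; first exact/measurable_EFinP.
by move=> x _ /=; rewrite lee_fin; apply: le_trans (H x) _; exact: ler_norm.
Qed.

Lemma integrable_hermite_fun k : mu.-integrable setT (EFin \o @hermite_fun R k).
Proof.
have [C [_ H]] := hermite_fun_gauss k.
exact: integrable_le_gauss6 (measurable_hermite_fun k) H.
Qed.

Lemma hermite_fun2_gauss j k : exists C : R, forall x,
  `|hermite_fun j x * hermite_fun k x| <= C * expR (- (x ^+ 2 / 6)).
Proof.
have [C [C0 H]] := hermite_fun_gauss k; exists (2 * j.+1%:R * C) => x.
by rewrite normrM -mulrA ler_pM ?hermite_fun_le ?H.
Qed.

Lemma integrable_hermite_fun2 j k :
  mu.-integrable setT (EFin \o (fun x => hermite_fun j x * hermite_fun k x : R)).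
Proof.
have [C H] := hermite_fun2_gauss j k; apply: integrable_le_gauss6 H.
by apply: measurable_funM; exact: measurable_hermite_fun.
Qed.

(** The fundamental theorem of calculus on [-n, n], whose boundary terms vanish in the limit,
    and dominated convergence. *)
Lemma Rintegral_deriv0 (F f : R -> R) (C : R) :
  (forall x : R, is_derive x 1 F (f x)) -> continuous f ->
  mu.-integrable setT (EFin \o f) -> (forall x, `|F x| <= C * expR (- (x ^+ 2 / 6))) ->
  \int[mu]_x f x = 0.
Proof.
move=> dF cf fi FC; rewrite /Rintegral.
pose fn n : R -> R := (f \_ (`[- n.+1%:R, n.+1%:R]%classic : set R)).
have cF : continuous F.
  by move=> x; apply/differentiable_continuous/derivable1_diffP; have [] := dF x.
have mf : measurable_fun setT f by apply: continuous_measurable_fun.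
have ftc n : (\int[mu]_x (fn n x)%:E)%E = (F n.+1%:R - F (- n.+1%:R))%:E.
  have -> : (\int[mu]_x (fn n x)%:E)%E = (\int[mu]_(x in `[(- n.+1%:R)%R, (n.+1%:R)%R]%classic) (f x)%:E)%E.
    by rewrite [RHS]integral_mkcond restrict_EFin.
  rewrite (@continuous_FTC2 _ _ F)//.
  - by rewrite gtrN.
  - exact: continuous_subspaceT.
  - split; first by move=> x _; have [] := dF x.
    + exact/cvg_at_right_filter/cF.
    + exact/cvg_at_left_filter/cF.
  - by move=> x _; rewrite derive1E; apply: derive_val.
have [|||||_ _ L] := @dominated_convergence _ _ _ mu setT measurableT
  (fun n x => (fn n x)%:E) (EFin \o f) (abse \o (EFin \o f)).
- move=> n; apply/measurable_EFinP; apply/(measurable_restrictT _ _).1 => //.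
  exact: measurable_funTS.
- exact/measurable_EFinP.
- apply: aeW => x _; apply: cvg_near_cst; exists (Num.bound `|x|) => // n /= bn.
  rewrite /fn patchE mem_set//= in_itv /= -ler_norml.
  apply/ltW/(lt_le_trans (archi_boundP (normr_ge0 x))).
  by rewrite ler_nat (leq_trans bn).
- exact: integrable_abse.
- apply: aeW => x n _; rewrite /fn patchE; case: ifP => // _.
  by rewrite abse0 abse_ge0.
have E : (fun n => (F n.+1%:R - F (- n.+1%:R))%:E) @ \oo --> (0:R)%:E.
  apply: cvg_EFin; first by apply: nearW.
  have C0 : 0 <= C.
    by have := FC 0; rewrite expr0n /= mul0r oppr0 expR0 mulr1; apply: le_trans.
  have B n : `|F n.+1%:R - F (- n.+1%:R)| <= 2 * C * 6 * n.+1%:R^-1.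
    have K (y : R) : `|y| = n.+1%:R -> `|F y| <= C * (6 / n.+1%:R).
      move=> yn; apply: le_trans (FC y) _; rewrite ler_wpM2l//.
      rewrite -(real_normK (num_real y)) yn expRN -[leRHS]invrK lef_pV2 ?posrE ?expR_gt0 ?invr_gt0 ?divr_gt0//.
      apply: le_trans (expR_ge1Dx _); rewrite invf_div.
      apply: (@le_trans _ _ (n.+1%:R ^+ 2 / 6)); last by rewrite lerDr.
      by rewrite ler_wpM2r ?invr_ge0// expr2 ler_peMl// ler1n.
    apply: le_trans (ler_normB _ _) _.
    have := K n.+1%:R; rewrite normr_nat => /(_ erefl) K1.
    have := K (- n.+1%:R); rewrite normrN normr_nat => /(_ erefl) K2.
    apply: le_trans (lerD K1 K2) _; apply: le_of_eq; ring.
  apply/cvgr0Pnorm_le => e e0.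
  have /cvgr0Pnorm_le /(_ (e / (2 * C * 6 + 1))) := @cvg_harmonic R.
  have D0 : 0 < 2 * C * 6 + 1 by rewrite ltr_wpDl// !mulr_ge0.
  move=> /(_ (divr_gt0 e0 D0)); apply: filterS => n /= H.
  apply: le_trans (B n) _; rewrite ger0_norm ?invr_ge0// in H.
  apply: (@le_trans _ _ ((2 * C * 6 + 1) * n.+1%:R^-1)).
    by rewrite ler_wpM2r ?invr_ge0// lerDl.
  by rewrite mulrC -ler_pdivlMr.
have L2 : (fun n => (F n.+1%:R - F (- n.+1%:R))%:E) @ \oo --> (\int[mu]_x (f x)%:E)%E.
  by move: L; rewrite (_ : [sequence _]_n = (fun n => (F n.+1%:R - F (- n.+1%:R))%:E)) //;
     apply/funext => n; exact: ftc.
by rewrite (cvg_unique _ L2 E).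
Qed.

(** The lowering operator is adjoint to the raising operator: the difference of the two
    integrands is half the derivative of h_j h_k. *)
Lemma hermite_adjoint j k :
  ladder j * \int[mu]_x (hermite_fun j.-1 x * hermite_fun k x) =
  ladder k.+1 * \int[mu]_x (hermite_fun j x * hermite_fun k.+1 x).
Proof.
pose I (a b : nat) := @integrable_hermite_fun2 a b.
have IZ (c : R) a b : mu.-integrable setT (EFin \o (fun x => c * (hermite_fun a x * hermite_fun b x) : R)).
  by have := integrableZl measurableT c (I a b); apply: eq_integrable.
apply/eqP; rewrite -subr_eq0; apply/eqP.
rewrite -!RintegralZl// -!RintegralB//.
have [C FC] := hermite_fun2_gauss j k.
pose f x : R := ladder j * (hermite_fun j.-1 x * hermite_fun k x) -
  ladder k.+1 * (hermite_fun j x * hermite_fun k.+1 x).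
have dF (x : R) : is_derive x 1 (fun x => 2^-1 * (hermite_fun j x * hermite_fun k x)) (f x).
  have d1 := is_derive_hermite_fun j x; have d2 := is_derive_hermite_fun k x.
  apply: is_derive_eq; rewrite /GRing.scale /= /f.
  have := hermite_fun_mulX j x; have := hermite_fun_mulX k x.
  move: (hermite_fun j x) (hermite_fun k x) (ladder j) (ladder k) (ladder j.+1) (ladder k.+1)
    (hermite_fun j.-1 x) (hermite_fun k.-1 x) (hermite_fun j.+1 x) (hermite_fun k.+1 x).
  move=> hj hk lj lk lj1 lk1 hjm hkm hj1 hk1 Ek Ej.
  have -> : lj1 * hj1 = x * hj - lj * hjm by rewrite Ej; ring.
  have -> : lk * hkm = x * hk - lk1 * hk1 by rewrite Ek; ring.
  by field.
have cf : continuous f.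
  have cc a b (c : R) : continuous (fun x => c * (hermite_fun a x * hermite_fun b x) : R).
    move=> x; apply: cvgMl_tmp; apply: cvgM; exact: continuous_hermite_fun.
  by move=> x; apply: cvgB; exact: cc.
have fi : mu.-integrable setT (EFin \o f).
  by have := integrableB measurableT (IZ (ladder j) j.-1 k) (IZ (ladder k.+1) j k.+1); apply: eq_integrable.
apply: (Rintegral_deriv0 (C := 2^-1 * C) dF cf fi) => x.
by rewrite normrM ger0_norm ?invr_ge0// -[leRHS]mulrA ler_wpM2l ?invr_ge0.
Qed.

Lemma hermite_fun0_norm : \int[mu]_x (hermite_fun 0 x * hermite_fun 0 x) = 1 :> R.
Proof.
have -> : (fun x => hermite_fun 0 x * hermite_fun 0 x) = (fun x => (Num.sqrt pi)^-1 * gauss_fun x) :> (R -> R).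
  apply/funext => x; rewrite !hermite_funE herm0 /gauss_fun.
  have -> : expR (- x ^+ 2) = expR (- x ^+ 2 / 2) * expR (- x ^+ 2 / 2).
    by rewrite -expRD; congr expR; field.
  have := @hermite_norm_sqr R 0; rewrite /mehler_wt fact0 expr0 mul1r invr1 mul1r => <-; ring.
have I := @integrableT_gauss R.
rewrite RintegralZl// /Rintegral integralT_gauss/= mulVf// gt_eqF//.
by rewrite sqrtr_gt0 pi_gt0.
Qed.

(** Orthogonality by lowering both indices with hermite_adjoint, down to an index 0, where
    ladder 0 = 0; the norms reduce to that of the Gaussian h_0. *)
Lemma hermite_orthonormal j k :
  \int[mu]_x (hermite_fun j x * hermite_fun k x) = (j == k)%:R :> R.
Proof.
elim: k j => [|k IH] [|j].
- exact: hermite_fun0_norm.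
- have := hermite_adjoint 0 j; rewrite ladder0 mul0r => /esym/eqP.
  rewrite mulf_eq0 gt_eqF ?ladder_gt0//= => /eqP E.
  rewrite (_ : (j.+1 == 0)%:R = 0 :> R)// -E.
  by apply: eq_Rintegral => x _; rewrite mulrC.
- have := hermite_adjoint 0 k; rewrite ladder0 mul0r => /esym/eqP.
  by rewrite mulf_eq0 gt_eqF ?ladder_gt0//= => /eqP.
have := hermite_adjoint j.+1 k; rewrite /= IH eqSS => H.
have l0 : ladder k.+1 != 0 :> R by rewrite gt_eqF// ladder_gt0.
apply: (mulfI l0); rewrite -H; case: eqP => [->//|_].
by rewrite !mulr0.
Qed.

End Orthonormality.

(** * Product functions on tuples *)

Section TupleIntegral.
Context {R : realType}.
Local Notation mu := (@lebesgue_measure R).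
Local Notation T n := (n.-tuple (measurableTypeR R)).

Definition tuple_prod n (g : 'I_n -> R -> R) (u : T n) : R := \prod_(i < n) g i (tnth u i).

Lemma tuple_prod_cons n (g : 'I_n.+1 -> R -> R) x u :
  tuple_prod g (cons_tuple_pair (x, u)) = g ord0 x * tuple_prod (fun i => g (lift ord0 i)) u.
Proof.
rewrite /tuple_prod big_ord_recl; congr (g ord0 _ * _).
by apply: eq_bigr => i _; congr (g _ _); rewrite tnthS.
Qed.

Lemma measurable_tuple_prod n (g : 'I_n -> R -> R) :
  (forall i, measurable_fun setT (g i)) -> measurable_fun setT (tuple_prod g).
Proof.
move=> mg; apply: measurable_prod => i _.
have mt : measurable_fun setT (fun u : T n => tnth u i) by exact: measurable_tnth.
exact: (measurableT_comp (mg i) mt).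
Qed.

Lemma integral_lebesgue_tuple0 (f : T 0 -> \bar R) : measurable_fun setT f ->
  (\int[lebesgue_tuple 0]_u f u = f [tuple])%E.
Proof. by move=> mf; rewrite integral_dirac// diracT mul1e. Qed.

Lemma integrable_lebesgue_tupleS n (f : T n.+1 -> \bar R) : measurable_fun setT f ->
  (mu \x lebesgue_tuple n)%E.-integrable setT (f \o @cons_tuple_pair R n) ->
  (lebesgue_tuple n.+1).-integrable setT f /\
  (\int[lebesgue_tuple n.+1]_u f u = \int[mu \x lebesgue_tuple n]_z f (cons_tuple_pair z))%E.
Proof.
move=> mf If.
have mc := @measurable_cons_tuple_pair R n.
have E (g : T n.+1 -> \bar R) : (\int[lebesgue_tuple n.+1]_u g u =
    \int[pushforward (mu \x lebesgue_tuple n)%E (@cons_tuple_pair R n)]_u g u)%E.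
  by apply: eq_measure_integral.
have I2 := @integrable_pushforward _ _ _ _ R _ mc _ setT f mf If measurableT.
split; last by rewrite E integral_pushforward.
apply/integrableP; split=> //; rewrite E.
by case/integrableP : I2.
Qed.

(** Fubini's theorem, one coordinate at a time. *)
Lemma tuple_prod_integral n (g : 'I_n -> R -> R) :
  (forall i, mu.-integrable setT (EFin \o g i)) ->
  (lebesgue_tuple n).-integrable setT (EFin \o tuple_prod g) /\
  \int[lebesgue_tuple n]_u tuple_prod g u = \prod_(i < n) \int[mu]_x g i x.
Proof.
elim: n g => [|n IH] g Ig.
  have c1 : tuple_prod g = cst 1.
    by apply/funext => u; rewrite /tuple_prod big_ord0.
  have m1 : measurable_fun setT (fun _ : T 0 => (1:R)%:E) by exact: measurable_cst.
  rewrite big_ord0 c1; split.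
    apply/integrableP; split; first exact: m1.
    have m2 : measurable_fun setT (fun _ : T 0 => `|(1:R)%:E|%E) by exact: measurable_cst.
    by rewrite (integral_lebesgue_tuple0 m2) abse_EFin ltry.
  by rewrite /Rintegral (integral_lebesgue_tuple0 m1).
have mg i : measurable_fun setT (g i).
  by apply/measurable_EFinP; exact: measurable_int (Ig i).
have [I' E'] := IH (fun i => g (lift ord0 i)) (fun i => Ig _).
set G' := tuple_prod _ in I' E'.
have mG := measurable_tuple_prod mg.
have mf : measurable_fun setT (EFin \o tuple_prod g) by exact/measurable_EFinP.
have comp : (EFin \o tuple_prod g) \o @cons_tuple_pair R n = (fun z => (g ord0 z.1 * G' z.2)%:E).
  by apply/funext => -[x u]; rewrite /comp tuple_prod_cons.
have mz : measurable_fun setT (fun z : measurableTypeR R * T n => (g ord0 z.1 * G' z.2)%:E).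
  rewrite -comp; apply: measurableT_comp => //; exact: measurable_cons_tuple_pair.
have mG' : measurable_fun setT G' by apply: measurable_tuple_prod.
have mnG : measurable_fun setT (fun u => `|G' u|%:E).
  by apply/measurable_EFinP; apply: measurableT_comp.
have mn0 : measurable_fun setT (fun x : measurableTypeR R => `|g ord0 x|%:E).
  by apply/measurable_EFinP; apply: measurableT_comp => //; exact: mg.
have fin' : (\int[lebesgue_tuple n]_u `|G' u|%:E)%E \is a fin_num.
  rewrite ge0_fin_numE ?integral_ge0//; by case/integrableP : I'.
have Iz : (mu \x lebesgue_tuple n)%E.-integrable setT (fun z => (g ord0 z.1 * G' z.2)%:E).
  apply/(integrable12ltyP _ _ mz).
  under eq_integral => x _.
    under eq_integral => u _ do rewrite /= normrM EFinM.
    rewrite ge0_integralZl//.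
    over.
  rewrite /= -(fineK fin') ge0_integralZr//.
  - have fin0 : (\int[mu]_x `|g ord0 x|%:E < +oo)%E by case/integrableP : (Ig ord0).
    by apply: lte_mul_pinfty; rewrite ?ltry// ?ge0_fin_numE ?integral_ge0.
  - by rewrite lee_fin fine_ge0// integral_ge0.
have [I2 E2] := integrable_lebesgue_tupleS mf (eq_ind_r (fun f => (mu \x lebesgue_tuple n)%E.-integrable setT f) Iz comp).
split => //; rewrite /Rintegral.
have -> : (\int[lebesgue_tuple n.+1]_x (tuple_prod g x)%:E)%E = (\int[mu \x lebesgue_tuple n]_z (g ord0 z.1 * G' z.2)%:E)%E.
  by rewrite E2; apply: eq_integral => z _; rewrite -[LHS]/(((EFin \o tuple_prod g) \o @cons_tuple_pair R n) z) comp.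
rewrite -integral12_prod_meas1//.
rewrite big_ord_recl -E' -RintegralZr//.
congr fine; apply: eq_integral => x _ /=.
rewrite /fubini_F /=; under eq_integral do rewrite EFinM.
by rewrite integralZl// -[X in (_ * X)%E]fineK ?integrable_fin_num.
Qed.

End TupleIntegral.

(** * Dilations and Lebesgue measure on tuples *)

Section Dilation.
Context {R : realType}.
Local Notation mu := (@lebesgue_measure R).
Local Notation T n := (n.-tuple (measurableTypeR R)).
Variable k : R.
Hypothesis k0 : 0 < k.

Definition dilate1 (x : measurableTypeR R) : measurableTypeR R := k * x.

Lemma measurable_dilate1 : measurable_fun setT dilate1.
Proof. by apply: continuous_measurable_fun => x; apply: cvgMl_tmp; exact: cvg_id. Qed.

Let kn : {nonneg R} := NngNum (ltW k0).

Let pf := measure_function_pushforward__canonical__measure_function_Measure mu measurable_dilate1.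

Lemma lebesgue_dilate1 (A : set (measurableTypeR R)) : measurable A ->
  mu A = (k%:E * mu (dilate1 @^-1` A))%E.
Proof.
move=> mA; rewrite (@lebesgue_measure_unique R (mscale kn pf))//.
move=> X [[a b] /= _ <-]; rewrite /mscale /= /pushforward.
have -> : dilate1 @^-1` `]a, b] = `]a / k, b / k]%classic.
  by apply/seteqP; split=> x /=; rewrite !in_itv /= /dilate1 ltr_pdivrMr// ler_pdivlMr// mulrC.
rewrite !lebesgue_measure_itv /= !lte_fin ltr_pM2r ?invr_gt0//.
case: ifP => _; last by rewrite mule0.
by rewrite -!EFinD -EFinM; congr EFin; field; rewrite gt_eqF.
Qed.

Lemma integral_dilate1 (f : R -> \bar R) : measurable_fun setT f -> (forall x, (0 <= f x)%E) ->
  (\int[mu]_x f x = k%:E * \int[mu]_x f (dilate1 x))%E.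
Proof.
move=> mf f0.
rewrite (@eq_measure_integral _ _ _ _ (mscale kn pf) mu f); last first.
  by move=> A mA _; first [exact: (lebesgue_dilate1 mA) | exact: (esym (lebesgue_dilate1 mA))].
rewrite ge0_integral_mscale//; congr (_ * _)%E.
exact: (ge0_integral_pushforward measurable_dilate1 mu measurableT mf (fun y _ => f0 y)).
Qed.

Definition dilate n (u : T n) : T n := [tuple of map dilate1 u].

Lemma measurable_dilate n : measurable_fun setT (@dilate n).
Proof.
apply/measurable_fun_tnthP => i.
rewrite (_ : _ \o _ = dilate1 \o (fun u : T n => tnth u i)); last first.
  by apply/funext => u /=; rewrite tnth_map.
by apply: (measurableT_comp measurable_dilate1); exact: measurable_tnth.
Qed.

Lemma cons_measureE n (A : set (T n.+1)) :
  lebesgue_tuple n.+1 A = (\int[mu]_x lebesgue_tuple n [set u | A (cons_tuple_pair (x, u))])%E.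
Proof.
rewrite [LHS]/=/cons_measure /pushforward /product_measure1.
apply: eq_integral => x _ /=; congr (lebesgue_tuple n _).
by apply/seteqP; split=> u /=; rewrite /xsection /= inE.
Qed.

Lemma measurable_cons_section n (A : set (T n.+1)) : measurable A ->
  measurable_fun setT (fun x : measurableTypeR R => lebesgue_tuple n [set u | A (cons_tuple_pair (x, u))]).
Proof.
move=> mA.
have mB : measurable (@cons_tuple_pair R n @^-1` A).
  by rewrite -[X in measurable X]setTI; exact: measurable_cons_tuple_pair.
have := measurable_fun_xsection (lebesgue_tuple n) mB.
rewrite (_ : _ \o _ = (fun x => lebesgue_tuple n [set u | A (cons_tuple_pair (x, u))]))//.
apply/funext => x /=; congr (lebesgue_tuple n _).
by apply/seteqP; split=> u /=; rewrite /xsection /= inE.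
Qed.

(** One coordinate at a time, by the one-dimensional change of variables in each section. *)
Lemma lebesgue_tuple_dilate n (A : set (T n)) : measurable A ->
  lebesgue_tuple n A = ((k ^+ n)%:E * lebesgue_tuple n (@dilate n @^-1` A))%E.
Proof.
elim: n A => [|n IH] A mA.
  rewrite expr0 mul1e; congr (lebesgue_tuple 0 _); apply/seteqP.
  by split=> u /=; rewrite (tuple0 u) (tuple0 (dilate _)).
rewrite !cons_measureE integral_dilate1//; last exact: measurable_cons_section.
rewrite exprS EFinM -muleA; congr (_ * _)%E.
rewrite -ge0_integralZl//; last first.
- by rewrite lee_fin exprn_ge0// ltW.
- apply: measurable_cons_section.
  by rewrite -[X in measurable X]setTI; exact: measurable_dilate.
apply: eq_integral => x _; rewrite IH; last first.
  have mB : measurable (@cons_tuple_pair R n @^-1` A).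
    by rewrite -[X in measurable X]setTI; exact: measurable_cons_tuple_pair.
  have := measurable_xsection (dilate1 x) mB.
  by rewrite (_ : xsection _ _ = [set u | A (cons_tuple_pair (dilate1 x, u))])//;
    apply/seteqP; split=> u /=; rewrite /xsection /= inE.
congr (_ * lebesgue_tuple n _)%E; apply/seteqP.
have E u : dilate (cons_tuple_pair (x, u)) = cons_tuple_pair (dilate1 x, dilate u) by exact/val_inj.
by split=> u /=; rewrite E.
Qed.

End Dilation.

(** * Sums over boxes of multi-indices *)

Section Boxes.
Context {R : realType} {n : nat}.
Local Notation I := {ffun 'I_n -> nat}.
Implicit Types (N M : nat) (mu : I) (a b : I -> R).

Definition boxseq N : seq I := [seq [ffun i => val (nu i)] | nu : {ffun 'I_n -> 'I_N}].

Lemma boxseq_uniq N : uniq (boxseq N).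
Proof.
rewrite map_inj_uniq ?enum_uniq// => f g /ffunP fg; apply/ffunP => i.
by apply/val_inj; have := fg i; rewrite !ffunE.
Qed.

Lemma mem_boxseq N mu : (mu \in boxseq N) = [forall i, (mu i < N)%N].
Proof.
apply/mapP/forallP => [[nu _ ->] i|H]; first by rewrite ffunE ltn_ord.
exists [ffun i => Ordinal (H i)]; first by rewrite mem_enum.
by apply/ffunP => i; rewrite !ffunE.
Qed.

Lemma boxseq_sub N M : (N <= M)%N -> {subset boxseq N <= boxseq M}.
Proof.
move=> NM mu; rewrite !mem_boxseq => /forallP H; apply/forallP => i.
exact: leq_trans NM.
Qed.

Lemma boxseq_max mu N : (\max_i mu i < N)%N -> mu \in boxseq N.
Proof.
move=> H; rewrite mem_boxseq; apply/forallP => i.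
by apply: leq_ltn_trans H; exact: (leq_bigmax i).
Qed.

Lemma boxseq_seq (s : seq I) : exists N, {subset s <= boxseq N}.
Proof.
exists (\max_(mu <- s) \max_i mu i).+1 => mu ms; apply: boxseq_max; rewrite ltnS.
exact: (@leq_bigmax_seq _ s xpredT (fun mu => \max_i mu i)).
Qed.

(** Boxes rather than balls of multi-indices, because box sums of products factor into
    one-dimensional sums. *)
Definition boxsum N a := \sum_(mu <- boxseq N) a mu.

Lemma boxsum_prod N (g : 'I_n -> nat -> R) :
  boxsum N (fun mu => \prod_i g i (mu i)) = \prod_i \sum_(0 <= k < N) g i k.
Proof.
rewrite /boxsum big_map big_enum /=.
under [RHS]eq_bigr do rewrite big_mkord.
rewrite bigA_distr_bigA /=; apply: eq_bigr => nu _.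
by apply: eq_bigr => i _; rewrite ffunE.
Qed.

Lemma sum_sub_uniq (T : eqType) (s1 s2 : seq T) (F : T -> R) : uniq s1 -> uniq s2 ->
  {subset s1 <= s2} -> (forall x, 0 <= F x) -> \sum_(x <- s1) F x <= \sum_(x <- s2) F x.
Proof.
move=> u1 u2 s12 F0; rewrite [leRHS](bigID (mem s1))/=.
have -> : \sum_(x <- s1) F x = \sum_(x <- s2 | x \in s1) F x.
  rewrite -[RHS]big_filter; apply: perm_big; apply: uniq_perm => //; first exact: filter_uniq.
  by move=> x; rewrite mem_filter; case: (boolP (x \in s1)) => //= /s12 ->.
by rewrite lerDl sumr_ge0.
Qed.

Lemma boxsum_le N M a : (N <= M)%N -> (forall mu, 0 <= a mu) -> boxsum N a <= boxsum M a.
Proof.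
by move=> NM a0; apply: sum_sub_uniq => //; [exact: boxseq_uniq..|exact: boxseq_sub].
Qed.

Lemma esum_le_seq a (B : \bar R) : (forall mu, 0 <= a mu) ->
  (forall N, (boxsum N a)%:E <= B)%E -> (\esum_(mu in [set: I]) (a mu)%:E <= B)%E.
Proof.
move=> a0 H; apply: ub_ereal_sup => _ [X [fX _] <-].
rewrite fsbig_finite//= sumEFin.
have [N sN] := boxseq_seq (finmap.enum_fset (fset_set X)); apply: le_trans (H N).
by rewrite lee_fin; apply: sum_sub_uniq => //; [exact: finmap.fset_uniq|exact: boxseq_uniq].
Qed.

Lemma boxsum_le_esum N a : ((boxsum N a)%:E <= \esum_(mu in [set: I]) (a mu)%:E)%E.
Proof.
apply: esum_ge; exists [set` boxseq N]; first by split; [exact: finite_seq|].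
by rewrite -fsbig_seq ?boxseq_uniq// sumEFin lee_fin.
Qed.

(** A summable majorant with product structure; every series over multi-indices here is
    dominated by a multiple of it. *)
Definition inv_sqr_prod mu : R := \prod_i inv_sqr (mu i).

(** Bound for the sum of the majorant outside a box. *)
Definition box_tail N : R := n%:R * 2 ^+ n * (2 / N.+1%:R).

Lemma boxsum_inv_sqr_prod N : boxsum N inv_sqr_prod = (\sum_(0 <= k < N) inv_sqr k) ^+ n.
Proof. by rewrite (boxsum_prod N (fun _ => @inv_sqr R)) prodr_const card_ord. Qed.

Lemma exprB_le (x y c : R) m : 0 <= y <= x -> x <= c -> 1 <= c ->
  x ^+ m - y ^+ m <= m%:R * c ^+ m * (x - y).
Proof.
move=> /andP[y0 yx] xc c1; elim: m => [|m IH]; first by rewrite !expr0 subrr !mul0r.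
have c0 : 0 <= c by apply: le_trans c1.
have -> : x ^+ m.+1 - y ^+ m.+1 = x * (x ^+ m - y ^+ m) + y ^+ m * (x - y).
  by rewrite !exprS; ring.
have H1 : x * (x ^+ m - y ^+ m) <= c * (m%:R * c ^+ m * (x - y)).
  apply: ler_pM => //; first exact: le_trans yx.
  by rewrite subr_ge0 lerXn2r// nnegrE// (le_trans y0).
have H2 : y ^+ m * (x - y) <= c ^+ m.+1 * (x - y).
  rewrite ler_wpM2r ?subr_ge0// exprS; apply: (@le_trans _ _ (c ^+ m)).
    by rewrite lerXn2r ?nnegrE// (le_trans yx).
  by rewrite ler_peMl// exprn_ge0.
apply: le_trans (lerD H1 H2) _; rewrite -natr1 exprS.
by apply: le_of_eq; ring.
Qed.

Lemma boxsum_inv_sqr_prod_tail N M : (N <= M)%N -> boxsum M inv_sqr_prod - boxsum N inv_sqr_prod <= box_tail N.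
Proof.
move=> NM; rewrite !boxsum_inv_sqr_prod.
have S0 K L : 0 <= \sum_(K <= k < L) inv_sqr k :> R.
  by apply: sumr_ge0 => i _; exact/ltW/inv_sqr_gt0.
have S2 K : \sum_(0 <= k < K) inv_sqr k <= 2 :> R.
  by have := @sum_inv_sqr_le R 0 K (leq0n K); rewrite divr1.
have E : \sum_(0 <= k < M) inv_sqr k = \sum_(0 <= k < N) inv_sqr k + \sum_(N <= k < M) inv_sqr k :> R.
  by rewrite -big_cat_nat.
apply: (@le_trans _ _ (n%:R * 2 ^+ n * (\sum_(N <= k < M) inv_sqr k))).
  have := @exprB_le (\sum_(0 <= k < M) inv_sqr k) (\sum_(0 <= k < N) inv_sqr k) 2 n.
  rewrite S0 S2 ler1n {1}E lerDl S0 => /(_ isT isT isT)/le_trans; apply.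
  by rewrite E addrAC subrr add0r.
by rewrite /box_tail ler_wpM2l ?mulr_ge0 ?exprn_ge0// sum_inv_sqr_le.
Qed.

Lemma box_tail_ge0 N : 0 <= box_tail N.
Proof. by rewrite /box_tail !mulr_ge0 ?exprn_ge0. Qed.

(** The upper bound comes from the monotonicity in N of the box sums of D * inv_sqr_prod - b. *)
Lemma esum_box_tail b (D : R) N : (forall mu, 0 <= b mu) -> (forall mu, b mu <= D * inv_sqr_prod mu) ->
  boxsum N b <= fine (\esum_(mu in [set: I]) (b mu)%:E) <= boxsum N b + D * box_tail N.
Proof.
move=> b0 bD; have D0 : 0 <= D.
  have := le_trans (b0 [ffun=> 0%N]) (bD [ffun=> 0%N]).
  rewrite pmulr_lge0//; apply: prodr_gt0 => i _; exact: inv_sqr_gt0.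
have ub : (\esum_(mu in [set: I]) (b mu)%:E <= (boxsum N b + D * box_tail N)%:E)%E.
  apply: esum_le_seq => // M; rewrite lee_fin.
  have [NM|/ltnW MN] := leqP N M; last first.
    by apply: le_trans (boxsum_le MN b0) _; rewrite lerDl mulr_ge0// box_tail_ge0.
  have K : boxsum N (fun mu => D * inv_sqr_prod mu - b mu) <= boxsum M (fun mu => D * inv_sqr_prod mu - b mu).
    by apply: boxsum_le => // mu; rewrite subr_ge0.
  move: K; rewrite /boxsum !sumrB -!mulr_sumr -/(boxsum N inv_sqr_prod) -/(boxsum M inv_sqr_prod) -/(boxsum N b) -/(boxsum M b).
  have := ler_wpM2l D0 (boxsum_inv_sqr_prod_tail NM); rewrite mulrBr; lra.
have lb := boxsum_le_esum N b.
have fn : \esum_(mu in [set: I]) (b mu)%:E \is a fin_num.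
  rewrite ge0_fin_numE; first exact: le_lt_trans ub (ltry _).
  by apply: esum_ge0 => mu _; rewrite lee_fin.
by rewrite -!lee_fin fineK// lb ub.
Qed.

Lemma real_usum_tail a (D : R) N : (forall mu, `|a mu| <= D * inv_sqr_prod mu) ->
  `|real_usum a - boxsum N a| <= D * box_tail N.
Proof.
move=> H; rewrite /real_usum.
have mx (x y : R) : `|x| <= y -> 0 <= Num.max x 0 <= y.
  move=> xy; rewrite le_max lexx orbT /= ge_max (le_trans (normr_ge0 x) xy).
  by rewrite (le_trans (ler_norm x) xy).
have /andP[p1 p2] := @esum_box_tail (fun mu => Num.max (a mu) 0) D N
  (fun mu => proj1 (andP (mx _ _ (H mu)))) (fun mu => proj2 (andP (mx _ _ (H mu)))).
have H' mu : `|- a mu| <= D * inv_sqr_prod mu by rewrite normrN.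
have /andP[q1 q2] := @esum_box_tail (fun mu => Num.max (- a mu) 0) D N
  (fun mu => proj1 (andP (mx _ _ (H' mu)))) (fun mu => proj2 (andP (mx _ _ (H' mu)))).
have E : boxsum N a = boxsum N (fun mu => Num.max (a mu) 0) - boxsum N (fun mu => Num.max (- a mu) 0).
  rewrite /boxsum -sumrB; apply: eq_bigr => mu _.
  by rewrite !maxEle; case: (leP (a mu) 0) => h; case: (leP (- a mu) 0) => h'; lra.
rewrite E ler_norml.
move: p1 p2 q1 q2; set P := fine _; set Q := fine _; set p := boxsum _ _; set q := boxsum _ _.
by move=> p1 p2 q1 q2; apply/andP; split; lra.
Qed.

Lemma real_usum_le a (D : R) : (forall mu, `|a mu| <= D * inv_sqr_prod mu) ->
  `|real_usum a| <= D * (n.+1%:R * 2 ^+ n.+1).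
Proof.
move=> H; have D0 : 0 <= D.
  have := le_trans (normr_ge0 _) (H [ffun=> 0%N]).
  rewrite pmulr_lge0//; apply: prodr_gt0 => i _; exact: inv_sqr_gt0.
have := real_usum_tail 0 H.
have B : `|boxsum 0 a| <= D * 2 ^+ n.
  apply: le_trans (ler_norm_sum _ _ _) _.
  apply: (@le_trans _ _ (D * boxsum 0 inv_sqr_prod)); first by rewrite /boxsum mulr_sumr ler_sum.
  rewrite ler_wpM2l// boxsum_inv_sqr_prod big_nil lerXn2r ?nnegrE//.
have E : D * (n.+1%:R * 2 ^+ n.+1) = D * box_tail 0 + 2 * (D * 2 ^+ n).
  by rewrite /box_tail divr1 -natr1 exprS; ring.
move=> H1; rewrite -[real_usum a](subrK (boxsum 0 a)).
apply: le_trans (ler_normD _ _) _; rewrite E; apply: lerD => //.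
apply: le_trans B _; have : 0 <= D * 2 ^+ n by rewrite mulr_ge0 ?exprn_ge0.
lra.
Qed.

End Boxes.

(** * Heat sums with polynomially bounded coefficients *)

Section HeatExpansion.
Context {R : realType} {n : nat}.
Local Notation I := {ffun 'I_n -> nat}.
Local Notation T := (n.-tuple (measurableTypeR R)).
Local Notation m := (@lebesgue_tuple R n).
Local Notation leb := (@lebesgue_measure R).
Implicit Types (mu nu : I) (x y : 'rV[R]_n) (u : T) (t s : R) (a : I -> R).

Lemma box_tail_small (C e : R) : 0 < e ->
  exists N0, forall N, (N0 <= N)%N -> C * @box_tail R n N <= e.
Proof.
move=> e0; pose D := `|C| * (n%:R * 2 ^+ n * 2).
have D0 : 0 <= D by rewrite !mulr_ge0 ?exprn_ge0.
exists (Num.bound (D / e)) => N DN.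
have CD : C * @box_tail R n N <= D / N.+1%:R.
  apply: (@le_trans _ _ (`|C| * @box_tail R n N)); first by rewrite ler_wpM2r ?box_tail_ge0// ler_norm.
  by rewrite /D /box_tail !mulrA.
apply: le_trans CD _; rewrite ler_pdivrMr// mulrC -ler_pdivrMr//.
have De : 0 <= D / e by rewrite divr_ge0// ltW.
by apply/ltW/(lt_le_trans (archi_boundP De)); rewrite ler_nat leqW.
Qed.

(** Identities for infinite sums are proved through their box sums, up to an error that
    vanishes with the box tail. *)
Lemma eq_box_tail (x y C : R) N0 :
  (forall N, (N0 <= N)%N -> `|x - y| <= C * @box_tail R n N) -> x = y.
Proof.
move=> H; apply/eqP; rewrite -subr_eq0 -normr_le0; apply/ler_addgt0Pl => e e0.
rewrite addr0; have [N1 HN] := box_tail_small C e0.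
apply: le_trans (H (maxn N0 N1) (leq_maxl _ _)) _; exact: HN (leq_maxr _ _).
Qed.

Definition decayn t mu : R := expR (- (t * (2 * mdeg mu + n)%N%:R)).

Lemma decayn_prod t mu : decayn t mu = \prod_(i < n) decay t (mu i).
Proof.
rewrite /decay -expR_sum /decayn; congr expR.
rewrite sumrN -mulr_sumr -natr_sum; congr (- (t * _%:R)).
by rewrite big_split /= sum1_card card_ord -big_distrr.
Qed.

Lemma decayn_gt0 t mu : 0 < decayn t mu. Proof. exact: expR_gt0. Qed.

Lemma decaynD t s mu : decayn (t + s) mu = decayn t mu * decayn s mu.
Proof. by rewrite /decayn mulrDl opprD expRD. Qed.

(** The growth of the Hermite coefficients of a tempered distribution. *)
Definition polybounded a := exists (A : R) B, 0 <= A /\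
  forall mu, `|a mu| <= A * \prod_(i < n) (mu i).+1%:R ^+ B.

(** The value at x of e^(-tL) on the formal Hermite series with coefficients a. *)
Definition heat_sum a t x : R := real_usum (fun mu => decayn t mu * a mu * Phi mu x).

Lemma heat_sum_term a : polybounded a -> exists (C : R) B, 0 <= C /\ forall t x mu, 0 < t <= 1 ->
  `|decayn t mu * a mu * Phi mu x| <= C / t ^+ B * inv_sqr_prod mu.
Proof.
move=> [A [B [A0 Ha]]].
have [C [C0 HC]] := @decay_le R B.+1.
exists (A * (2 * C) ^+ n), (B.+3 * n)%N; split; first by rewrite mulr_ge0// exprn_ge0// mulr_ge0.
move=> t x mu t01; rewrite !normrM (ger0_norm (ltW (decayn_gt0 _ _))).
have HP : `|Phi mu x| <= \prod_(i < n) (2 * (mu i).+1%:R).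
  rewrite /Phi normr_prod; apply: ler_prod => i _.
  by rewrite normr_ge0 hermite_fun_le.
apply: (@le_trans _ _ (decayn t mu * (A * \prod_(i < n) (mu i).+1%:R ^+ B) * \prod_(i < n) (2 * (mu i).+1%:R))).
  apply: ler_pM => //; first by rewrite mulr_ge0// ltW// decayn_gt0.
  by rewrite ler_wpM2l// ltW// decayn_gt0.
have -> : A * (2 * C) ^+ n / t ^+ (B.+3 * n) * inv_sqr_prod mu = A * \prod_(i < n) (2 * C / t ^+ B.+3 * inv_sqr (mu i)).
  by rewrite big_split /= prodr_const card_ord [(2 * C / _) ^+ n]exprMn exprVn -exprM !mulrA.
have -> : decayn t mu * (A * \prod_(i < n) (mu i).+1%:R ^+ B) * \prod_(i < n) (2 * (mu i).+1%:R) =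
    A * \prod_(i < n) (decay t (mu i) * (mu i).+1%:R ^+ B * (2 * (mu i).+1%:R)).
  by rewrite decayn_prod !big_split /=; ring.
rewrite ler_wpM2l//.
apply: ler_prod => i _.
rewrite !mulr_ge0 ?decay_ge0 ?exprn_ge0//=.
apply: (@le_trans _ _ (2 * (decay t (mu i) * (mu i).+1%:R ^+ B.+1))).
  by rewrite exprS; apply: le_of_eq; ring.
by rewrite -!mulrA ler_wpM2l// !mulrA HC.
Qed.

Lemma heat_sum_tail a : polybounded a -> exists (C : R) B, 0 <= C /\ forall t x N, 0 < t <= 1 ->
  `|heat_sum a t x - boxsum N (fun mu => decayn t mu * a mu * Phi mu x)| <= C / t ^+ B * @box_tail R n N.
Proof.
move=> /heat_sum_term [C [B [C0 H]]]; exists C, B; split => // t x N t01.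
by apply: real_usum_tail => mu; exact: H.
Qed.

Lemma heat_sum_bound a : polybounded a -> exists (C : R) B, 0 <= C /\ forall t x, 0 < t <= 1 ->
  `|heat_sum a t x| <= C / t ^+ B.
Proof.
move=> /heat_sum_term [C [B [C0 H]]]; exists (C * (n.+1%:R * 2 ^+ n.+1)), B; split.
  by rewrite !mulr_ge0 ?exprn_ge0.
move=> t x t01; rewrite mulrAC; apply: real_usum_le => mu; exact: H.
Qed.

Lemma Phi_row mu u : Phi mu (row_of_tuple u) = tuple_prod (fun i => hermite_fun (mu i)) u.
Proof. by rewrite /Phi /tuple_prod; apply: eq_bigr => i _; rewrite mxE. Qed.

Lemma measurable_Phi mu : measurable_fun setT (fun u => Phi mu (row_of_tuple u)).
Proof.
under eq_fun do rewrite Phi_row.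
by apply: measurable_tuple_prod => i; exact: measurable_hermite_fun.
Qed.

Lemma integrable_Phi mu : m.-integrable setT (EFin \o (fun u => Phi mu (row_of_tuple u))).
Proof.
have -> : (fun u => Phi mu (row_of_tuple u)) = tuple_prod (fun i => hermite_fun (mu i)).
  by apply/funext => u; rewrite Phi_row.
by apply: (tuple_prod_integral _).1 => i; exact: integrable_hermite_fun.
Qed.

(** Integrals of products of one-dimensional functions factor. *)
Lemma Phi_orthonormal mu nu :
  m.-integrable setT (EFin \o (fun u => Phi mu (row_of_tuple u) * Phi nu (row_of_tuple u))) /\
  \int[m]_u (Phi mu (row_of_tuple u) * Phi nu (row_of_tuple u)) = (mu == nu)%:R.
Proof.
have -> : (fun u => Phi mu (row_of_tuple u) * Phi nu (row_of_tuple u)) =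
    tuple_prod (fun i (z : R) => hermite_fun (mu i) z * hermite_fun (nu i) z).
  by apply/funext => u; rewrite !Phi_row /tuple_prod -big_split.
have [|Ii ->] := @tuple_prod_integral R n (fun i (z : R) => hermite_fun (mu i) z * hermite_fun (nu i) z).
  by move=> i; exact: integrable_hermite_fun2.
split => //; under eq_bigr do rewrite hermite_orthonormal.
case: (eqVneq mu nu) => [->|mn]; first by rewrite big1// => i _; rewrite eqxx.
have /existsP[i ni] : [exists i, mu i != nu i].
  rewrite -negb_forall; apply: contra mn => /forallP H.
  by apply/eqP/ffunP => i; exact/eqP.
by rewrite (bigD1 i)//= (negbTE ni) mul0r.
Qed.

Lemma measurable_heat_sum a t : polybounded a -> 0 < t <= 1 ->
  measurable_fun setT (fun u => heat_sum a t (row_of_tuple u)).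
Proof.
move=> /heat_sum_tail [C [B [C0 H]]] t01.
apply: (@measurable_fun_cvg _ _ _ _ (fun N u => boxsum N (fun mu => decayn t mu * a mu * Phi mu (row_of_tuple u)))).
  move=> N; apply: measurable_sum => mu _.
  apply: measurable_funM => //; exact: measurable_Phi.
move=> u _; apply/cvgrPdist_le => e e0.
have [N0 HN] := box_tail_small (C / t ^+ B) e0.
by exists N0 => // N /= NN; apply: le_trans (H _ _ _ t01) (HN N NN).
Qed.

End HeatExpansion.

(** * Semigroup identity, coefficients and Bessel's inequality *)

Section BoundedFactor.
Context d {T : measurableType d} {R : realType} (m : {measure set T -> \bar R}).
Implicit Types (f g : T -> R) (B e : R).

Lemma integrable_bounded_mul f g B : measurable_fun setT f -> (forall u, `|f u| <= B) ->
  m.-integrable setT (EFin \o g) -> m.-integrable setT (EFin \o (fun u => f u * g u)).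
Proof.
move=> mf fB Ig; have mg : measurable_fun setT g by apply/measurable_EFinP; exact: measurable_int Ig.
have := integrableZl measurableT B Ig; apply: le_integrable => //.
  by apply/measurable_EFinP; exact: measurable_funM.
move=> u _ /=; rewrite lee_fin !normrM ler_wpM2r//.
by apply: le_trans (fB u) _; exact: ler_norm.
Qed.

Lemma Rintegral_mul_close f1 f2 g B1 B2 e : measurable_fun setT f1 -> measurable_fun setT f2 ->
  (forall u, `|f1 u| <= B1) -> (forall u, `|f2 u| <= B2) ->
  (forall u, `|f1 u - f2 u| <= e) -> m.-integrable setT (EFin \o g) ->
  `|\int[m]_u (f1 u * g u) - \int[m]_u (f2 u * g u)| <= e * \int[m]_u `|g u|.
Proof.
move=> m1 m2 b1 b2 fe Ig.
have I1 := integrable_bounded_mul m1 b1 Ig.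
have I2 := integrable_bounded_mul m2 b2 Ig.
have I12 : m.-integrable setT (EFin \o (fun u => f1 u * g u - f2 u * g u)).
  by have := integrableB measurableT I1 I2; apply: eq_integrable.
have Ig' : m.-integrable setT (EFin \o (fun u => `|g u|)) by exact: integrable_norm.
rewrite -RintegralB//; apply: le_trans (le_normr_Rintegral measurableT I12) _.
rewrite -RintegralZl//; apply: le_Rintegral => //.
- exact: integrable_norm.
- by have := integrableZl measurableT e Ig'; apply: eq_integrable.
- by move=> u _; rewrite -mulrBl normrM ler_wpM2r.
Qed.

Lemma RintegralD_sum (J : eqType) (s : seq J) (h : J -> T -> R) :
  (forall j, m.-integrable setT (EFin \o h j)) ->
  m.-integrable setT (EFin \o (fun u => \sum_(j <- s) h j u)) /\
  \int[m]_u (\sum_(j <- s) h j u) = \sum_(j <- s) \int[m]_u h j u.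
Proof.
move=> Ih; elim: s => [|j s [IHi IHe]].
  have E : (fun u => \sum_(j <- [::]) h j u) = cst 0 by apply/funext => u; rewrite big_nil.
  rewrite E big_nil; split; last by rewrite /Rintegral /= integral0.
  exact: integrable0.
have E : (fun u => \sum_(j <- j :: s) h j u) = (fun u => h j u + \sum_(j <- s) h j u).
  by apply/funext => u; rewrite big_cons.
rewrite E big_cons; split; last by rewrite RintegralD// IHe.
by have := integrableD measurableT (Ih j) IHi; apply: eq_integrable.
Qed.

End BoundedFactor.

Section HeatSemigroup.
Context {R : realType} {n : nat}.
Local Notation I := {ffun 'I_n -> nat}.
Local Notation T := (n.-tuple (measurableTypeR R)).
Local Notation m := (@lebesgue_tuple R n).
Local Notation leb := (@lebesgue_measure R).
Implicit Types (mu nu : I) (u : T) (t s : R) (a : I -> R).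

(** Termwise integration of the series of the kernel, legitimate because the partial sums
    converge uniformly and the Hermite function is integrable. *)
Lemma integral_heat1_hermite t (x : R) k : 0 < t <= 1 ->
  leb.-integrable setT (EFin \o (fun y => heat1 t x y * hermite_fun k y)) /\
  \int[leb]_y (heat1 t x y * hermite_fun k y) = decay t k * hermite_fun k x.
Proof.
move=> /[dup] t01 /andP[t0 t1].
have mbd y : `|heat1 t x y| <= (Num.sqrt t)^-1 by rewrite ger0_norm ?heat1_ge0// heat1_le.
have mm := measurable_heat1 x t0.
have Ih := @integrable_hermite_fun R k.
split; first by have := @integrable_bounded_mul _ _ R leb (heat1 t x) (hermite_fun k) _ mm mbd Ih.
have [C [B [C0 H]]] := @heat1_der_tail R 0 0.
pose p N (y : R) := \sum_(0 <= j < N) decay t j * hermite_fun j x * hermite_fun j y.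
have mp N : measurable_fun setT (p N).
  by apply: measurable_sum => j; apply: measurable_funM => //; exact: measurable_hermite_fun.
have close N y : `|heat1 t x y - p N y| <= C / t ^+ B / N.+1%:R.
  by have := H t x y N t01; rewrite expr0 !mul1r heat1_der0.
have pb N y : `|p N y| <= (Num.sqrt t)^-1 + C / t ^+ B / N.+1%:R.
  rewrite -(subrK (heat1 t x y) (p N y)) addrC; apply: le_trans (ler_normD _ _) _.
  by apply: lerD => //; rewrite distrC.
have ip N : (k < N)%N -> \int[leb]_y (p N y * hermite_fun k y) = decay t k * hermite_fun k x.
  move=> kN; have -> : (fun y => p N y * hermite_fun k y) = (fun y => \sum_(j <- index_iota 0 N)
      (decay t j * hermite_fun j x) * (hermite_fun j y * hermite_fun k y)).
    by apply/funext => y; rewrite mulr_suml; apply: eq_bigr => j _; rewrite !mulrA.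
  have Ij j := @integrable_hermite_fun2 R j k.
  have [|_ ->] := @RintegralD_sum _ _ R leb _ (index_iota 0 N)
    (fun j y => (decay t j * hermite_fun j x) * (hermite_fun j y * hermite_fun k y)).
    by move=> j; have := integrableZl measurableT (decay t j * hermite_fun j x) (Ij j); apply: eq_integrable.
  rewrite (bigD1_seq k) ?mem_index_iota ?iota_uniq//= RintegralZl//.
  rewrite hermite_orthonormal eqxx mulr1 big1 ?addr0// => j jk.
  by rewrite RintegralZl// hermite_orthonormal (negbTE jk) mulr0.
(* For n = 1 the box tail is a multiple of 1/(N+1). *)
apply: (@eq_box_tail R 1 _ _ (C / t ^+ B * \int[leb]_y `|hermite_fun k y|) k.+1) => N kN.
have cl := @Rintegral_mul_close _ _ R leb (heat1 t x) (p N) (hermite_fun k) _ _ _ mm (mp N) mbd (pb N) (close N) Ih.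
rewrite -(ip N kN); apply: le_trans cl _.
have J0 : 0 <= \int[leb]_y `|hermite_fun k y| by apply: Rintegral_ge0.
have D0 : 0 <= C / t ^+ B * (\int[leb]_y `|hermite_fun k y|) by rewrite !mulr_ge0 ?invr_ge0 ?exprn_ge0 ?(ltW t0).
rewrite mulrAC ler_wpM2l// /box_tail expr1 mulrA -[leLHS]mul1r ler_wpM2r//.
lra.
Qed.

Definition tuple_kernel t (x : 'rV[R]_n) u : R := tuple_prod (fun i => heat1 t (x 0 i)) u.

Lemma tuple_kernel_ge0 t x u : 0 <= tuple_kernel t x u.
Proof. by apply: prodr_ge0 => i _; exact: heat1_ge0. Qed.

Lemma tuple_kernel_le t x u : 0 < t <= 1 -> tuple_kernel t x u <= (Num.sqrt t)^-1 ^+ n.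
Proof.
move=> t01; rewrite -[n in leRHS]card_ord -prodr_const; apply: ler_prod => i _.
by rewrite heat1_ge0 heat1_le.
Qed.

Lemma integrable_heat1 t x : 0 < t -> leb.-integrable setT (EFin \o heat1 t x).
Proof.
move=> t0; apply/integrableP; split; first by apply/measurable_EFinP; exact: measurable_heat1.
apply: le_lt_trans (ltry 1); apply: le_trans (integral_heat1_le1 x t0).
apply: le_of_eq; apply: eq_integral => y _.
by rewrite /= ger0_norm ?heat1_ge0.
Qed.

Lemma integral_tuple_kernel t x : 0 < t -> m.-integrable setT (EFin \o tuple_kernel t x) /\ \int[m]_u tuple_kernel t x u <= 1.
Proof.
move=> t0; have [|Ii ->] := @tuple_prod_integral R n (fun i => heat1 t (x 0 i)).
  by move=> i; exact: integrable_heat1.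
split => //; rewrite -[leRHS](expr1n _ n) -[n in leRHS]card_ord -prodr_const.
apply: ler_prod => i _; have I1 := integrable_heat1 (x 0 i) t0.
rewrite Rintegral_ge0 => [|y _]; last exact: heat1_ge0.
have := integral_heat1_le1 (x 0 i) t0.
by rewrite -(fineK (integrable_fin_num measurableT I1)) lee_fin.
Qed.

Lemma integral_tuple_kernel_Phi t x mu : 0 < t <= 1 ->
  m.-integrable setT (EFin \o (fun u => tuple_kernel t x u * Phi mu (row_of_tuple u))) /\
  \int[m]_u (tuple_kernel t x u * Phi mu (row_of_tuple u)) = decayn t mu * Phi mu x.
Proof.
move=> t01.
have -> : (fun u => tuple_kernel t x u * Phi mu (row_of_tuple u)) =
    tuple_prod (fun i (z : R) => heat1 t (x 0 i) z * hermite_fun (mu i) z).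
  by apply/funext => u; rewrite !Phi_row /tuple_kernel /tuple_prod -big_split.
have [|Ii ->] := @tuple_prod_integral R n (fun i (z : R) => heat1 t (x 0 i) z * hermite_fun (mu i) z).
  by move=> i; exact: (integral_heat1_hermite (x 0 i) (mu i) t01).1.
split => //; under eq_bigr do rewrite (integral_heat1_hermite _ _ t01).2.
by rewrite big_split /= decayn_prod.
Qed.

(** The operator e^(-(t/2)L), written with its kernel, is applied to the box sums at time t/2,
    which converge uniformly. *)
Lemma heat_sum_semigroup a t x : polybounded a -> 0 < t <= 1 ->
  m.-integrable setT (EFin \o (fun u => heat_sum a (t / 2) (row_of_tuple u) * tuple_kernel (t / 2) x u)) /\
  heat_sum a t x = \int[m]_u (heat_sum a (t / 2) (row_of_tuple u) * tuple_kernel (t / 2) x u).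
Proof.
move=> pa t01.
have h01 : 0 < t / 2 <= 1 by move: t01 => /andP[t0 t1]; rewrite divr_gt0//=; lra.
have h0 : 0 < t / 2 by case/andP: h01.
have [C [B [C0 H]]] := heat_sum_tail pa.
have [D [B' [D0 HD]]] := heat_sum_bound pa.
have [IK IK1] := integral_tuple_kernel x h0.
have mv := measurable_heat_sum pa h01.
have vb u : `|heat_sum a (t / 2) (row_of_tuple u)| <= D / (t / 2) ^+ B' by exact: HD.
pose p N u := boxsum N (fun mu => decayn (t / 2) mu * a mu * Phi mu (row_of_tuple u)).
have mp N : measurable_fun setT (p N).
  by apply: measurable_sum => mu; apply: measurable_funM => //; exact: measurable_Phi.
have close N u : `|heat_sum a (t / 2) (row_of_tuple u) - p N u| <= C / (t / 2) ^+ B * @box_tail R n N by exact: H.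
have pb N u : `|p N u| <= D / (t / 2) ^+ B' + C / (t / 2) ^+ B * @box_tail R n N.
  rewrite -(subrK (heat_sum a (t / 2) (row_of_tuple u)) (p N u)) addrC.
  by apply: le_trans (ler_normD _ _) _; apply: lerD => //; rewrite distrC.
split; first exact: (@integrable_bounded_mul _ _ R m _ _ _ mv vb IK).
have ip N : \int[m]_u (p N u * tuple_kernel (t / 2) x u) = boxsum N (fun mu => decayn t mu * a mu * Phi mu x).
  have -> : (fun u => p N u * tuple_kernel (t / 2) x u) = (fun u => \sum_(mu <- boxseq N)
      (decayn (t / 2) mu * a mu) * (tuple_kernel (t / 2) x u * Phi mu (row_of_tuple u))).
    by apply/funext => u; rewrite mulr_suml; apply: eq_bigr => mu _; ring.
  have Ij mu := integral_tuple_kernel_Phi x mu h01.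
  have [|_ ->] := @RintegralD_sum _ _ R m _ (@boxseq n N)
    (fun mu u => (decayn (t / 2) mu * a mu) * (tuple_kernel (t / 2) x u * Phi mu (row_of_tuple u))).
    by move=> mu; have := integrableZl measurableT (decayn (t / 2) mu * a mu) (Ij mu).1; apply: eq_integrable.
  apply: eq_bigr => mu _; rewrite RintegralZl//; last exact: (Ij mu).1.
  rewrite (Ij mu).2 [in RHS](_ : t = t / 2 + t / 2); last by field.
  by rewrite decaynD; ring.
apply: (@eq_box_tail R n _ _ (C / t ^+ B + C / (t / 2) ^+ B) 0) => N _.
have cl := @Rintegral_mul_close _ _ R m _ _ _ _ _ _ mv (mp N) vb (pb N) (close N) IK.
rewrite ip in cl.
rewrite -(subrK (boxsum N (fun mu => decayn t mu * a mu * Phi mu x)) (heat_sum a t x)) -addrA mulrDl.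
apply: le_trans (ler_normD _ _) _; apply: lerD; first exact: H.
rewrite distrC; apply: le_trans cl _.
have -> : (\int[m]_u `|tuple_kernel (t / 2) x u|) = \int[m]_u tuple_kernel (t / 2) x u.
  by apply: eq_Rintegral => u _; rewrite ger0_norm ?tuple_kernel_ge0.
rewrite ler_piMr// mulr_ge0 ?box_tail_ge0// divr_ge0// exprn_ge0// ltW//.
Qed.

Lemma heat_sum_coef a t mu : polybounded a -> 0 < t <= 1 ->
  m.-integrable setT (EFin \o (fun u => heat_sum a t (row_of_tuple u) * Phi mu (row_of_tuple u))) /\
  \int[m]_u (heat_sum a t (row_of_tuple u) * Phi mu (row_of_tuple u)) = decayn t mu * a mu.
Proof.
move=> pa t01.
have [C [B [C0 H]]] := heat_sum_tail pa.
have [D [B' [D0 HD]]] := heat_sum_bound pa.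
have IP := @integrable_Phi R n mu.
have mv := measurable_heat_sum pa t01.
have vb u : `|heat_sum a t (row_of_tuple u)| <= D / t ^+ B' by exact: HD.
pose p N u := boxsum N (fun mu => decayn t mu * a mu * Phi mu (row_of_tuple u)).
have mp N : measurable_fun setT (p N).
  by apply: measurable_sum => nu; apply: measurable_funM => //; exact: measurable_Phi.
have close N u : `|heat_sum a t (row_of_tuple u) - p N u| <= C / t ^+ B * @box_tail R n N by exact: H.
have pb N u : `|p N u| <= D / t ^+ B' + C / t ^+ B * @box_tail R n N.
  rewrite -(subrK (heat_sum a t (row_of_tuple u)) (p N u)) addrC.
  by apply: le_trans (ler_normD _ _) _; apply: lerD => //; rewrite distrC.
split; first exact: (@integrable_bounded_mul _ _ R m _ _ _ mv vb IP).
have ip N : mu \in boxseq N -> \int[m]_u (p N u * Phi mu (row_of_tuple u)) = decayn t mu * a mu.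
  move=> mN.
  have -> : (fun u => p N u * Phi mu (row_of_tuple u)) = (fun u => \sum_(nu <- boxseq N)
      (decayn t nu * a nu) * (Phi nu (row_of_tuple u) * Phi mu (row_of_tuple u))).
    by apply/funext => u; rewrite mulr_suml; apply: eq_bigr => nu _; ring.
  have Ij nu := @Phi_orthonormal R n nu mu.
  have [|_ ->] := @RintegralD_sum _ _ R m _ (@boxseq n N)
    (fun nu u => (decayn t nu * a nu) * (Phi nu (row_of_tuple u) * Phi mu (row_of_tuple u))).
    by move=> nu; have := integrableZl measurableT (decayn t nu * a nu) (Ij nu).1; apply: eq_integrable.
  rewrite (bigD1_seq mu) ?boxseq_uniq//= RintegralZl//; last exact: (Ij mu).1.
  rewrite (Ij mu).2 eqxx mulr1 big1 ?addr0// => nu nm.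
  by rewrite RintegralZl//; [rewrite (Ij nu).2 (negbTE nm) mulr0|exact: (Ij nu).1].
apply: (@eq_box_tail R n _ _ (C / t ^+ B * \int[m]_u `|Phi mu (row_of_tuple u)|) (\max_i mu i).+1) => N kN.
have cl := @Rintegral_mul_close _ _ R m _ _ _ _ _ _ mv (mp N) vb (pb N) (close N) IP.
by rewrite mulrAC -(ip N (boxseq_max kN)).
Qed.

(** Bessel's inequality: w being the partial expansion of v over A, expand the integral of
    (v - w)^2 >= 0. *)
Lemma heat_sum_bessel a t (A : seq I) : polybounded a -> 0 < t <= 1 -> uniq A ->
  ((\sum_(mu <- A) (decayn t mu * a mu) ^+ 2)%:E <=
   \int[m]_u ((heat_sum a t (row_of_tuple u)) ^+ 2)%:E)%E.
Proof.
move=> pa t01 uA; have mv := measurable_heat_sum pa t01.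
have [Ioo|Ioo] := eqVneq (\int[m]_u ((heat_sum a t (row_of_tuple u)) ^+ 2)%:E)%E (+oo)%E; first by rewrite Ioo leey.
pose v u := heat_sum a t (row_of_tuple u).
pose b mu := decayn t mu * a mu.
pose w u := \sum_(mu <- A) b mu * Phi mu (row_of_tuple u).
have Iv2 : m.-integrable setT (EFin \o (fun u => v u ^+ 2)).
  apply/integrableP; split; first by apply/measurable_EFinP; exact: measurable_funX.
  have E0 : (\int[m]_u `|(v u ^+ 2)%:E|)%E = (\int[m]_u ((heat_sum a t (row_of_tuple u)) ^+ 2)%:E)%E.
    by apply: eq_integral => u _; rewrite /= ger0_norm ?sqr_ge0.
  by rewrite E0 ltey.
have Pc mu := heat_sum_coef mu pa t01.
have [|Ivw Evw] := @RintegralD_sum _ _ R m _ A (fun mu u => b mu * (v u * Phi mu (row_of_tuple u))).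
  by move=> mu; have := integrableZl measurableT (b mu) (Pc mu).1; apply: eq_integrable.
have Ww nu : m.-integrable setT (EFin \o (fun u => \sum_(mu <- A) b mu * (Phi mu (row_of_tuple u) * Phi nu (row_of_tuple u)))) /\
   \int[m]_u (\sum_(mu <- A) b mu * (Phi mu (row_of_tuple u) * Phi nu (row_of_tuple u))) = if nu \in A then b nu else 0.
  have [|Ii ->] := @RintegralD_sum _ _ R m _ A (fun mu u => b mu * (Phi mu (row_of_tuple u) * Phi nu (row_of_tuple u))).
    by move=> mu; have := integrableZl measurableT (b mu) (@Phi_orthonormal R n mu nu).1; apply: eq_integrable.
  split => //; rewrite (eq_bigr (fun mu => b mu * (mu == nu)%:R)); last first.
    move=> mu _; rewrite RintegralZl//; last exact: (@Phi_orthonormal R n _ _).1.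
    by rewrite (@Phi_orthonormal R n _ _).2.
  case: ifPn => nA.
    rewrite (bigD1_seq nu)//= eqxx mulr1 big1 ?addr0// => mu mn.
    by rewrite (negbTE mn) mulr0.
  rewrite big_seq big1// => mu mA; case: eqVneq => [E|_]; last by rewrite mulr0.
  by rewrite -E mA in nA.
have [|Iw2 Ew2] := @RintegralD_sum _ _ R m _ A (fun nu u => b nu * \sum_(mu <- A) b mu * (Phi mu (row_of_tuple u) * Phi nu (row_of_tuple u))).
  by move=> mu; have := integrableZl measurableT (b mu) (Ww mu).1; apply: eq_integrable.
have w2E : (fun u => w u ^+ 2) = (fun u => \sum_(nu <- A) b nu * \sum_(mu <- A) b mu * (Phi mu (row_of_tuple u) * Phi nu (row_of_tuple u))).
  apply/funext => u; rewrite expr2 {2}/w mulr_sumr; apply: eq_bigr => nu _.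
  by rewrite /w mulr_suml mulr_sumr; apply: eq_bigr => mu _; ring.
have vwE : (fun u => v u * w u) = (fun u => \sum_(mu <- A) b mu * (v u * Phi mu (row_of_tuple u))).
  by apply/funext => u; rewrite /w mulr_sumr; apply: eq_bigr => mu _; ring.
rewrite -w2E in Iw2 Ew2; rewrite -vwE in Ivw Evw.
have S2 : \int[m]_u (w u ^+ 2) = \sum_(mu <- A) b mu ^+ 2.
  rewrite Ew2 !big_seq; apply: eq_bigr => mu mA.
  by rewrite RintegralZl ?(Ww mu).2 ?mA ?expr2//; exact: (Ww mu).1.
have SV : \int[m]_u (v u * w u) = \sum_(mu <- A) b mu ^+ 2.
  rewrite Evw; apply: eq_bigr => mu _.
  by rewrite RintegralZl ?(Pc mu).2 ?expr2//; exact: (Pc mu).1.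
have I2 : m.-integrable setT (EFin \o (fun u => 2 * (v u * w u))).
  by have := integrableZl measurableT 2 Ivw; apply: eq_integrable.
have Is : m.-integrable setT (EFin \o (fun u => v u ^+ 2 + w u ^+ 2)).
  by have := integrableD measurableT Iv2 Iw2; apply: eq_integrable.
have : \int[m]_u (2 * (v u * w u)) <= \int[m]_u (v u ^+ 2 + w u ^+ 2).
  apply: le_Rintegral => // u _; rewrite -subr_ge0 (_ : _ - _ = (v u - w u) ^+ 2) ?sqr_ge0//; ring.
rewrite RintegralZl// RintegralD// SV S2 => K.
rewrite -(fineK (integrable_fin_num measurableT Iv2)) lee_fin.
rewrite -/(Rintegral m setT (fun u => v u ^+ 2)) -/(b _).
move: K; set X := Rintegral _ _ _; set Y := \sum_(_ <- _) _; lra.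
Qed.

End HeatSemigroup.

(** * Capped sums over geometric levels *)

Section DyadicSums.
Context {R : realType}.
Implicit Types (g c w X : R) (K N i j k : nat).

(** The sum of the geometric series with ratio 1/g. *)
Definition geo_total g : R := g / (g - 1).

Lemma geo_total_ge0 g : 1 < g -> 0 <= geo_total g.
Proof. by move=> g1; rewrite divr_ge0// ?subr_ge0 ltW// (lt_trans ltr01). Qed.

Lemma geo_sum_le g K : 1 < g -> \sum_(k < K.+1) g ^+ k <= geo_total g * g ^+ K.
Proof.
move=> g1; have g0 : 0 < g by apply: lt_trans g1.
have gm : 0 < g - 1 by rewrite subr_gt0.
elim: K => [|K IH].
  by rewrite big_ord_recr big_ord0 /= add0r expr0 mulr1 /geo_total ler_pdivlMr// mul1r gerBl.
rewrite big_ord_recr /=; apply: le_trans (lerD IH (lexx _)) _.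
rewrite exprS; apply: le_of_eq; rewrite /geo_total; field.
by rewrite gt_eqF.
Qed.

(** The terms of an increasing geometric progression that stay below X are dominated by the
    last of them. *)
Lemma geo_sum_cond g c X K : 1 < g -> 0 <= c -> 0 <= X ->
  \sum_(k < K) (if c * g ^+ k <= X then c * g ^+ k else 0) <= geo_total g * X.
Proof.
move=> g1 c0 X0; have g0 : 0 < g by apply: lt_trans g1.
elim: K => [|K IH]; first by rewrite big_ord0 mulr_ge0// geo_total_ge0.
have [H|H] := leP (c * g ^+ K) X; last first.
  by rewrite big_ord_recr /= (lt_geF H) addr0.
apply: (@le_trans _ _ (\sum_(k < K.+1) c * g ^+ k)).
  apply: ler_sum => k _; case: ifP => // _; by rewrite mulr_ge0// exprn_ge0// ltW.
rewrite -mulr_sumr; apply: le_trans (ler_wpM2l c0 (geo_sum_le K g1)) _.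
by rewrite mulrCA ler_wpM2l// geo_total_ge0.
Qed.

(** The terms of a decreasing geometric progression that are below w are dominated by the first
    of them. *)
Lemma geo_sum_inv g w K : 1 < g -> 0 <= w ->
  \sum_(k < K) (if g ^- k <= w then g ^- k else 0) <= geo_total g * w.
Proof.
move=> g1; have g0 : 0 < g by apply: lt_trans g1.
have gm : 0 < g - 1 by rewrite subr_gt0.
have gn0 : g != 0 by rewrite gt_eqF.
elim: K w => [|K IH] w w0; first by rewrite big_ord0 mulr_ge0// geo_total_ge0.
have full L : \sum_(k < L) g ^- k <= geo_total g.
  suff : \sum_(k < L) g ^- k <= geo_total g * (1 - g ^- L).
    move/le_trans; apply; rewrite ler_piMr ?geo_total_ge0// gerBl invr_ge0 exprn_ge0// ltW//.
  elim: L => [|L IHL]; first by rewrite big_ord0 expr0 invr1 subrr mulr0.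
  rewrite big_ord_recr /=; apply: le_trans (lerD IHL (lexx _)) _.
  rewrite exprS invfM; apply: le_of_eq; rewrite /geo_total; field.
  by rewrite gn0 expf_neq0//= gt_eqF.
have [w1|w1] := leP 1 w.
  apply: (@le_trans _ _ (\sum_(k < K.+1) g ^- k)).
    by apply: ler_sum => k _; case: ifP => // _; rewrite invr_ge0 exprn_ge0// ltW.
  by apply: le_trans (full _) _; rewrite ler_peMr// geo_total_ge0.
rewrite big_ord_recl /= expr0 invr1 (lt_geF w1) add0r.
rewrite (eq_bigr (fun k : 'I_K => g^-1 * (if g ^- k <= g * w then g ^- k else 0))); last first.
  move=> k _; rewrite /bump /= add1n exprS invfM ler_pdivrMl//.
  by case: ifP => //; rewrite mulr0.
rewrite -mulr_sumr ler_pdivrMl// mulrCA.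
by apply: IH; rewrite mulr_ge0// ltW.
Qed.

Lemma sqr_sum_le K (x : nat -> R) : (forall j, 0 <= x j) ->
  (\sum_(j < K) x j) ^+ 2 <= 2 * \sum_(j < K) (x j * \sum_(k < j.+1) x k).
Proof.
move=> x0; elim: K => [|K IH]; first by rewrite !big_ord0 mulr0 expr0n.
rewrite big_ord_recr [in leRHS]big_ord_recr /= [\sum_(k < K.+1) x k]big_ord_recr /=.
set S := \sum_(i < K) x i in IH *; set Z := \sum_(j < K) _ in IH *.
have xx : 0 <= x K * x K by rewrite mulr_ge0.
have -> : (S + x K) ^+ 2 = S ^+ 2 + 2 * (x K * S) + x K * x K by ring.
have -> : 2 * (Z + x K * (S + x K)) = 2 * Z + 2 * (x K * S) + 2 * (x K * x K) by ring.
lra.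
Qed.

Variables D th : R.
Hypotheses (D1 : 1 < D) (th1 : 1 < th).

Let D0 : 0 < D. Proof. exact: lt_trans D1. Qed.
Let th0 : 0 < th. Proof. exact: lt_trans th1. Qed.

Variables (c : R) (w : nat -> R) (K : nat).
Hypotheses (c0 : 0 <= c) (w0 : forall j, 0 <= w j).

Let b j := c * th ^+ j.
Let b0 j : 0 <= b j. Proof. by rewrite mulr_ge0// exprn_ge0// ltW. Qed.

Lemma b_geo j : \sum_(k < j.+1) b k <= geo_total th * b j.
Proof.
rewrite -mulr_sumr; apply: le_trans (ler_wpM2l c0 (geo_sum_le j th1)) _.
by rewrite mulrCA.
Qed.

(** The data are b_j = l_j^(p/2) and the measures w_j of superlevel sets at dyadic levels l_j;
    D^i stands for t^(-n/2) at time t = 2^-i, and min (1, D^i w_j) bounds the integral of the heat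
    kernel over the j-th superlevel set. *)
Definition capped_sum i : R := \sum_(j < K) b j * Num.min 1 (D ^+ i * w j).

Lemma capped_sum_ge0 i : 0 <= capped_sum i.
Proof.
apply: sumr_ge0 => j _; rewrite mulr_ge0// le_min ler01 /= mulr_ge0// exprn_ge0// ltW//.
Qed.

(** Split each capped sum into the levels where D^i w_j >= 1 and the others, and write its
    square as a sum over pairs k <= j. In both parts the sum over k or over i is geometric: for the
    first, b is geometric in k and D^-i is summed over D^-i <= w_j; for the second, D^i w_k is
    summed over D^i w_k <= 1. *)
Lemma sum_capped_sum_sqr N : \sum_(i < N) D ^- i * capped_sum i ^+ 2 <=
  8 * geo_total th * geo_total D * \sum_(j < K) b j ^+ 2 * w j.
Proof.
(* x collects the levels where the minimum is 1, y those where it is below 1. *)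
pose x i j := if 1 <= D ^+ i * w j then b j else 0.
pose y i j := if 1 <= D ^+ i * w j then 0 else b j * (D ^+ i * w j).
have Dw i j : 0 <= D ^+ i * w j by rewrite mulr_ge0// exprn_ge0// ltW.
have x0 i j : 0 <= x i j by rewrite /x; case: ifP.
have y0 i j : 0 <= y i j by rewrite /y; case: ifP => // _; rewrite mulr_ge0.
have JE i : capped_sum i = \sum_(j < K) x i j + \sum_(j < K) y i j.
  rewrite /capped_sum -big_split /=; apply: eq_bigr => j _; rewrite /x /y minEle.
  by case: ifP => _; rewrite ?mulr1 ?addr0 ?add0r.
have Di i : 0 < D ^- i by rewrite invr_gt0 exprn_gt0.
have DK i : D ^- i * D ^+ i = 1 by rewrite mulVf// expf_neq0// gt_eqF.
set W := \sum_(j < K) _.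
have X2 i : (\sum_(j < K) x i j) ^+ 2 <= 2 * geo_total th * \sum_(j < K) b j ^+ 2 * (if 1 <= D ^+ i * w j then 1 else 0).
  apply: le_trans (sqr_sum_le K (x0 i)) _; rewrite -mulrA ler_wpM2l// mulr_sumr.
  apply: ler_sum => j _; rewrite {1}/x; case: ifP => _; last by rewrite mul0r !mulr0.
  rewrite mulr1 expr2 mulrCA ler_wpM2l//.
  by apply: le_trans (b_geo j); apply: ler_sum => k _; rewrite /x; case: ifP.
have SX : \sum_(i < N) D ^- i * (\sum_(j < K) x i j) ^+ 2 <= 2 * geo_total th * geo_total D * W.
  apply: (@le_trans _ _ (\sum_(i < N) 2 * geo_total th * \sum_(j < K) b j ^+ 2 * (if D ^- i <= w j then D ^- i else 0))).
    apply: ler_sum => i _; apply: le_trans (ler_wpM2l (ltW (Di i)) (X2 i)) _.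
    rewrite [leLHS]mulrCA; apply: ler_wpM2l; first by rewrite mulr_ge0 ?geo_total_ge0.
    rewrite mulr_sumr; apply: ler_sum => j _.
    rewrite mulrCA ler_wpM2l ?sqr_ge0//.
    have -> : (1 <= D ^+ i * w j) = (D ^- i <= w j).
      by rewrite -(ler_pM2l (Di i)) mulr1 mulrA DK mul1r.
    by case: ifP => _; rewrite ?mulr1 ?mulr0.
  rewrite -mulr_sumr -[leRHS]mulrA; apply: ler_wpM2l; first by rewrite mulr_ge0 ?geo_total_ge0.
  rewrite exchange_big /= /W mulr_sumr; apply: ler_sum => j _.
  by rewrite -mulr_sumr mulrCA ler_wpM2l ?sqr_ge0// geo_sum_inv.
have SY : \sum_(i < N) D ^- i * (\sum_(j < K) y i j) ^+ 2 <= 2 * geo_total th * geo_total D * W.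
  apply: (@le_trans _ _ (\sum_(i < N) 2 * \sum_(j < K) \sum_(k < j.+1) (b j * w j * b k) *
      (if w k * D ^+ i <= 1 then w k * D ^+ i else 0))).
    apply: ler_sum => i _.
    apply: le_trans (ler_wpM2l (ltW (Di i)) (sqr_sum_le K (y0 i))) _.
    rewrite mulrCA ler_wpM2l// mulr_sumr; apply: ler_sum => j _.
    rewrite !mulr_sumr; apply: ler_sum => k _.
    have yj : y i j <= b j * (D ^+ i * w j) by rewrite /y; case: ifP => // _; rewrite mulr_ge0.
    have yk : y i k <= b k * (if w k * D ^+ i <= 1 then w k * D ^+ i else 0).
      rewrite /y (mulrC (w k)); case: (leP 1) => H; last by rewrite (ltW H).
      by rewrite mulr_ge0//; case: ifP.
    apply: (@le_trans _ _ (D ^- i * (b j * (D ^+ i * w j) * (b k * (if w k * D ^+ i <= 1 then w k * D ^+ i else 0))))).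
      by rewrite ler_wpM2l ?(ltW (Di i))// ler_pM.
    set e := (if _ then _ else _); apply: le_of_eq.
    transitivity ((D ^- i * D ^+ i) * (b j * w j * b k * e)); first by ring.
    by rewrite DK mul1r.
  rewrite -mulr_sumr -!mulrA ler_wpM2l// exchange_big /= /W !mulr_sumr; apply: ler_sum => j _.
  rewrite exchange_big /=.
  apply: (@le_trans _ _ (\sum_(k < j.+1) (b j * w j * b k) * geo_total D)).
    apply: ler_sum => k _; rewrite -mulr_sumr; apply: ler_wpM2l.
      by apply: mulr_ge0; [apply: mulr_ge0|].
    by have := @geo_sum_cond D (w k) 1 N D1 (w0 k) ler01; rewrite mulr1.
  rewrite -mulr_suml -mulr_sumr.
  apply: (@le_trans _ _ (b j * w j * (geo_total th * b j) * geo_total D)); last first.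
    by apply: le_of_eq; rewrite /geo_total; ring.
  apply: ler_wpM2r; first exact: geo_total_ge0.
  by apply: ler_wpM2l; [apply: mulr_ge0|exact: b_geo].
apply: (@le_trans _ _ (\sum_(i < N) (2 * (D ^- i * (\sum_(j < K) x i j) ^+ 2) + 2 * (D ^- i * (\sum_(j < K) y i j) ^+ 2)))).
  apply: ler_sum => i _; rewrite JE.
  set X := \sum_(j < K) x i j; set Y := \sum_(j < K) y i j.
  have -> : 2 * (D ^- i * X ^+ 2) + 2 * (D ^- i * Y ^+ 2) = D ^- i * (2 * X ^+ 2 + 2 * Y ^+ 2) by ring.
  rewrite ler_wpM2l ?(ltW (Di i))// -subr_ge0 (_ : _ - _ = (X - Y) ^+ 2) ?sqr_ge0//; ring.
rewrite big_split /= -!mulr_sumr.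
have -> : 8 * geo_total th * geo_total D * W = 2 * (2 * geo_total th * geo_total D * W) + 2 * (2 * geo_total th * geo_total D * W) by ring.
lra.
Qed.

End DyadicSums.

(** * Summation over dyadic times *)

Section PowerSums.
Context {R : realType}.
Implicit Types (r a b : R).

(** With c / (a + b) <= 1 its r-th power is larger, for c = a and c = b. *)
Lemma powRD_le r a b : 0 < r -> r <= 1 -> 0 <= a -> 0 <= b ->
  (a + b) `^ r <= a `^ r + b `^ r.
Proof.
move=> r0 r1 a0 b0; have [->|s0] := eqVneq (a + b) 0.
  by rewrite powR0 ?gt_eqF// addr_ge0 ?powR_ge0.
have sp : 0 < a + b by rewrite lt_neqAle eq_sym s0 addr_ge0.
have key c : 0 <= c -> c <= a + b -> c / (a + b) * (a + b) `^ r <= c `^ r.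
  move=> c0 cs; have [->|cn0] := eqVneq c 0; first by rewrite !mul0r powR_ge0.
  rewrite -[X in _ <= X `^ r](divfK s0) powRM ?divr_ge0 ?(ltW sp)//.
  rewrite ler_wpM2r ?powR_ge0//; apply: ger1_powR => //.
  have cp : 0 < c by rewrite lt_neqAle eq_sym cn0.
  by rewrite divr_gt0//= ler_pdivrMr// mul1r.
have E : (a + b) `^ r = a / (a + b) * (a + b) `^ r + b / (a + b) * (a + b) `^ r.
  by rewrite -mulrDl -mulrDl mulfV// mul1r.
by rewrite E; apply: lerD; apply: key => //; rewrite ?lerDl ?lerDr.
Qed.

Lemma powR_sum_le r K (x : nat -> R) : 0 < r -> r <= 1 -> (forall j, 0 <= x j) ->
  (\sum_(j < K) x j) `^ r <= \sum_(j < K) x j `^ r.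
Proof.
move=> r0 r1 x0; elim: K => [|K IH]; first by rewrite !big_ord0 powR0 ?gt_eqF.
rewrite !big_ord_recr /=; apply: le_trans (powRD_le r0 r1 _ (x0 K)) _.
  exact: sumr_ge0.
by rewrite lerD2r.
Qed.

Variables D th : R.
Hypotheses (D1 : 1 < D) (th1 : 1 < th).
Let D0 : 0 < D. Proof. exact: lt_trans D1. Qed.

Variables (c : R) (w : nat -> R) (K : nat) (r : R) (l M : nat -> R) (kap : R).
Hypotheses (c0 : 0 <= c) (w0 : forall j, 0 <= w j) (r0 : 0 < r) (r1 : r < 1).
Hypothesis l0 : forall j, 0 < l j.
Hypothesis lb : forall j, l j `^ (2 * r) = (c * th ^+ j) ^+ 2.
Hypothesis M0 : forall i, 0 <= M i.
Hypothesis kap0 : 0 <= kap.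
Hypothesis MJ : forall i, M i `^ (2 * r) <= kap * capped_sum D th c w K i ^+ 2.

Let b j := c * th ^+ j.
Let D' := D `^ (1 - r).

Let D'1 : 1 < D'.
Proof.
have E : 1 `^ (1 - r) = 1 :> R by rewrite powR1.
by rewrite /D' -[ltLHS]E gt0_ltr_powR ?subr_gt0// nnegrE// ltW.
Qed.

Let D'D i : D' ^- i = (D ^- i) `^ (1 - r).
Proof.
rewrite /D' -powR_mulrn ?powR_ge0// -powR_mulrn ?(ltW D0)// -!powRN -!powRrM.
by congr (_ `^ _); ring.
Qed.

Definition level_const : R := geo_total (D `^ (1 - r)) + geo_total (th ^+ 2) * (kap * (8 * geo_total th * geo_total D)).

(** After the r-th power has been distributed over the levels, compare D^-i with w_j. If
    D^-i <= w_j, the sum over i is geometric and gives w_j^r w_j^(1-r) = w_j. If w_j <= D^-i, the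
    term is at most D^-i l_j^(2r); the sum over the levels below M_i is dominated by M_i^(2r), which
    is controlled by the square of the capped sum, and sum_capped_sum_sqr applies. *)
Lemma sum_level_le N :
  \sum_(i < N) (D `^ (1 - r)) ^- i * (\sum_(j < K) (if l j < M i then l j ^+ 2 * w j else 0)) `^ r
  <= level_const * \sum_(j < K) (c * th ^+ j) ^+ 2 * w j.
Proof.
have th21 : 1 < th ^+ 2 by rewrite exprn_egt1.
have Di i : 0 < D ^- i by rewrite invr_gt0 exprn_gt0.
set W := \sum_(j < K) (c * th ^+ j) ^+ 2 * w j.
have step i : (D `^ (1 - r)) ^- i * (\sum_(j < K) (if l j < M i then l j ^+ 2 * w j else 0)) `^ r <=
   \sum_(j < K) b j ^+ 2 * (w j `^ r * (if D' ^- i <= w j `^ (1 - r) then D' ^- i else 0)) +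
   D ^- i * \sum_(j < K) (if c ^+ 2 * (th ^+ 2) ^+ j <= M i `^ (2 * r) then c ^+ 2 * (th ^+ 2) ^+ j else 0).
  have D'i : 0 <= D' ^- i by rewrite invr_ge0 exprn_ge0// powR_ge0.
  have nn j : 0 <= (if l j < M i then l j ^+ 2 * w j else 0).
    by case: ifP => // _; rewrite mulr_ge0 ?sqr_ge0.
  apply: le_trans (ler_wpM2l D'i (powR_sum_le K r0 (ltW r1) nn)) _.
  rewrite !mulr_sumr -big_split /=; apply: ler_sum => j _.
  have b2 : b j ^+ 2 = c ^+ 2 * (th ^+ 2) ^+ j by rewrite /b exprMn -!exprM mulnC.
  have rhs1 : 0 <= b j ^+ 2 * (w j `^ r * (if D' ^- i <= w j `^ (1 - r) then D' ^- i else 0)).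
    by rewrite mulr_ge0 ?sqr_ge0// mulr_ge0 ?powR_ge0//; case: ifP.
  have rhs2 : 0 <= D ^- i * (if c ^+ 2 * (th ^+ 2) ^+ j <= M i `^ (2 * r) then c ^+ 2 * (th ^+ 2) ^+ j else 0).
    by rewrite mulr_ge0 ?(ltW (Di i))//; case: ifP => // _; rewrite -b2 sqr_ge0.
  case: ifPn => lM; last by rewrite powR0 ?gt_eqF// mulr0 addr_ge0.
  have -> : (l j ^+ 2 * w j) `^ r = b j ^+ 2 * w j `^ r.
    rewrite powRM ?sqr_ge0// -powR_mulrn ?(ltW (l0 j))// -powRrM.
    by rewrite -lb.
  have [H|H] := leP (D' ^- i) (w j `^ (1 - r)).
    rewrite H in rhs1 *; apply: ler_wpDr => //.
    by rewrite mulrCA [w j `^ r * _]mulrC.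
  have wD : w j <= D ^- i.
    rewrite leNgt; apply/negP => H2; move: H; rewrite D'D ltNge => /negP; apply.
    by rewrite ge0_ler_powR ?subr_ge0 ?nnegrE ?(ltW r1) ?(ltW (Di i)) ?(ltW H2)// (ltW).
  have cM : c ^+ 2 * (th ^+ 2) ^+ j <= M i `^ (2 * r).
    rewrite -b2 -lb ge0_ler_powR ?nnegrE ?(ltW (l0 j)) ?(ltW lM)//.
    by rewrite mulr_ge0// ltW.
  rewrite cM in rhs2 *; rewrite /= !mulr0 add0r -b2 mulrCA mulrC ler_wpM2r ?sqr_ge0//.
  rewrite D'D; apply: (@le_trans _ _ ((D ^- i) `^ (1 - r) * (D ^- i) `^ r)).
    by rewrite ler_wpM2l ?powR_ge0// ge0_ler_powR ?nnegrE ?(ltW r0) ?(ltW (Di i)).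
  by rewrite -powRD ?subrK ?powRr1 ?(ltW (Di i)) ?oner_eq0.
apply: le_trans; first by apply: ler_sum => i _; exact: step.
rewrite big_split /= /level_const [leRHS]mulrDl; apply: lerD.
  rewrite exchange_big /= /W mulr_sumr; apply: ler_sum => j _.
  rewrite -mulr_sumr mulrCA; apply: ler_wpM2l; first exact: sqr_ge0.
  rewrite -mulr_sumr; apply: le_trans (ler_wpM2l (powR_ge0 _ _) (geo_sum_inv N D'1 (powR_ge0 _ _))) _.
  rewrite mulrCA ler_wpM2l ?geo_total_ge0// -powRD; last by rewrite addrC subrK oner_eq0.
  by rewrite addrC subrK powRr1.
apply: (@le_trans _ _ (\sum_(i < N) geo_total (th ^+ 2) * kap * (D ^- i * capped_sum D th c w K i ^+ 2))).
  apply: ler_sum => i _.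
  have := @geo_sum_cond R (th ^+ 2) (c ^+ 2) (M i `^ (2 * r)) K th21 (sqr_ge0 c) (powR_ge0 _ _).
  move=> H; apply: le_trans (ler_wpM2l (ltW (Di i)) H) _.
  apply: le_trans (ler_wpM2l (ltW (Di i)) (ler_wpM2l (geo_total_ge0 th21) (MJ i))) _.
  by apply: le_of_eq; ring.
rewrite -mulr_sumr -[leRHS]mulrA -[leLHS]mulrA; apply: ler_wpM2l; first exact: geo_total_ge0.
rewrite -[leRHS]mulrA; apply: ler_wpM2l => //.
exact: sum_capped_sum_sqr.
Qed.

End PowerSums.

(** * Dyadic levels *)

Section Layers.
Context {R : realType}.

(** The dyadic numbers 2^(j-K). For j < 2K they form a window that exhausts all dyadic levels
    as K grows; every estimate is made in a window, with constants independent of K. *)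
Definition dyadic_level (K j : nat) : R := 2 ^- K * 2 ^+ j.

Lemma dyadic_level_gt0 K j : 0 < dyadic_level K j.
Proof. by rewrite mulr_gt0 ?invr_gt0 ?exprn_gt0. Qed.

Lemma dyadic_levelS K j : dyadic_level K.+1 j.+1 = dyadic_level K j.
Proof. by rewrite /dyadic_level !exprS invfM mulrACA mulVf// mul1r. Qed.

(** The largest level below v is at least v / 2; if there is none, v <= 2^-K. *)
Lemma layer_le (K J : nat) (e v : R) : 0 < e -> 0 <= v -> v <= dyadic_level K J ->
  v `^ e <= (2 ^- K) `^ e + \sum_(j < J) (if dyadic_level K j < v then (2 * dyadic_level K j) `^ e else 0).
Proof.
move=> e0 v0; elim: J => [|J IH] vJ.
  by rewrite big_ord0 addr0 ge0_ler_powR ?nnegrE ?(ltW e0) ?invr_ge0 ?exprn_ge0//; move: vJ; rewrite /dyadic_level expr0 mulr1.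
rewrite big_ord_recr /=; have [vl|lv] := leP v (dyadic_level K J).
  by rewrite /= addr0 IH.
apply: ler_wpDl; last apply: ler_wpDl.
- exact: powR_ge0.
- by apply: sumr_ge0 => j _; case: ifP => // _; exact: powR_ge0.
- rewrite ge0_ler_powR ?nnegrE ?(ltW e0)// ?mulr_ge0 ?(ltW (dyadic_level_gt0 _ _))//.
  by rewrite (le_trans vJ)// /dyadic_level exprS mulrCA.
Qed.

Lemma dyadic_level_unbounded (v : R) : exists K0, forall K, (K0 <= K)%N -> v <= dyadic_level K (2 * K).
Proof.
exists (Num.bound `|v|) => K hK; rewrite /dyadic_level mul2n -addnn exprD mulKf ?expf_neq0//.
apply: le_trans (ler_norm v) _; apply: ltW.
apply: lt_le_trans (archi_boundP (normr_ge0 v)) _; rewrite -natrX ler_nat.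
by apply: leq_trans hK _; exact: ltnW (ltn_expl _ _).
Qed.

Lemma expV2_small (e eps : R) : 0 < e -> 0 < eps -> exists K0, forall K, (K0 <= K)%N -> (2 ^- K) `^ e <= eps.
Proof.
move=> e0 eps0; pose z : R := eps `^ e^-1.
have z0 : 0 < z by exact: powR_gt0.
exists (Num.bound z^-1) => K hK.
have -> : eps = z `^ e by rewrite /z -powRrM mulVf ?gt_eqF// powRr1// ltW.
rewrite ge0_ler_powR ?nnegrE ?(ltW e0) ?(ltW z0) ?invr_ge0 ?exprn_ge0//.
rewrite -[leRHS]invrK lef_pV2 ?posrE ?exprn_gt0 ?invr_gt0//.
have zi : 0 <= z^-1 by rewrite invr_ge0 ltW.
apply: ltW; apply: lt_le_trans (archi_boundP zi) _; rewrite -natrX ler_nat.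
by apply: leq_trans hK _; exact: ltnW (ltn_expl _ _).
Qed.

Lemma sum_dyadic_level_mono (F : R -> R) K K' : (K <= K')%N -> (forall x, 0 <= F x) ->
  \sum_(j < 2 * K) F (dyadic_level K j) <= \sum_(j < 2 * K') F (dyadic_level K' j).
Proof.
move=> KK F0; rewrite -(subnKC KK); elim: (K' - K)%N => [|d IH]; first by rewrite addn0.
apply: le_trans IH _; rewrite addnS mulnS add2n big_ord_recl big_ord_recr /=.
rewrite ler_wpDl// ler_wpDr//; apply: le_of_eq.
by apply: eq_bigr => j _; rewrite /bump /= add1n dyadic_levelS.
Qed.

(** A single window whose sum is within a factor 2 of all others, in place of the limit over
    windows. *)
Lemma sup_approx (g : nat -> R) (B : R) : (forall k, 0 <= g k) ->
  {homo g : k k' / (k <= k')%N >-> k <= k'} -> (forall k, g k <= B) ->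
  exists k0, forall k, g k <= 2 * g k0.
Proof.
move=> g0 gm gB; pose E := range g.
have hs : has_sup E by split; [exists (g 0%N), 0%N|exists B => _ [k _ <-]].
have ub k : g k <= sup E by apply: sup_upper_bound => //; exists k.
have [s0|s0] := leP (sup E) 0.
  exists 0%N => k; apply: le_trans (ub k) _; apply: le_trans s0 _.
  by rewrite mulr_ge0.
have s2 : 0 < sup E / 2 by rewrite divr_gt0.
have [_ [k0 _ <-] H] := sup_adherent s2 hs.
exists k0 => k; apply: le_trans (ub k) _; lra.
Qed.

Lemma sup_approx_fin (g : nat -> nat -> R) N : (forall i k, 0 <= g i k) ->
  (forall i, {homo g i : k k' / (k <= k')%N >-> k <= k'}) ->
  (forall i, exists B, forall k, g i k <= B) ->
  exists k0, forall i, (i < N)%N -> forall k, g i k <= 2 * g i k0.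
Proof.
move=> g0 gm gB; elim: N => [|N [k0 IH]]; first by exists 0%N.
have [B HB] := gB N; have [k1 H1] := sup_approx (g0 N) (gm N) HB.
exists (maxn k0 k1) => i; rewrite ltnS leq_eqVlt => /predU1P[->|iN] k.
  by apply: le_trans (H1 k) _; rewrite ler_wpM2l// gm// leq_maxr.
by apply: le_trans (IH i iN k) _; rewrite ler_wpM2l// gm// leq_maxl.
Qed.

(** The exponents z^k tend to 0 so fast that they bring any exponential growth in k to 1. *)
Lemma self_improve (z C : R) B (L v : R) : 0 < z -> z < 1 -> 1 <= C -> 0 <= L ->
  (forall k, v <= L * (C * 2 ^+ (B * k)) `^ (z ^+ k)) -> v <= L.
Proof.
move=> z0 z1 C1 L0 H.
have C0 : 0 < C by apply: lt_le_trans C1.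
have cv : (fun k => L * (C * 2 ^+ (B * k)) `^ (z ^+ k)) @ \oo --> L.
  rewrite -[X in _ --> X]mulr1; apply: cvgMl_tmp.
  have E k : (C * 2 ^+ (B * k)) `^ (z ^+ k) = expR (z ^+ k * (ln C + k%:R * (B%:R * ln 2))).
    rewrite /powR gt_eqF ?mulr_gt0 ?exprn_gt0//; congr (expR (_ * _)).
    rewrite lnM ?posrE ?exprn_gt0//; congr (_ + _).
    by rewrite lnXn// -[ln 2 *+ _]mulr_natr natrM; ring.
  set al := ln C in E; set be := B%:R * ln 2 in E.
  have su : subexp (fun k => al + k%:R * be).
    apply: subexp_le (subexpZ (`|al| + `|be|) (@subexp_nat R)) _ => k.
    apply: le_trans (ler_norm _); rewrite mulrDl.
    apply: le_trans (ler_normD _ _) _; apply: lerD; first by rewrite ler_peMr// ler1n.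
    by rewrite normrM mulrC ler_wpM2l// normr_nat ler_nat.
  have z1' : `|z| < 1 by rewrite ger0_norm// ltW.
  have c0 : (fun k => z ^+ k * (al + k%:R * be)) @ \oo --> (0 : R).
    have := cvg_series_cvg_0 (subexp_cvg su z1').
    by under eq_fun do rewrite mulrC.
  have : (fun k => expR (z ^+ k * (al + k%:R * be))) @ \oo --> expR (0 : R).
    by apply: continuous_cvg => //; exact: continuous_expR.
  by rewrite expR0; under [in X in _ -> X]eq_fun do rewrite E.
by apply: (cvgr_to_ge cv); apply: nearW => k; exact: H.
Qed.

End Layers.

(** * Bounding the heat sum at time t by its supremum at time t/2 *)

Section OneStep.
Context {R : realType} {n : nat}.
Local Notation I := {ffun 'I_n -> nat}.
Local Notation T := (n.-tuple (measurableTypeR R)).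
Local Notation m := (@lebesgue_tuple R n).
Implicit Types (u : T) (t s : R) (a : I -> R) (x : 'rV[R]_n).

(** The kernel has mass at most 1 and is bounded by s^(-n/2). *)
Lemma kernel_indic_le s x (A : set T) (om : R) : 0 < s <= 1 -> measurable A -> (m A <= om%:E)%E ->
  m.-integrable setT (EFin \o (fun u => \1_A u * tuple_kernel s x u)) /\
  \int[m]_u (\1_A u * tuple_kernel s x u) <= Num.min 1 ((Num.sqrt s)^-1 ^+ n * om).
Proof.
move=> s01 mA mom; have s0 : 0 < s by case/andP: s01.
have [IK IK1] := integral_tuple_kernel x s0.
have m1 : measurable_fun setT (\1_A : T -> R) by exact: measurable_indic.
have b1 u : `|\1_A u : R| <= 1 by rewrite indicE; case: (_ \in _); rewrite ?normr1// normr0.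
have I1 := @integrable_bounded_mul _ _ R m _ _ _ m1 b1 IK.
split => //; rewrite le_min; apply/andP; split.
  apply: le_trans IK1; apply: le_Rintegral => // u _.
  by rewrite ler_piMl ?tuple_kernel_ge0// (le_trans (ler_norm _)).
have c0 : 0 <= (Num.sqrt s)^-1 ^+ n by rewrite exprn_ge0// invr_ge0 sqrtr_ge0.
have mAoo : (m A < +oo)%E by apply: le_lt_trans mom (ltry _).
have Ii : m.-integrable setT (EFin \o (\1_A : T -> R)).
  apply/integrableP; split; first exact/measurable_EFinP.
  rewrite (_ : (\int[m]_u _)%E = (\int[m]_u ((\1_A : T -> R) u)%:E)%E); last first.
    by apply: eq_integral => u _; rewrite /= ger0_norm// indicE.
  by rewrite integral_indic// setIT.
have Ic : m.-integrable setT (EFin \o (fun u => (Num.sqrt s)^-1 ^+ n * (\1_A : T -> R) u)).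
  by have := integrableZl measurableT ((Num.sqrt s)^-1 ^+ n) Ii; apply: eq_integrable.
apply: (@le_trans _ _ (\int[m]_u ((Num.sqrt s)^-1 ^+ n * (\1_A : T -> R) u))).
  apply: le_Rintegral => // u _; rewrite mulrC ler_wpM2r ?tuple_kernel_le//.
rewrite RintegralZl// ler_wpM2l// /Rintegral integral_indic// setIT.
by rewrite -lee_fin fineK// ge0_fin_numE.
Qed.

Lemma measurable_superlevel a t (l : R) : polybounded a -> 0 < t <= 1 ->
  measurable [set u : T | l < `|heat_sum a t (row_of_tuple u)|].
Proof.
move=> pa t01; have mv := measurable_heat_sum pa t01.
have mn : measurable_fun setT (fun u : T => `|heat_sum a t (row_of_tuple u)|) by apply: measurableT_comp.
have mb : measurable_fun setT (fun u : T => l < `|heat_sum a t (row_of_tuple u)|).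
  exact: (measurable_fun_ltr (measurable_cst l) mn).
have := mb measurableT [set true] Logic.I.
by rewrite setTI.
Qed.

(** Write v(t) as the kernel applied to v(t/2), interpolate |v(t/2)| <= B^(1-q) |v(t/2)|^q, and
    cut |v(t/2)|^q into dyadic layers, each integrated with kernel_indic_le. The bound B enters
    only with the power 1-q. *)
Lemma sup_improve a t (q B A : R) (om : R -> R) : polybounded a -> 0 < t <= 1 ->
  0 < q -> q < 1 -> 0 <= B ->
  (forall x, `|heat_sum a (t / 2) x| <= B) ->
  (forall l : R, 0 < l -> (m [set u | (l < `|heat_sum a (t / 2) (row_of_tuple u)|)%R] <= (om l)%:E)%E) ->
  (forall K, \sum_(j < 2 * K) (2 * dyadic_level K j) `^ q * Num.min 1 ((Num.sqrt (t / 2))^-1 ^+ n * om (dyadic_level K j)) <= A) ->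
  forall x, `|heat_sum a t x| <= B `^ (1 - q) * A.
Proof.
move=> pa t01 q0 q1 B0 vB mom sA x.
have h01 : 0 < t / 2 <= 1 by move: t01 => /andP[t0 t1]; rewrite divr_gt0//=; lra.
have h0 : 0 < t / 2 by case/andP: h01.
have [Iv ->] := heat_sum_semigroup x pa t01.
have [IK IK1] := integral_tuple_kernel x h0.
pose v u := heat_sum a (t / 2) (row_of_tuple u).
apply/ler_addgt0Pr => e e0.
have b0 : 0 <= B `^ (1 - q) := powR_ge0 _ _.
have e1 : 0 < e / (B `^ (1 - q) + 1) by rewrite divr_gt0// ltr_wpDl.
have [K0 H0] := dyadic_level_unbounded B.
have [K1 H1] := expV2_small q0 e1.
pose K := maxn K0 K1.
pose S j := [set u | dyadic_level K j < `|v u|].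
have mS j : measurable (S j) by exact: measurable_superlevel.
have KI j := @kernel_indic_le (t / 2) x (S j) (om (dyadic_level K j)) h01 (mS j) (mom _ (dyadic_level_gt0 _ _)).
pose g u := B `^ (1 - q) * ((2 ^- K) `^ q * tuple_kernel (t / 2) x u +
  \sum_(j < 2 * K) (2 * dyadic_level K j) `^ q * (\1_(S j) u * tuple_kernel (t / 2) x u)).
have IKd : m.-integrable setT (EFin \o (fun u => (2 ^- K) `^ q * tuple_kernel (t / 2) x u)).
  by have := integrableZl measurableT ((2 ^- K) `^ q) IK; apply: eq_integrable.
have [|Is Es] := @RintegralD_sum _ _ R m _ (index_enum 'I_(2 * K))
  (fun j u => (2 * dyadic_level K j) `^ q * (\1_(S j) u * tuple_kernel (t / 2) x u)).
  by move=> j; have := integrableZl measurableT ((2 * dyadic_level K j) `^ q) (KI j).1; apply: eq_integrable.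
have Isum : m.-integrable setT (EFin \o (fun u => (2 ^- K) `^ q * tuple_kernel (t / 2) x u +
   \sum_(j < 2 * K) (2 * dyadic_level K j) `^ q * (\1_(S j) u * tuple_kernel (t / 2) x u))).
  by have := integrableD measurableT IKd Is; apply: eq_integrable.
have Ig : m.-integrable setT (EFin \o g).
  by have := integrableZl measurableT (B `^ (1 - q)) Isum; apply: eq_integrable.
have point u : `|v u * tuple_kernel (t / 2) x u| <= g u.
  rewrite normrM (ger0_norm (tuple_kernel_ge0 _ _ _)).
  (* |v| = |v|^(1-q) |v|^q, the first factor being bounded by the supremum. *)
  have vq : `|v u| <= B `^ (1 - q) * `|v u| `^ q.
    have [->|vn0] := eqVneq (v u) 0; first by rewrite normr0 mulr_ge0 ?powR_ge0.
    apply: (@le_trans _ _ (`|v u| `^ (1 - q) * `|v u| `^ q)).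
      by rewrite -powRD ?subrK ?powRr1 ?oner_eq0.
    by rewrite ler_wpM2r ?powR_ge0// ge0_ler_powR ?nnegrE ?subr_ge0 ?(ltW q1)// vB.
  apply: le_trans (ler_wpM2r (tuple_kernel_ge0 _ _ _) vq) _.
  rewrite -mulrA; apply: ler_wpM2l => //.
  have vK : `|v u| <= dyadic_level K (2 * K) by apply: le_trans (vB _) (H0 K (leq_maxl _ _)).
  apply: le_trans (ler_wpM2r (tuple_kernel_ge0 _ _ _) (layer_le q0 (normr_ge0 _) vK)) _.
  rewrite mulrDl lerD2l mulr_suml; apply: ler_sum => j _.
  rewrite indicE; case: ifPn => H; first by rewrite mem_set// mul1r.
  by rewrite !mul0r mulr_ge0 ?powR_ge0// mulr_ge0 ?tuple_kernel_ge0.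
apply: le_trans (le_normr_Rintegral measurableT Iv) _.
apply: (@le_trans _ _ (\int[m]_u g u)).
  by apply: le_Rintegral => //; [exact: integrable_norm|move=> u _; exact: point].
rewrite /g RintegralZl// RintegralD// RintegralZl// Es mulrDr addrC; apply: lerD.
  apply: ler_wpM2l => //; apply: le_trans (sA K); apply: ler_sum => j _.
  rewrite RintegralZl//; last exact: (KI j).1.
  by rewrite ler_wpM2l ?powR_ge0// (KI j).2.
apply: (@le_trans _ _ (B `^ (1 - q) * (e / (B `^ (1 - q) + 1)))).
  apply: ler_wpM2l => //; apply: le_trans (H1 K (leq_maxr _ _)).
  by rewrite ler_piMr ?powR_ge0.
by rewrite mulrA ler_pdivrMr ?ltr_wpDl// mulrC ler_wpM2l ?(ltW e0)// lerDl.
Qed.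

End OneStep.

(** * The supremum of a heat sum *)

Section Bootstrap.
Context {R : realType} {n : nat}.
Local Notation I := {ffun 'I_n -> nat}.
Local Notation T := (n.-tuple (measurableTypeR R)).
Local Notation m := (@lebesgue_tuple R n).
Implicit Types (u : T) (t s : R) (a : I -> R) (x : 'rV[R]_n).

(** 2^(n/2), which is t^(-n/2) at t = 1/2. *)
Definition two_half_dim : R := Num.sqrt 2 ^+ n.

Lemma two_half_dim_ge1 : 1 <= two_half_dim.
Proof. by rewrite exprn_ege1// -[leLHS]sqrtr1 ler_sqrt ?ler1n. Qed.

Lemma sqrt_dyadic k : (Num.sqrt (2 ^- k : R))^-1 ^+ n = two_half_dim ^+ k.
Proof.
have E : Num.sqrt (2 ^+ k : R) = Num.sqrt 2 ^+ k.
  by elim: k => [|k IH]; [rewrite !expr0 sqrtr1|rewrite !exprS sqrtrM ?IH].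
by rewrite sqrtrV ?exprn_ge0// invrK E /two_half_dim -!exprM mulnC.
Qed.

Lemma dyadic_scale k : 0 < (2 ^- k : R) <= 1.
Proof. by rewrite invr_gt0 exprn_gt0//= invf_le1 ?exprn_gt0// exprn_ege1// ler1n. Qed.

Lemma dyadic_level_powR K j (q : R) : dyadic_level K j `^ q = (2 ^- K) `^ q * (2 `^ q) ^+ j.
Proof.
rewrite /dyadic_level powRM ?invr_ge0 ?exprn_ge0//; congr (_ * _).
elim: j => [|j IH]; first by rewrite !expr0 powR1.
by rewrite !exprS powRM ?exprn_ge0// IH.
Qed.

Lemma min_scale_le (X Y : R) : 1 <= X -> 0 <= Y -> Num.min 1 (X * Y) <= X * Num.min 1 Y.
Proof.
move=> X1 Y0; rewrite [Num.min 1 Y]minEle; case: ifP => _.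
  by rewrite mulr1 ge_min X1.
by rewrite ge_min lexx orbT.
Qed.

Definition levsum (om : R -> R) (q : R) K i : R :=
  capped_sum two_half_dim (2 `^ q) ((2 ^- K) `^ q) (fun j => om (dyadic_level K j)) (2 * K) i.

Lemma levsumE om q K i :
  levsum om q K i = \sum_(j < 2 * K) dyadic_level K j `^ q * Num.min 1 (two_half_dim ^+ i * om (dyadic_level K j)).
Proof. by apply: eq_bigr => j _; rewrite dyadic_level_powR. Qed.

(** How the maximal function enters: om is a distribution function
    dominating that of each heat sum with time at most 1. *)
Definition superlevel_le a (om : R -> R) := forall t (l : R), 0 < t <= 1 -> 0 < l ->
  (m [set u | (l < `|heat_sum a t (row_of_tuple u)|)%R] <= (om l)%:E)%E.

(** The value at which the iteration of sup_improve settles. *)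
Definition sup_bound (q A : R) : R := (2 `^ q * two_half_dim `^ (q^-1) * A) `^ (q^-1).

Lemma sup_bound_gt0 q A : 0 < A -> 0 < sup_bound q A.
Proof.
move=> A0; rewrite powR_gt0// mulr_gt0// mulr_gt0 ?powR_gt0//.
exact: lt_le_trans two_half_dim_ge1.
Qed.

(** Iterate sup_improve along the times t, t/2, t/4, ... The starting bound, polynomial in
    2^k at the k-th time, is only raised to the power (1-q)^k, so that its influence disappears
    by self_improve. *)
Lemma heat_sum_sup_le a om q A i : polybounded a -> superlevel_le a om -> (forall l, 0 <= om l) ->
  0 < q -> q < 1 -> 0 < A -> (forall K, levsum om q K i <= A) ->
  forall x, `|heat_sum a (2 ^- i) x| <= sup_bound q A.
Proof.
move=> pa hom om0 q0 q1 A0 hA x.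
have D1 := two_half_dim_ge1; have D0 : 0 < two_half_dim by apply: lt_le_trans D1.
pose E := two_half_dim `^ (q^-1).
have E1 : 1 <= E.
  have : 1 `^ (q^-1) <= E by rewrite ge0_ler_powR ?nnegrE ?invr_ge0 ?(ltW q0)// ltW.
  by rewrite powR1.
have E0 : 0 < E by apply: lt_le_trans E1.
have L0 := sup_bound_gt0 q A0; set L := sup_bound q A in L0 *.
have Lq : L `^ q = 2 `^ q * E * A.
  rewrite /L /sup_bound -powRrM mulVf ?gt_eqF// powRr1//.
  by rewrite !mulr_ge0 ?powR_ge0// ltW.
have Eq : E `^ q = two_half_dim by rewrite /E -powRrM mulVf ?gt_eqF// powRr1// ltW.
clearbody L E.
(* Going down k times in scale, where the starting bound exceeds the target by the factor y. *)
have boot k : forall y, 0 <= y -> (forall x, `|heat_sum a (2 ^- (i + k)) x| <= L * E ^+ k * y) ->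
    forall x, `|heat_sum a (2 ^- i) x| <= L * y `^ ((1 - q) ^+ k).
  elim: k => [|k IH] y y0 H z.
    by rewrite expr0 powRr1//; have := H z; rewrite addn0 expr0 mulr1.
  rewrite exprS powRrM; apply: IH; first exact: powR_ge0.
  move=> {}z; have hf : 2 ^- (i + k) / 2 = 2 ^- (i + k.+1) :> R by rewrite addnS exprS invfM mulrC.
  pose B := L * E ^+ k.+1 * y.
  have B0 : 0 <= B by rewrite !mulr_ge0 ?exprn_ge0// ltW.
  apply: le_trans (@sup_improve R n a (2 ^- (i + k)) q B (2 `^ q * two_half_dim ^+ k.+1 * A) om pa (dyadic_scale _) q0 q1 B0 _ _ _ z) _.
  - by rewrite hf.
  - by move=> l l0; rewrite hf; apply: hom => //; exact: dyadic_scale.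
  - move=> K; rewrite hf sqrt_dyadic.
    apply: (@le_trans _ _ (2 `^ q * two_half_dim ^+ k.+1 * levsum om q K i)); last first.
      by rewrite ler_wpM2l// mulr_ge0 ?powR_ge0 ?exprn_ge0// ltW.
    rewrite levsumE mulr_sumr; apply: ler_sum => j _.
    have X1 : 1 <= two_half_dim ^+ k.+1 by rewrite exprn_ege1.
    have Y0 : 0 <= two_half_dim ^+ i * om (dyadic_level K j) by rewrite mulr_ge0// exprn_ge0// ltW.
    have := min_scale_le X1 Y0; rewrite mulrA -exprD addnC => H'.
    have l0 : 0 <= dyadic_level K j :> R by exact: ltW (dyadic_level_gt0 K j).
    have := ler_wpM2l (powR_ge0 2 q) (ler_wpM2l (powR_ge0 (dyadic_level K j) q) H').
    rewrite powRM//.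
    move: (2 `^ q) (dyadic_level K j `^ q) (Num.min _ _) (Num.min _ _) (two_half_dim ^+ k.+1) => c1 c2 c3 c4 c5 H2.
    by rewrite -mulrA; apply: le_trans H2 _; apply: le_of_eq; ring.
  rewrite /B; apply: le_of_eq.
  rewrite !powRM ?mulr_ge0 ?exprn_ge0 ?(ltW L0) ?(ltW E0)//.
  have -> : (E ^+ k.+1) `^ (1 - q) = E ^+ k.+1 / two_half_dim ^+ k.+1.
    rewrite -Eq -[E ^+ k.+1]powR_mulrn ?(ltW E0)// -[(E `^ q) ^+ _]powR_mulrn ?powR_ge0//.
    rewrite -!powRrM -powRB ?(gt_eqF E0) ?implybT//.
    by congr (_ `^ _); ring.
  have -> : L `^ (1 - q) = L / (2 `^ q * E * A).
    by rewrite -Lq powRB ?gt_eqF ?implybT// powRr1// ltW.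
  rewrite exprS; field.
  by rewrite !gt_eqF ?exprn_gt0 ?powR_gt0.
have [C [Bd [C0 HC]]] := heat_sum_bound pa.
(* The a priori bound for the heat sum at time 2^-(i+k), relative to L. *)
pose C' := 1 + C * 2 ^+ (i * Bd) / L.
have C'1 : 1 <= C' by rewrite lerDl divr_ge0 ?(ltW L0)// mulr_ge0// exprn_ge0.
apply: (@self_improve R (1 - q) C' Bd L) => //; try lra.
move=> k; apply: boot.
  by rewrite mulr_ge0 ?exprn_ge0// (le_trans _ C'1).
move=> z; apply: le_trans (HC _ z (dyadic_scale _)) _.
have -> : C / (2 ^- (i + k)) ^+ Bd = C * (2 ^+ (i * Bd) * 2 ^+ (k * Bd)).
  by rewrite exprVn invrK -exprM mulnDl exprD.
apply: (@le_trans _ _ (L * 1 * (C' * 2 ^+ (Bd * k)))); last first.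
  rewrite ler_wpM2r ?mulr_ge0 ?exprn_ge0 ?(le_trans _ C'1)// ler_wpM2l ?(ltW L0)//.
  by rewrite exprn_ege1.
rewrite mulr1 mulrA [in leRHS]mulrA (mulnC k) ler_wpM2r ?exprn_ge0// /C' mulrDr mulr1.
by rewrite [L * (_ / _)]mulrC divfK ?gt_eqF// ler_wpDl// ltW.
Qed.

End Bootstrap.

(** * The square integral of a heat sum *)

Section SquareIntegral.
Context {R : realType} {n : nat}.
Local Notation I := {ffun 'I_n -> nat}.
Local Notation T := (n.-tuple (measurableTypeR R)).
Local Notation m := (@lebesgue_tuple R n).
Implicit Types (u : T) (t s : R) (a : I -> R) (x : 'rV[R]_n).

(** The square of v is at most 4 l^2 for the largest level l below v, and l < M. *)
Lemma layer_sqr_le (K J : nat) (v M : R) : 2 ^- K < v -> v <= dyadic_level K J -> v <= M ->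
  v ^+ 2 <= \sum_(j < J) (if dyadic_level K j < M then (2 * dyadic_level K j) ^+ 2 else 0) * (if dyadic_level K j < v then 1 else 0).
Proof.
move=> v0 vJ vM; elim: J vJ => [|J IH] vJ.
  by move: vJ; rewrite /dyadic_level expr0 mulr1 leNgt v0.
have nn j : 0 <= (if dyadic_level K j < M then (2 * dyadic_level K j) ^+ 2 else 0) * (if dyadic_level K j < v then 1 else 0) :> R.
  by rewrite mulr_ge0//; case: ifP => // _; rewrite sqr_ge0.
rewrite big_ord_recr /=; have [vl|lv] := leP v (dyadic_level K J).
  by apply: ler_wpDr; [rewrite mulr0|exact: IH].
rewrite (lt_le_trans lv vM) mulr1; apply: ler_wpDl; first by apply: sumr_ge0.
have vp : 0 <= v by rewrite ltW// (lt_trans _ v0)// invr_gt0 exprn_gt0.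
rewrite lerXn2r ?nnegrE// ?mulr_ge0 ?(ltW (dyadic_level_gt0 _ _))//.
by rewrite (le_trans vJ)// /dyadic_level exprS mulrCA.
Qed.

Definition sqsum (om : R -> R) (M : R) K : R :=
  \sum_(j < 2 * K) (if dyadic_level K j < M then dyadic_level K j ^+ 2 * om (dyadic_level K j) else 0).

(** The layers above the supremum M are empty; this truncation is what makes the integral of the
    square finite, and of the right size. *)
Lemma heat_sum_sq_le a om t (M G : R) : polybounded a -> superlevel_le a om -> 0 < t <= 1 ->
  (forall x, `|heat_sum a t x| <= M) -> (forall K, sqsum om M K <= G) ->
  (\int[m]_u ((heat_sum a t (row_of_tuple u)) ^+ 2)%:E <= (4 * G)%:E)%E.
Proof.
move=> pa hom t01 vM hG.
pose v u := heat_sum a t (row_of_tuple u).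
have mv : measurable_fun setT v := measurable_heat_sum pa t01.
pose S (l : R) := [set u | l < `|v u|].
have mS l : measurable (S l) by exact: measurable_superlevel.
(* Only values above 2^-K are seen by the K-th window; these sets exhaust the support of v. *)
pose F K := S (2 ^- K).
have mv2 : measurable_fun setT (fun u => (v u ^+ 2)%:E).
  by apply/measurable_EFinP; exact: measurable_funX.
have UF : \bigcup_K F K = [set u | v u != 0].
  apply/seteqP; split=> u /=.
    move=> [K _]; rewrite /F /S /= => H; rewrite -normr_gt0; apply: lt_trans H.
    by rewrite invr_gt0 exprn_gt0.
  move=> v0; have vp : 0 < `|v u| / 2 by rewrite divr_gt0// normr_gt0.
  have [K HK] := expV2_small ltr01 vp; exists K => //=; rewrite /F /S /=.
  have := HK K (leqnn K); rewrite powRr1 ?invr_ge0 ?exprn_ge0//; lra.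
have ndF : {homo F : K L / (K <= L)%N >-> (K <= L)%O}.
  move=> K L KL; apply/subsetPset => u; rewrite /F /S /=; apply: le_lt_trans.
  by rewrite lef_pV2 ?posrE ?exprn_gt0// ler_weXn2l// ler1n.
have cv : (\int[m]_(u in F i) (v u ^+ 2)%:E)%E @[i --> \oo] --> (\int[m]_(u in \bigcup_i F i) (v u ^+ 2)%:E)%E.
  apply: (@ge0_nondecreasing_set_cvg_integral _ _ _ F (fun u => (v u ^+ 2)%:E) m) => //.
  - by move=> K; exact: mS.
  - by move=> i; exact: measurable_funTS.
  - by move=> i u _; rewrite lee_fin sqr_ge0.
have E : (\int[m]_(u in \bigcup_i F i) (v u ^+ 2)%:E = \int[m]_u (v u ^+ 2)%:E)%E.
  rewrite integral_mkcond; apply: eq_integral => u _; rewrite /restrict UF.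
  case: ifPn => // /negP; rewrite inE /= => /negP; rewrite negbK => /eqP ->.
  by rewrite expr0n.
rewrite -/v -E.
apply: (cvge_to_le cv).
have [K0 HK0] := dyadic_level_unbounded M.
exists K0 => // K /= KK.
pose c j : R := if dyadic_level K j < M then (2 * dyadic_level K j) ^+ 2 else 0.
have c0 j : 0 <= c j by rewrite /c; case: ifP => // _; exact: sqr_ge0.
apply: (@le_trans _ _ (\int[m]_u (\sum_(j < 2 * K) (c j)%:E * (\1_(S (dyadic_level K j)) u)%:E))%E).
  rewrite integral_mkcond; apply: ge0_le_integral => //.
  - by move=> u _; rewrite /restrict; case: ifP => // _; rewrite lee_fin sqr_ge0.
  - by apply/(measurable_restrictT _ (mS _)); exact: measurable_funTS.
  - by apply: emeasurable_sum => j; apply: measurable_funeM; exact/measurable_EFinP.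
  - move=> u _; rewrite /restrict; case: ifPn => [|_]; last first.
      by apply: sume_ge0 => j _; rewrite -EFinM lee_fin mulr_ge0// indicE.
    rewrite inE /F /S /= => Hu.
    rewrite (eq_bigr (fun j : 'I_(2 * K) => (c j * (if dyadic_level K j < `|v u| then 1 else 0))%:E)); last first.
      move=> j _; rewrite -EFinM indicE; congr (_ * _)%:E.
      by case: ifPn => H; [rewrite mem_set|rewrite memNset//; apply/negP].
    rewrite sumEFin lee_fin -real_normK ?num_real//; apply: layer_sqr_le => //; last exact: vM.
    exact: le_trans (vM _) (HK0 K KK).
have mc j : measurable_fun setT (fun u => (c j)%:E * (\1_(S (dyadic_level K j)) u)%:E)%E.
  by apply: measurable_funeM; exact/measurable_EFinP.
have nc j u : (0 <= (c j)%:E * (\1_(S (dyadic_level K j)) u)%:E)%E.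
  by rewrite -EFinM lee_fin mulr_ge0// indicE.
rewrite (ge0_integral_sum m measurableT (f := fun (j : 'I_(2 * K)) u => ((c j)%:E * (\1_(S (dyadic_level K j)) u)%:E)%E))//.
apply: (@le_trans _ _ (\sum_(j < 2 * K) (c j * om (dyadic_level K j))%:E)%E).
  apply: lee_sum => j _; rewrite ge0_integralZl//.
  - rewrite integral_indic// setIT EFinM lee_wpmul2l ?lee_fin//.
    exact: (hom _ _ t01 (dyadic_level_gt0 _ _)).
  - exact/measurable_EFinP.
  - by rewrite lee_fin.
rewrite sumEFin lee_fin; apply: le_trans (ler_wpM2l (ler0n _ 4) (hG K)).
rewrite /sqsum mulr_sumr; apply: ler_sum => j _; rewrite /c; case: ifP => _; last by rewrite mul0r mulr0.
by rewrite exprMn -natrX !mulrA.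
Qed.

End SquareIntegral.

(** * From superlevel sets to coefficients *)

Section CoefficientBound.
Context {R : realType}.

Lemma exprn_powR (x : R) i (e : R) : 0 <= x -> (x `^ e) ^+ i = (x ^+ i) `^ e.
Proof.
move=> x0; elim: i => [|i IH]; first by rewrite !expr0 powR1.
by rewrite !exprS powRM ?exprn_ge0// IH.
Qed.

(** Concavity of the power, in the form: small y by monotonicity, large y by comparison with the
    linear function. *)
Lemma powR_tangent (y b r : R) : 0 <= y -> 0 < b -> 0 < r -> r <= 1 ->
  y `^ r <= b `^ r + b `^ r / b * y.
Proof.
move=> y0 b0 r0 r1; have [yb|by_] := leP y b.
  apply: ler_wpDr; first by rewrite mulr_ge0// divr_ge0 ?powR_ge0// ltW.
  by rewrite ge0_ler_powR ?nnegrE ?(ltW r0) ?(ltW b0).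
apply: ler_wpDl; first exact: powR_ge0.
have yE : y = b * (y / b) by rewrite mulrCA mulfV ?mulr1// gt_eqF.
rewrite {1}yE powRM ?(ltW b0) ?divr_ge0 ?(ltW b0)// -mulrA ler_wpM2l ?powR_ge0//.
rewrite [leRHS]mulrC; apply: ler1_powR => //.
by rewrite ler_pdivlMr// mul1r ltW.
Qed.

(** Hoelder's inequality for the counting measure, up to the factor 2: sum the previous bound
    at b equal to the mean of the squares. *)
Lemma sum_powR_holder (J : eqType) (A : seq J) (f : J -> R) (r X : R) :
  0 < r -> r < 1 -> 0 < X -> (size A)%:R <= X ->
  \sum_(j <- A) `|f j| `^ (2 * r) <= 2 * X `^ (1 - r) * (\sum_(j <- A) f j ^+ 2) `^ r.
Proof.
move=> r0 r1 X0 AX; set S := \sum_(j <- A) f j ^+ 2.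
have fE j : `|f j| `^ (2 * r) = (f j ^+ 2) `^ r.
  by rewrite powRrM powR_mulrn// real_normK ?num_real.
have S0 : 0 <= S by apply: sumr_ge0 => j _; exact: sqr_ge0.
have [Sz|Sn] := eqVneq S 0.
  rewrite Sz powR0 ?gt_eqF// mulr0 big_seq big1// => j jA.
  rewrite fE (_ : f j ^+ 2 = 0) ?powR0 ?gt_eqF//; apply/eqP.
  have /eqP := Sz; rewrite /S psumr_eq0 => [/allP /(_ j jA) //|k _]; exact: sqr_ge0.
have Sp : 0 < S by rewrite lt_neqAle eq_sym Sn.
pose b := S / X; have b0 : 0 < b by rewrite divr_gt0.
apply: (@le_trans _ _ (\sum_(j <- A) (b `^ r + b `^ r / b * f j ^+ 2))).
  by apply: ler_sum => j _; rewrite fE; apply: powR_tangent => //; [exact: sqr_ge0|exact: ltW].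
rewrite big_split /= -mulr_sumr -/S big_const_seq count_predT iter_addr addr0 -[_ *+ _]mulr_natr.
have bE : b `^ r * X = X `^ (1 - r) * S `^ r.
  rewrite /b powRM ?invr_ge0 ?(ltW Sp) ?(ltW X0)//.
  rewrite powRB ?gt_eqF ?implybT// powRr1 ?(ltW X0)// -powR_inv1 ?(ltW X0)// -powRrM mulN1r powRN.
  by ring.
have H1 : b `^ r * (size A)%:R <= X `^ (1 - r) * S `^ r by rewrite -bE ler_wpM2l ?powR_ge0.
have H2 : b `^ r / b * S = X `^ (1 - r) * S `^ r.
  rewrite -bE /b; field; by rewrite !gt_eqF.
rewrite H2; have -> : 2 * X `^ (1 - r) * S `^ r = X `^ (1 - r) * S `^ r + X `^ (1 - r) * S `^ r by ring.
by rewrite lerD2r.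
Qed.

End CoefficientBound.

Section HermiteHardy.
Context {R : realType} {n : nat}.
Hypothesis hn : (1 <= n)%N.
Local Notation I := {ffun 'I_n -> nat}.
Local Notation T := (n.-tuple (measurableTypeR R)).
Local Notation m := (@lebesgue_tuple R n).
Local Notation D := (@two_half_dim R n).
Implicit Types (u : T) (t s : R) (a : I -> R) (x : 'rV[R]_n) (mu : I).

Definition eigval mu : nat := (2 * mdeg mu + n)%N.

Lemma eigval_gt0 mu : (0 < eigval mu)%N.
Proof. by rewrite /eigval addn_gt0 hn orbT. Qed.

Lemma size_boxseq N : size (@boxseq n N) = (N ^ n)%N.
Proof. by rewrite size_map -cardE card_ffun !card_ord. Qed.

Lemma two_half_dim_sqr : D ^+ 2 = 2 ^+ n.
Proof. by rewrite /two_half_dim -exprM mulnC exprM sqr_sqrtr. Qed.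

(** The block has at most 2^(in) indices, because |mu| < 2^i there. Hoelder's inequality thus
    costs 2^(in(1-p/2)), and the weight gains 2^(-i 3n/4 (2-p)), that is 2^(-3in/2 (1-p/2)); what
    remains is 2^(-in/2 (1-p/2)). *)
Lemma block_le (A : seq I) a (p : R) i : 0 < p -> p <= 1 -> uniq A ->
  {in A, forall mu, (2 ^ i <= eigval mu < 2 ^ i.+1)%N} ->
  \sum_(mu <- A) `|a mu| `^ p / (eigval mu)%:R `^ (3 * n%:R / 4 * (2 - p)) <=
  2 * ((D `^ (1 - p / 2)) ^- i * (\sum_(mu <- A) a mu ^+ 2) `^ (p / 2)).
Proof.
move=> p0 p1 uA hA; set r := p / 2; set sg := 3 * n%:R / 4 * (2 - p).
have r0 : 0 < r by rewrite divr_gt0.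
have r1 : r < 1 by rewrite /r; lra.
have D0 : 0 < D by apply: lt_le_trans (@two_half_dim_ge1 R n).
have sg0 : 0 <= sg by rewrite !mulr_ge0 ?divr_ge0// subr_ge0; lra.
have sA : (size A)%:R <= (D ^+ i) ^+ 2.
  rewrite -exprM mulnC exprM two_half_dim_sqr -exprM mulnC exprM -natrX -natrX ler_nat.
  rewrite -(size_boxseq (2 ^ i)); apply: uniq_leq_size => // mu mA.
  rewrite mem_boxseq; apply/forallP => k.
  have /andP[_] := hA mu mA; rewrite /eigval expnS => H.
  have mk : (mu k <= mdeg mu)%N by rewrite /mdeg (bigD1 k)//= leq_addr.
  by rewrite -(ltn_pmul2l (isT : (0 < 2)%N)); apply: leq_ltn_trans H; rewrite (leq_trans _ (leq_addr _ _))// leq_mul2l.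
have Di : 0 < D ^+ i by rewrite exprn_gt0.
have Dsg : (2 ^+ i) `^ sg = (D ^+ i) `^ (3 * (1 - r)).
  have -> : sg = n%:R * (2^-1 * (3 * (1 - r))) by rewrite /sg /r; field.
  rewrite powRrM powR_mulrn ?exprn_ge0// -exprM mulnC exprM -two_half_dim_sqr -exprM mulnC exprM.
  by rewrite powRrM powR12_sqrt ?exprn_ge0// ?sqrtr_sqr ?ger0_norm ?(ltW Di)// sqr_ge0.
apply: (@le_trans _ _ (((D ^+ i) `^ (3 * (1 - r)))^-1 * \sum_(mu <- A) `|a mu| `^ (2 * r))).
  rewrite mulr_sumr big_seq [leRHS]big_seq; apply: ler_sum => mu mA.
  have -> : 2 * r = p by rewrite /r; field.
  rewrite mulrC ler_wpM2r ?powR_ge0// lef_pV2 ?posrE ?powR_gt0 ?ltr0n ?eigval_gt0//.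
  rewrite -Dsg ge0_ler_powR ?nnegrE ?exprn_ge0// -natrX ler_nat.
  by case/andP: (hA mu mA).
apply: le_trans (ler_wpM2l _ (sum_powR_holder a r0 r1 (exprn_gt0 2 Di) sA)) _.
  by rewrite invr_ge0 powR_ge0.
apply: le_of_eq.
rewrite (exprn_powR i (1 - r) (ltW D0)).
have -> : ((D ^+ i) ^+ 2) `^ (1 - r) = (D ^+ i) `^ (1 - r) * (D ^+ i) `^ (1 - r).
  by rewrite expr2 powRM ?(ltW Di).
have -> : (D ^+ i) `^ (3 * (1 - r)) = (D ^+ i) `^ (1 - r) * (D ^+ i) `^ (1 - r) * (D ^+ i) `^ (1 - r).
  have -> : 3 * (1 - r) = (1 - r) + (1 - r) + (1 - r) by ring.
  by rewrite !powRD ?(gt_eqF Di) ?implybT.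
by field; rewrite gt_eqF// powR_gt0.
Qed.

(** At time 2^-i the exponential factors are bounded below on the i-th dyadic block. *)
Lemma decayn_dyadic mu i : (eigval mu < 2 ^ i.+1)%N -> expR (- 2) <= decayn (2 ^- i) mu :> R.
Proof.
move=> H; rewrite /decayn ler_expR lerN2 -/(eigval mu) ler_pdivrMl ?exprn_gt0//.
by rewrite mulrC -exprS -natrX ler_nat ltnW.
Qed.

Lemma sqsum_mono (om : R -> R) (M : R) K K' : (forall l, 0 <= om l) -> (K <= K')%N ->
  sqsum om M K <= sqsum om M K'.
Proof.
move=> om0 KK; apply: (@sum_dyadic_level_mono R (fun l => if l < M then l ^+ 2 * om l else 0)) => // l.
by case: ifP => // _; rewrite mulr_ge0// sqr_ge0.
Qed.

Lemma levsum_mono (om : R -> R) (q : R) i K K' : (forall l, 0 <= om l) -> (K <= K')%N ->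
  @levsum R n om q K i <= @levsum R n om q K' i.
Proof.
move=> om0 KK; rewrite !levsumE.
apply: (@sum_dyadic_level_mono R (fun l => l `^ q * Num.min 1 (D ^+ i * om l))) => // l.
rewrite mulr_ge0 ?powR_ge0// le_min ler01 /= mulr_ge0// exprn_ge0//.
by apply: le_trans (@two_half_dim_ge1 R n).
Qed.

Lemma two_half_dim_gt1 : 1 < D.
Proof. by rewrite exprn_egt1// -?lt0n// -[ltLHS]sqrtr1 ltr_sqrt// ltr1n. Qed.

Lemma two_powR_gt1 (q : R) : 0 < q -> 1 < 2 `^ q :> R.
Proof.
move=> q0; have E : 1 `^ q = 1 :> R by rewrite powR1.
by rewrite -[ltLHS]E gt0_ltr_powR ?nnegrE// ltr1n.
Qed.

(** In the i-th dyadic block of eigenvalues Bessel's inequality at time 2^-i bounds the squares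
    of the coefficients by the truncated level sum of heat_sum_sq_le, with the supremum M_i of
    heat_sum_sup_le as truncation. The powers p are recovered by block_le, and the sum over the blocks
    is sum_level_le, with r = p/2. *)
Theorem hardy_of_superlevel (p : R) : 0 < p -> p <= 1 -> exists C : R, 0 < C /\
  forall a (om : R -> R) (W : R), polybounded a -> superlevel_le a om -> (forall l, 0 <= om l) ->
    (forall K, \sum_(j < 2 * K) dyadic_level K j `^ p * om (dyadic_level K j) <= W) ->
  (\esum_(mu in [set: I]) (`|a mu| `^ p / (eigval mu)%:R `^ (3 * n%:R / 4 * (2 - p)))%:E <= (C * W)%:E)%E.
Proof.
move=> p0 p1; set r := p / 2.
have r0 : 0 < r by rewrite divr_gt0.
have r1 : r < 1 by rewrite /r; lra.
have D1 := two_half_dim_gt1; have D0 : 0 < D by apply: lt_trans D1.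
have t1 := two_powR_gt1 r0; set th := 2 `^ r in t1.
pose c1 : R := 2 `^ r * D `^ (r^-1) * 2.
have c10 : 0 < c1 by rewrite mulr_gt0// mulr_gt0 ?powR_gt0.
pose kap : R := c1 ^+ 2.
pose NC := level_const D th r kap.
have NC0 : 0 <= NC.
  have D'1 : 1 < D `^ (1 - r).
    have E : 1 `^ (1 - r) = 1 :> R by rewrite powR1.
    by rewrite -[ltLHS]E gt0_ltr_powR ?subr_gt0 ?nnegrE ?(ltW D0).
  have th2 : 1 < th ^+ 2 by rewrite exprn_egt1.
  by rewrite addr_ge0 ?geo_total_ge0// mulr_ge0 ?geo_total_ge0// mulr_ge0 ?sqr_ge0// mulr_ge0 ?geo_total_ge0// mulr_ge0 ?geo_total_ge0.
pose c2 : R := expR 4 * (4 * 2).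
have c20 : 0 <= c2 by rewrite mulr_ge0 ?expR_ge0.
exists (2 * c2 `^ r * NC + 1); split.
  by rewrite ltr_wpDl// mulr_ge0// mulr_ge0// powR_ge0.
move=> a om W pa hom om0 hW.
have W0 : 0 <= W by have := hW 0%N; rewrite muln0 big_ord0.
have lp K j : (2 ^- K) `^ r * th ^+ j = dyadic_level K j `^ r by rewrite dyadic_level_powR.
have lpp K j : dyadic_level K j `^ (2 * r) = ((2 ^- K) `^ r * th ^+ j) ^+ 2 :> R.
  by rewrite lp mulrC powRrM powR_mulrn ?powR_ge0.
have p2r : 2 * r = p by rewrite /r; field.
have Wsum K : \sum_(j < 2 * K) ((2 ^- K) `^ r * th ^+ j) ^+ 2 * om (dyadic_level K j) <= W.
  by apply: le_trans (hW K); apply: ler_sum => j _; rewrite -lpp p2r.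
have cK K : 0 <= (2 ^- K) `^ r :> R by exact: powR_ge0.
have J0 i K : 0 <= @levsum R n om r K i.
  by apply: capped_sum_ge0 => // j; exact: om0.
have JB i : exists B, forall K, @levsum R n om r K i <= B.
  exists (1 + D ^+ i * (8 * geo_total th * geo_total D * W)) => K.
  have H := @sum_capped_sum_sqr R D th D1 t1 ((2 ^- K) `^ r) (fun j => om (dyadic_level K j)) (2 * K) (cK K) (fun j => om0 _) i.+1.
  have {}H := le_trans H (ler_wpM2l _ (Wsum K)).
  have g0 : 0 <= 8 * geo_total th * geo_total D by rewrite mulr_ge0 ?geo_total_ge0// mulr_ge0 ?geo_total_ge0.
  have {}H := H g0; rewrite big_ord_recr /= in H.
  set J := @levsum R n om r K i.
  have JJ : D ^- i * J ^+ 2 <= 8 * geo_total th * geo_total D * W.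
    apply: le_trans H; apply: ler_wpDl; last exact: lexx.
    by apply: sumr_ge0 => k _; rewrite mulr_ge0 ?sqr_ge0// invr_ge0 exprn_ge0// ltW.
  have J2 : J ^+ 2 <= D ^+ i * (8 * geo_total th * geo_total D * W).
    by rewrite -ler_pdivrMl ?exprn_gt0.
  have := sqr_ge0 (J - 1); rewrite sqrrB expr1n mulr1; have := J0 i K; rewrite -/J => Jn.
  lra.
apply: esum_le_seq => [mu|N].
  by rewrite divr_ge0 ?powR_ge0.
rewrite lee_fin.
pose s := @boxseq n N.
(* All eigenvalues of the box are below 2^L, and so lie in the blocks i < L. *)
pose L := (\max_(mu <- s) eigval mu)%N.
(* One window that serves for all the times 2^-i with i < L. *)
have [K0 HK0] := @sup_approx_fin R (fun i K => @levsum R n om r K i) L J0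
  (fun i K K' KK => levsum_mono r i om0 KK) JB.
pose A i := 2 * @levsum R n om r K0 i.
pose M i := (c1 / 2 * A i) `^ (r^-1).
have vM i : (i < L)%N -> forall x, `|heat_sum a (2 ^- i) x| <= M i.
  move=> iL x; rewrite /M; set v := `|heat_sum a _ x|.
  have vr : v `^ r <= c1 / 2 * A i.
    apply/ler_addgt0Pr => e e0.
    have d0 : 0 < e / (c1 / 2) by rewrite divr_gt0// divr_gt0.
    have A0 : 0 <= A i by rewrite mulr_ge0.
    have Ap : 0 < A i + e / (c1 / 2) by rewrite ltr_wpDl.
    have AK K : @levsum R n om r K i <= A i + e / (c1 / 2).
      by apply: le_trans (HK0 i iL K) _; rewrite lerDl ltW.
    have H := @heat_sum_sup_le R n a om r _ i pa hom om0 r0 r1 Ap AK x.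
    have {}H : v `^ r <= @sup_bound R n r (A i + e / (c1 / 2)) `^ r.
      have L0 := ltW (@sup_bound_gt0 R n r _ Ap); rewrite ge0_ler_powR ?nnegrE ?(ltW r0)//.
      exact: normr_ge0.
    move: H; rewrite /sup_bound -powRrM mulVf ?gt_eqF// powRr1; last first.
      by rewrite mulr_ge0 ?(ltW Ap)// mulr_ge0 ?powR_ge0.
    have -> : 2 `^ r * D `^ (r^-1) = c1 / 2 by rewrite /c1 mulfK.
    by rewrite mulrDr [X in _ + X]mulrC divfK// gt_eqF// divr_gt0.
  have v0 : 0 <= v by exact: normr_ge0.
  have -> : v = (v `^ r) `^ (r^-1) by rewrite -powRrM mulfV ?gt_eqF// powRr1.
  apply: ge0_ler_powR; rewrite ?nnegrE ?invr_ge0 ?(ltW r0) ?powR_ge0//.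
  by apply: le_trans vr; exact: powR_ge0.
have A0 i : 0 <= A i by rewrite mulr_ge0.
have M0 i : 0 <= M i by exact: powR_ge0.
have GB i : exists B, forall K, sqsum om (M i) K <= B.
  exists ((M i) `^ (2 - p) * W) => K; apply: (@le_trans _ _ ((M i) `^ (2 - p) * \sum_(j < 2 * K) dyadic_level K j `^ p * om (dyadic_level K j))); last first.
    by rewrite ler_wpM2l ?powR_ge0.
  rewrite mulr_sumr; apply: ler_sum => j _; have l0 := @dyadic_level_gt0 R K j.
  case: ifPn => lM; last by rewrite mulr_ge0 ?powR_ge0// mulr_ge0 ?powR_ge0.
  rewrite mulrA ler_wpM2r//.
  have -> : dyadic_level K j ^+ 2 = dyadic_level K j `^ (2 - p) * dyadic_level K j `^ p :> R.
    rewrite -powRD ?(gt_eqF l0) ?implybT//.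
    have -> : 2 - p + p = 2%:R by ring.
    by rewrite powR_mulrn// ltW.
  apply: ler_wpM2r; first exact: powR_ge0.
  apply: ge0_ler_powR; rewrite ?nnegrE ?(ltW l0) ?(ltW lM)//.
  by lra.
have G0 i K : 0 <= sqsum om (M i) K.
  by apply: sumr_ge0 => j _; case: ifP => // _; rewrite mulr_ge0 ?sqr_ge0.
have [K1' HK1'] := @sup_approx_fin R (fun i K => sqsum om (M i) K) L G0
  (fun i K K' KK => sqsum_mono (M i) om0 KK) GB.
(* The same for the truncated level sums, which also dominates the first window. *)
pose K1 := maxn K0 K1'.
have HK1 i : (i < L)%N -> forall K, sqsum om (M i) K <= 2 * sqsum om (M i) K1.
  move=> iL K; apply: le_trans (HK1' i iL K) _.
  by rewrite ler_wpM2l// sqsum_mono// leq_maxr.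
pose blk i := [seq mu <- s | (2 ^ i <= eigval mu < 2 ^ i.+1)%N].
have Sblk i : (i < L)%N -> \sum_(mu <- blk i) a mu ^+ 2 <= c2 * sqsum om (M i) K1.
  move=> iL.
  have V := @heat_sum_sq_le R n a om (2 ^- i) (M i) (2 * sqsum om (M i) K1) pa hom (dyadic_scale _) (vM i iL) (HK1 i iL).
  have := heat_sum_bessel pa (dyadic_scale i) (filter_uniq (fun mu => 2 ^ i <= eigval mu < 2 ^ i.+1)%N (@boxseq_uniq n N)).
  move=> /le_trans /(_ V); rewrite lee_fin -/(blk i) => Bs.
  rewrite /c2 -mulrA -[4 * 2 * _]mulrA -ler_pdivrMl ?expR_gt0// -expRN.
  apply: le_trans Bs; rewrite mulr_sumr big_seq [leRHS]big_seq; apply: ler_sum => mu.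
  rewrite mem_filter => /andP[/andP[_ mlt] _]; rewrite exprMn ler_wpM2r ?sqr_ge0//.
  have -> : expR (- 4) = expR (- 2) ^+ 2 :> R by rewrite -expRM_natl; congr expR; ring.
  by rewrite lerXn2r ?nnegrE ?expR_ge0// decayn_dyadic.
(* The index mu belongs to the block of number trunc_log 2 (eigval mu). *)
have split_sum (F : I -> R) : boxsum N F = \sum_(i < L) \sum_(mu <- blk i) F mu.
  rewrite /boxsum -/s.
  under [RHS]eq_bigr do rewrite big_filter big_mkcond /=.
  rewrite exchange_big /= big_seq [RHS]big_seq; apply: eq_bigr => mu ms.
  have lmu := eigval_gt0 mu.
  have bnd : (2 ^ trunc_log 2 (eigval mu) <= eigval mu < 2 ^ (trunc_log 2 (eigval mu)).+1)%N.
    exact: (@trunc_log_bounds 2 (eigval mu) isT lmu).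
  have tl : (trunc_log 2 (eigval mu) < L)%N.
    apply: (@leq_trans (eigval mu)); last exact: (@leq_bigmax_seq _ s xpredT eigval).
    by case/andP: bnd => + _; apply: leq_trans; exact: ltn_expl.
  rewrite (bigD1 (Ordinal tl))//= bnd big1 ?addr0// => i ni.
  case: ifPn => // H; case/eqP: ni; apply/val_inj => /=.
  by apply/esym/trunc_log_eq.
rewrite split_sum.
apply: (@le_trans _ _ (\sum_(i < L) 2 * c2 `^ r * ((D `^ (1 - r)) ^- i * (sqsum om (M i) K1) `^ r))).
  apply: ler_sum => i _.
  apply: le_trans (@block_le (blk i) a p i p0 p1 _ _) _.
  - exact/filter_uniq/boxseq_uniq.
  - by move=> mu; rewrite mem_filter => /andP[].
  rewrite -[leRHS]mulrA ler_wpM2l// mulrCA ler_wpM2l ?invr_ge0 ?exprn_ge0 ?powR_ge0//.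
  rewrite -powRM// -/r ge0_ler_powR ?nnegrE ?(ltW r0) ?mulr_ge0//; last exact: Sblk.
  by apply: sumr_ge0 => mu _; exact: sqr_ge0.
rewrite -mulr_sumr.
have MJ i : M i `^ (2 * r) <= kap * capped_sum D th ((2 ^- K1) `^ r) (fun j => om (dyadic_level K1 j)) (2 * K1) i ^+ 2.
  have Mr : M i `^ r = c1 / 2 * A i.
    rewrite /M -powRrM mulVf ?gt_eqF// powRr1// mulr_ge0//.
    by rewrite divr_ge0// ltW.
  rewrite [2 * r]mulrC powRrM Mr.
  rewrite powR_mulrn; last by rewrite mulr_ge0// divr_ge0// ltW.
  have -> : c1 / 2 * A i = c1 * @levsum R n om r K0 i by rewrite /A mulrA divfK.
  rewrite exprMn ler_wpM2l ?sqr_ge0// lerXn2r ?nnegrE//; first exact: J0.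
  exact: (levsum_mono r i om0 (leq_maxl K0 K1')).
have := @sum_level_le R D th D1 t1 ((2 ^- K1) `^ r) (fun j => om (dyadic_level K1 j)) (2 * K1) r (fun j => dyadic_level K1 j) M kap
  (cK K1) (fun j => om0 _) r0 r1 (fun j => dyadic_level_gt0 _ _) (lpp K1) M0 (sqr_ge0 _) MJ L.
move=> H; have {}H := le_trans H (ler_wpM2l NC0 (Wsum K1)).
apply: le_trans (ler_wpM2l _ H) _; first by rewrite mulr_ge0 ?powR_ge0.
by rewrite mulrA [leRHS]mulrDl mul1r lerDl.
Qed.

End HermiteHardy.

(** * Partial derivatives of tensor products *)

Section TensorProducts.
Context {R : realType} {n : nat}.
Implicit Types (g : 'rV[R]_n -> R) (x y : 'rV[R]_n) (s : seq 'I_n).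

Lemma partials0 s : partials s (fun=> 0 : R) = (fun=> 0) :> ('rV[R]_n -> R).
Proof. by elim: s => //= i s ->; apply/funext => x; rewrite /partial derive_cst. Qed.

Lemma smooth0 : smooth (fun=> 0 : R) (n := n).
Proof.
move=> s; rewrite partials0; split=> [|i x]; last exact: derivable_cst.
exact: cst_continuous.
Qed.

Lemma partials_lin (c : R) g h s : smooth g -> smooth h ->
  partials s (fun x => c * g x + h x) = (fun x => c * partials s g x + partials s h x).
Proof.
move=> sg sh; elim: s => //= i s ->; apply/funext => x; rewrite /partial.
have [_ dg] := sg s; have [_ dh] := sh s.
have -> : (fun x => c * partials s g x + partials s h x) = (c *: partials s g) + partials s h by [].
by rewrite deriveD ?deriveZ//; exact: derivableZ.
Qed.

Lemma smooth_lin (c : R) g h : smooth g -> smooth h -> smooth (fun x => c * g x + h x).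
Proof.
move=> sg sh s; rewrite partials_lin//; have [cg dg] := sg s; have [ch dh] := sh s; split.
  move=> x; apply: (@cvgD _ _ _ (nbhs x) _ (fun y => c * partials s g y) (partials s h)); last exact: ch.
  by apply: (@cvgMl_tmp _ _ (nbhs x) _ (partials s g)); exact: cg.
move=> i x.
have -> : (fun x => c * partials s g x + partials s h x) = (c *: partials s g) + partials s h by [].
by apply: derivableD => //; exact: derivableZ.
Qed.

(** When G i m is the m-th derivative of the i-th factor, this is the derivative along the word s
    of the product of the factors. *)
Definition tensor (G : 'I_n -> nat -> R -> R) s y : R :=
  \prod_(i < n) G i (count_mem i s) (y 0 i).

Variable G : 'I_n -> nat -> R -> R.
Hypothesis dG : forall i m z, is_derive z (1 : R) (G i m) (G i m.+1 z).

(** Along a coordinate direction all factors but one are constant, so the difference quotient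
    is a multiple of a one-dimensional one. *)
Lemma is_derive_tensor s j x :
  is_derive x (delta_mx 0 j : 'rV[R]_n) (tensor G s) (tensor G (j :: s) x).
Proof.
pose P := \prod_(i < n | i != j) G i (count_mem i s) (x 0 i).
have PE : tensor G (j :: s) x = P * G j (count_mem j s).+1 (x 0 j).
  rewrite /tensor (bigD1 j)//= eqxx add1n mulrC; congr (_ * _).
  by apply: eq_bigr => i ij; rewrite eq_sym (negbTE ij).
have TE h : tensor G s (h *: (delta_mx 0 j : 'rV[R]_n) + x) = P * G j (count_mem j s) (h *: 1 + x 0 j).
  rewrite /tensor (bigD1 j)//= !mxE !eqxx mulrC /GRing.scale /=; congr (_ * _).
  by apply: eq_bigr => i ij; rewrite !mxE (negbTE ij) andbF mulr0 add0r.
have T0 : tensor G s x = P * G j (count_mem j s) (x 0 j) by have := TE 0; rewrite !scale0r !add0r.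
have [/= dj Ej] := dG j (count_mem j s) (x 0 j).
have Hc : (fun h : R => h^-1 *: ((tensor G s \o shift x) (h *: (delta_mx 0 j : 'rV[R]_n)) - tensor G s x)) @ 0^'
   --> P * G j (count_mem j s).+1 (x 0 j).
  have -> : (fun h : R => h^-1 *: ((tensor G s \o shift x) (h *: (delta_mx 0 j : 'rV[R]_n)) - tensor G s x)) =
     (fun h : R => P * (h^-1 *: ((G j (count_mem j s) \o shift (x 0 j)) (h *: 1) - G j (count_mem j s) (x 0 j)))).
    apply/funext => h /=; rewrite /shift /= TE T0 -mulrBr /GRing.scale /=; ring.
  by apply: cvgMl_tmp; rewrite -Ej; exact: dj.
rewrite PE; split; first by apply/cvg_ex; eexists; exact: Hc.
by apply/cvg_lim => //; exact: Hc.
Qed.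

Lemma partials_tensor s : partials s (tensor G [::]) = tensor G s.
Proof.
elim: s => //= i s ->; apply/funext => x; rewrite /partial.
exact: (@derive_val _ _ _ _ _ _ _ (is_derive_tensor s i x)).
Qed.

Lemma continuous_tensor s : continuous (tensor G s).
Proof.
rewrite /tensor; elim: (index_enum _) => [|i l IH].
  rewrite (_ : (fun y => _) = (fun=> 1)); first exact: cst_continuous.
  by apply/funext => y; rewrite big_nil.
rewrite (_ : (fun y => _) = (fun y : 'rV[R]_n => G i (count_mem i s) (y 0 i) *
    \prod_(j <- l) G j (count_mem j s) (y 0 j))); last by apply/funext => y; rewrite big_cons.
have c1 : continuous (fun y : 'rV[R]_n => G i (count_mem i s) (y 0 i)).
  move=> x; apply: (@continuous_comp _ _ _ (fun y : 'rV[R]_n => y 0 i) (G i (count_mem i s)) x).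
    exact: coord_continuous.
  apply/differentiable_continuous/derivable1_diffP.
  by case: (dG i (count_mem i s) (x 0 i)).
by move=> x; exact: (cvgM (c1 x) (IH x)).
Qed.

Lemma smooth_tensor : smooth (tensor G [::]).
Proof.
move=> s; rewrite partials_tensor; split; first exact: continuous_tensor.
by move=> i x; case: (is_derive_tensor s i x).
Qed.

End TensorProducts.

(** * Schwartz seminorms of real functions *)

Section SchwartzNorms.
Context {R : realType} {n : nat}.
Implicit Types (g h : 'rV[R]_n -> R) (x y : 'rV[R]_n) (s : seq 'I_n).

Definition complexify g : 'rV[R]_n -> R[i] := fun x => (g x)%:C%C.

Definition seminorm_le N g (B : R) := forall (al : {ffun 'I_n -> nat}) s x,
  (mdeg al <= N)%N -> (size s <= N)%N -> `|monomial al x * partials s g x| <= B.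

Lemma modc_real (a : R) : modc (a +i* 0)%C = `|a|.
Proof. by rewrite /= expr0n /= addr0 sqrtr_sqr. Qed.

Lemma partialsC_complexify s g x : partialsC s (complexify g) x = (partials s g x +i* 0)%C.
Proof. by rewrite /partialsC /complexify /= partials0. Qed.

Lemma schwartz_norm_le N g B : seminorm_le N g B -> (schwartz_norm N (complexify g) <= B%:E)%E.
Proof.
move=> H; apply: ge_ereal_sup => _ [[[al s] x] [/= h1 h2] <-].
rewrite lee_fin; change (`|monomial al x| * modc (partialsC s (complexify g) x) <= B).
by rewrite partialsC_complexify modc_real -normrM H.
Qed.

Lemma schwartz_complexify g : smooth g -> (forall N, exists B, seminorm_le N g B) ->
  schwartz (complexify g).
Proof.
move=> sg H; split; first by split => //; exact: smooth0.
move=> N; have [B HB] := H N.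
by apply: le_lt_trans (schwartz_norm_le HB) _; rewrite ltry.
Qed.

Lemma monomial_tensor al s (G : 'I_n -> nat -> R -> R) x :
  monomial al x * tensor G s x = \prod_(i < n) (x 0 i ^+ al i * G i (count_mem i s) (x 0 i)).
Proof. by rewrite /monomial /tensor big_split. Qed.

Lemma al_le_mdeg (al : {ffun 'I_n -> nat}) i : (al i <= mdeg al)%N.
Proof. by rewrite /mdeg (bigD1 i)//= leq_addr. Qed.

Lemma prod_le_prod (J : Type) (l : seq J) (a b : J -> R) :
  (forall j, `|a j| <= b j) -> `|\prod_(j <- l) a j| <= \prod_(j <- l) b j.
Proof.
move=> H; elim: l => [|j l IH]; first by rewrite !big_nil normr1.
by rewrite !big_cons normrM ler_pM.
Qed.

(** Telescoping: the factors are replaced one at a time. *)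
Lemma prod_diff_le (J : Type) (l : seq J) (a b : J -> R) (A e : R) : 1 <= A ->
  (forall j, `|a j| <= A) -> (forall j, `|b j| <= A) -> (forall j, `|a j - b j| <= e) ->
  `|\prod_(j <- l) a j - \prod_(j <- l) b j| <= (size l)%:R * A ^+ size l * e.
Proof.
move=> A1 ha hb he; have A0 : 0 <= A by apply: le_trans A1.
elim: l => [|j l IH]; first by rewrite !big_nil subrr normr0 !mul0r.
have e0 : 0 <= e by apply: le_trans (he j).
rewrite !big_cons.
have -> : a j * \prod_(j0 <- l) a j0 - b j * \prod_(j0 <- l) b j0 =
  a j * (\prod_(j0 <- l) a j0 - \prod_(j0 <- l) b j0) + (a j - b j) * \prod_(j0 <- l) b j0 by ring.
apply: le_trans (ler_normD _ _) _; rewrite !normrM /=.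
have hp : `|\prod_(j0 <- l) b j0| <= A ^+ size l.
  apply: le_trans (prod_le_prod l hb) _.
  by rewrite big_const_seq count_predT iter_mulr_1.
have h1 : `|a j| * `|\prod_(j0 <- l) a j0 - \prod_(j0 <- l) b j0| <= A * ((size l)%:R * A ^+ size l * e).
  by apply: ler_pM.
have h2 : `|a j - b j| * `|\prod_(j0 <- l) b j0| <= e * A ^+ size l by apply: ler_pM.
have h3 : e * A ^+ size l <= e * A ^+ (size l).+1.
  by rewrite ler_wpM2l// exprS ler_peMl// exprn_ge0.
apply: le_trans (lerD h1 (le_trans h2 h3)) _.
apply: le_of_eq; rewrite -natr1 exprS; ring.
Qed.

(** Common constants for the finitely many pairs of orders that enter a Schwartz seminorm. *)
Lemma uniform_orders (P : nat -> nat -> R -> nat -> Prop) :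
  (forall al m, exists C B, 0 <= C /\ P al m C B) ->
  (forall al m C B C' B', 0 <= C -> C <= C' -> (B <= B')%N -> P al m C B -> P al m C' B') ->
  forall N, exists C B, 0 <= C /\ forall al m, (al <= N)%N -> (m <= N)%N -> P al m C B.
Proof.
move=> H mono N.
have Hr al : exists C B, 0 <= C /\ forall m, (m <= N)%N -> P al m C B.
  elim: N => [|N [C [B [C0 h]]]].
    have [C [B [C0 h]]] := H al 0%N; exists C, B; split => // m; by rewrite leqn0 => /eqP ->.
  have [C' [B' [C'0 h']]] := H al N.+1; exists (C + C'), (B + B')%N; split; first exact: addr_ge0.
  move=> m; rewrite leq_eqVlt ltnS => /orP[/eqP ->|mN].
    by apply: mono h' => //; rewrite ?leq_addl ?lerDr.
  by apply: mono (h m mN) => //; rewrite ?leq_addr ?lerDl.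
have : forall N', exists C B, 0 <= C /\ forall al m, (al <= N')%N -> (m <= N)%N -> P al m C B.
  elim=> [|N' [C [B [C0 h]]]].
    have [C [B [C0 h]]] := Hr 0%N; exists C, B; split => // al m; by rewrite leqn0 => /eqP ->; exact: h.
  have [C' [B' [C'0 h']]] := Hr N'.+1; exists (C + C'), (B + B')%N; split; first exact: addr_ge0.
  move=> al m; rewrite leq_eqVlt ltnS => /orP[/eqP ->|aN] mN.
    by apply: mono (h' m mN) => //; rewrite ?leq_addl ?lerDr.
  by apply: mono (h al m aN mN) => //; rewrite ?leq_addr ?lerDl.
by apply.
Qed.

Lemma schwartz_norm_ge0 N (phi : 'rV[R]_n -> R[i]) : (0 <= schwartz_norm N phi)%E.
Proof.
apply: le_trans (ereal_sup_ubound _); last first.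
  exists (([ffun=> 0%N], [::]), 0) => //=; split => //.
  by rewrite /mdeg big1// => i _; rewrite ffunE.
by rewrite lee_fin mulr_ge0//; case: (partialsC _ _ _) => ? ? /=; exact: sqrtr_ge0.
Qed.

Variable f : ('rV[R]_n -> R[i]) -> R[i].
Hypothesis tf : tempered f.

Lemma tempered_lin (c : R) g h : schwartz (complexify g) -> schwartz (complexify h) ->
  f (complexify (fun x => c * g x + h x)) = c%:C%C * f (complexify g) + f (complexify h).
Proof.
move=> sg sh; have [lin _] := tf; rewrite -lin//; congr f.
by apply/funext => x; rewrite /complexify rmorphD rmorphM.
Qed.

Lemma tempered_bound : exists N (C : R), 0 <= C /\ forall g B, schwartz (complexify g) ->
  seminorm_le N g B -> modc (f (complexify g)) <= C * B.
Proof.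
have [_ [N [C H]]] := tf; exists N, `|C|; split => // g B sg /schwartz_norm_le gB.
rewrite -lee_fin; apply: le_trans (H _ sg) _.
apply: (@le_trans _ _ (`|C|%:E * schwartz_norm N (complexify g))%E).
  by rewrite lee_wpmul2r ?schwartz_norm_ge0// lee_fin ler_norm.
by rewrite EFinM lee_wpmul2l// lee_fin.
Qed.

End SchwartzNorms.

(** * Pairing a tempered distribution with the heat kernel *)

Section HermitePairing.
Context {R : realType} {n : nat}.
Hypothesis hn : (1 <= n)%N.
Local Notation I := {ffun 'I_n -> nat}.
Implicit Types (x y : 'rV[R]_n) (s : seq 'I_n) (mu : I) (t : R).

Lemma Re_le_modc (z : R[i]) : `|complex.Re z| <= modc z.
Proof. by case: z => a b /=; rewrite -sqrtr_sqr ler_wsqrtr// lerDl sqr_ge0. Qed.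

Lemma Im_le_modc (z : R[i]) : `|complex.Im z| <= modc z.
Proof. by case: z => a b /=; rewrite -sqrtr_sqr ler_wsqrtr// lerDr sqr_ge0. Qed.

Lemma Re_combination (J : Type) (A : seq J) (c : J -> R) (z : J -> R[i]) :
  complex.Re (\sum_(j <- A) (c j)%:C%C * z j) = \sum_(j <- A) c j * complex.Re (z j).
Proof.
rewrite (big_morph (@complex.Re R) (id1 := 0) (op1 := +%R))//; last by case=> ? ? [].
by apply: eq_bigr => j _; case: (z j) => a b /=; rewrite mul0r subr0.
Qed.

Lemma Im_combination (J : Type) (A : seq J) (c : J -> R) (z : J -> R[i]) :
  complex.Im (\sum_(j <- A) (c j)%:C%C * z j) = \sum_(j <- A) c j * complex.Im (z j).
Proof.
rewrite (big_morph (@complex.Im R) (id1 := 0) (op1 := +%R))//; last by case=> ? ? [].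
by apply: eq_bigr => j _; case: (z j) => a b /=; rewrite mul0r addr0.
Qed.

Lemma ReB (z w : R[i]) : complex.Re (z - w) = complex.Re z - complex.Re w.
Proof. by case: z => ? ?; case: w. Qed.

Lemma ImB (z w : R[i]) : complex.Im (z - w) = complex.Im z - complex.Im w.
Proof. by case: z => ? ?; case: w. Qed.

Lemma Phi_tensor mu : @Phi R n mu = tensor (fun i m => hermite_der m (mu i)) [::].
Proof. by []. Qed.

Lemma smooth_Phi mu : smooth (@Phi R n mu).
Proof. by rewrite Phi_tensor; apply: smooth_tensor => i m z; exact: is_derive_hermite_der. Qed.

(** The seminorms of a tensor product factor into one-dimensional bounds, which are polynomial in
    the index. *)
Lemma Phi_seminorm N : exists (C : R) B, 0 <= C /\
  forall mu, seminorm_le N (@Phi R n mu) (\prod_(i < n) (C * (mu i).+1%:R ^+ B)).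
Proof.
pose P al m (C : R) B := forall k (z : R), `|z ^+ al * hermite_der m k z| <= C * k.+1%:R ^+ B.
have mono al m C B C' B' : 0 <= C -> C <= C' -> (B <= B')%N -> P al m C B -> P al m C' B'.
  move=> C0 CC BB H k z; apply: le_trans (H k z) _.
  by apply: ler_pM => //; rewrite ler_weXn2l// ler1n.
have [C [B [C0 H]]] := uniform_orders (@hermite_der_bound R) mono N; exists C, B; split => // mu al s x hal hs.
rewrite Phi_tensor (@partials_tensor R n _ (fun i m z => is_derive_hermite_der m (mu i) z)).
rewrite monomial_tensor; apply: prod_le_prod => i; apply: H.
  by apply: leq_trans hal; exact: al_le_mdeg.
by apply: leq_trans hs; exact: count_size.
Qed.

Lemma schwartz_Phi mu : schwartz (complexify (@Phi R n mu)).
Proof.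
apply: schwartz_complexify; first exact: smooth_Phi.
by move=> N; have [C [B [_ H]]] := Phi_seminorm N; eexists; exact: H.
Qed.

Variable f : ('rV[R]_n -> R[i]) -> R[i].
Hypothesis tf : tempered f.

Lemma hermite_coef_bound : exists (A : R) B, 0 <= A /\
  forall mu, modc (hermite_coef f mu) <= A * \prod_(i < n) (mu i).+1%:R ^+ B.
Proof.
have [N [C [C0 HC]]] := tempered_bound tf.
have [C' [B [C'0 H]]] := Phi_seminorm N.
exists (C * C' ^+ n), B; split; first by rewrite mulr_ge0 ?exprn_ge0.
move=> mu; apply: le_trans (HC _ _ (schwartz_Phi mu) (H mu)) _.
by rewrite big_split /= prodr_const card_ord mulrA.
Qed.

(** Real and imaginary parts are treated separately, as real coefficient sequences. *)
Definition rcoef mu := complex.Re (hermite_coef f mu).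
Definition icoef mu := complex.Im (hermite_coef f mu).

Lemma polybounded_rcoef : polybounded rcoef.
Proof.
have [A [B [A0 H]]] := hermite_coef_bound; exists A, B; split => // mu.
by apply: le_trans (H mu); exact: Re_le_modc.
Qed.

Lemma polybounded_icoef : polybounded icoef.
Proof.
have [A [B [A0 H]]] := hermite_coef_bound; exists A, B; split => // mu.
by apply: le_trans (H mu); exact: Im_le_modc.
Qed.

Definition heat_kernel t x y := \prod_(i < n) heat1 t (x 0 i) (y 0 i).

Lemma heat_kernel_tensor t x : 0 < t ->
  heat_kernel t x = tensor (fun i m => heat1_der t (x 0 i) m) [::].
Proof.
by move=> t0; apply/funext => y; apply: eq_bigr => i _; rewrite -heat1_der0.
Qed.

Lemma smooth_heat_kernel t x : 0 < t <= 1 -> smooth (heat_kernel t x).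
Proof.
move=> t01; rewrite heat_kernel_tensor; last by case/andP: t01.
by apply: smooth_tensor => i m z; exact: is_derive_heat1_der.
Qed.

Definition heat_partial t x N y := boxsum N (fun mu => decayn t mu * Phi mu x * Phi mu y).

(** Finite Hermite sums stay in the Schwartz class, and f acts on them termwise. *)
Lemma schwartz_combination (A : seq I) (c : I -> R) :
  smooth (fun y => \sum_(mu <- A) c mu * @Phi R n mu y) /\
  (forall N, exists B, seminorm_le N (fun y => \sum_(mu <- A) c mu * @Phi R n mu y) B) /\
  (forall s y, partials s (fun y => \sum_(mu <- A) c mu * @Phi R n mu y) y =
     \sum_(mu <- A) c mu * partials s (@Phi R n mu) y) /\
  f (complexify (fun y => \sum_(mu <- A) c mu * @Phi R n mu y)) = \sum_(mu <- A) (c mu)%:C%C * hermite_coef f mu.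
Proof.
elim: A => [|nu A [sA [bA [dA fA]]]].
  have -> : (fun y => \sum_(mu <- [::]) c mu * @Phi R n mu y) = (fun=> 0).
    by apply/funext => y; rewrite big_nil.
  have B0 N : seminorm_le N (fun=> 0 : R) (0 : R) (n := n).
    by move=> al s x _ _; rewrite partials0 mulr0 normr0.
  split; first exact: smooth0.
  split; first by move=> N; exists 0.
  split; first by move=> s y; rewrite partials0 big_nil.
  have s0 : schwartz (complexify (fun=> 0 : R) : 'rV[R]_n -> _).
    by apply: schwartz_complexify; [exact: smooth0|move=> N; exists 0].
  rewrite big_nil; have := tempered_lin tf (-1) s0 s0.
  have -> : (fun x : 'rV[R]_n => -1 * 0 + 0) = (fun=> 0 : R) by apply/funext => y; rewrite mulr0 addr0.
  by rewrite rmorphN rmorph1 mulN1r addNr.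
have -> : (fun y => \sum_(mu <- nu :: A) c mu * @Phi R n mu y) =
  (fun y => c nu * Phi nu y + \sum_(mu <- A) c mu * @Phi R n mu y).
  by apply/funext => y; rewrite big_cons.
have dS s := @partials_lin R n (c nu) _ _ s (smooth_Phi nu) sA.
split; first exact: (smooth_lin (c nu) (smooth_Phi nu) sA).
split.
  move=> N; have [B HB] := bA N; have [C [B' [_ HC]]] := Phi_seminorm N.
  exists (`|c nu| * \prod_(i < n) (C * (nu i).+1%:R ^+ B') + B) => al s x h1 h2.
  rewrite dS mulrDr; apply: le_trans (ler_normD _ _) _; apply: lerD; last exact: HB.
  by rewrite mulrCA normrM ler_wpM2l// HC.
split; first by move=> s y; rewrite dS dA big_cons.
by rewrite (tempered_lin tf (c nu) (schwartz_Phi nu) (schwartz_complexify sA bA)) big_cons fA.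
Qed.

(** Both the kernel and its box sum are products over the coordinates, whose factors are close
    in every weighted derivative by heat1_der_tail. *)
Lemma heat_kernel_close t x N : 0 < t <= 1 -> exists C : R, 0 <= C /\
  forall M, seminorm_le N (fun y => (-1) * heat_partial t x M y + heat_kernel t x y) (C / M.+1%:R).
Proof.
move=> t01.
pose P al m (C : R) (_ : nat) := forall (z y : R) M,
  `|y ^+ al * heat1_der t z m y - y ^+ al * \sum_(0 <= k < M) decay t k * hermite_fun k z * hermite_der m k y|
    <= C / M.+1%:R.
have ex al m : exists C B, 0 <= C /\ P al m C B.
  have [C [B [C0 H]]] := @heat1_der_tail R al m; exists (C / t ^+ B), 0%N; split.
    by rewrite divr_ge0// exprn_ge0//; case/andP: t01 => /ltW.
  by move=> z y M; exact: H.
have mono al m C B C' B' : 0 <= C -> C <= C' -> (B <= B')%N -> P al m C B -> P al m C' B'.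
  move=> C0 CC _ H z y M; apply: le_trans (H z y M) _.
  by rewrite ler_wpM2r// invr_ge0.
have [K [KB [K0 HK]]] := uniform_orders ex mono N.
(* The factors of the kernel are bounded by K (empty partial sum), those of the box sums by 2 K. *)
pose A := 2 * K + 1.
exists (n%:R * A ^+ n * K); split.
  by rewrite !mulr_ge0// exprn_ge0// /A addr_ge0// mulr_ge0.
move=> M al s y hal hs.
have [sP [_ [dP _]]] := schwartz_combination (@boxseq n M) (fun mu => decayn t mu * Phi mu x).
rewrite partials_lin//; last exact: smooth_heat_kernel.
rewrite heat_kernel_tensor; last by case/andP: t01.
rewrite (@partials_tensor R n _ (fun i m z => is_derive_heat1_der (x 0 i) m z t01)).
rewrite /heat_partial /boxsum dP mulN1r addrC mulrBr monomial_tensor.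
have -> : monomial al y * \sum_(mu <- boxseq M) decayn t mu * Phi mu x * partials s (Phi mu) y =
  \prod_(i < n) (y 0 i ^+ al i * \sum_(0 <= k < M) decay t k * hermite_fun k (x 0 i) * hermite_der (count_mem i s) k (y 0 i)).
  rewrite big_split /= -boxsum_prod /boxsum; congr (_ * _); apply: eq_bigr => mu _.
  rewrite decayn_prod Phi_tensor (@partials_tensor R n _ (fun i m z => is_derive_hermite_der m (mu i) z)).
  by rewrite /tensor !big_split.
have al_N i : (al i <= N)%N by apply: leq_trans hal; exact: al_le_mdeg.
have s_N i : (count_mem i s <= N)%N by apply: leq_trans hs; exact: count_size.
have h0 i z w : `|w ^+ al i * heat1_der t z (count_mem i s) w| <= K.
  by have := HK (al i) (count_mem i s) (al_N i) (s_N i) z w 0%N; rewrite big_geq// mulr0 subr0 divr1.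
have hM i z w := HK (al i) (count_mem i s) (al_N i) (s_N i) z w M.
have KM : K / M.+1%:R <= K by rewrite ler_pdivrMr ?ltr0n// ler_peMr// ler1n.
have KA : K + K <= A by rewrite /A mulrDl mul1r lerDl.
have A1 : 1 <= A by rewrite /A lerDr mulr_ge0.
apply: le_trans (@prod_diff_le R _ (index_enum 'I_n) _ _ A (K / M.+1%:R) A1 _ _ _) _.
- move=> i; by apply: le_trans (h0 i _ _) _; apply: le_trans KA; rewrite lerDl.
- move=> i; set b := (X in `|X|); set a := y 0 i ^+ al i * heat1_der t (x 0 i) (count_mem i s) (y 0 i).
  have -> : b = a - (a - b) by ring.
  apply: le_trans (ler_normB _ _) _; apply: le_trans KA; apply: lerD; first exact: h0.
  by apply: le_trans KM; exact: hM.
- by move=> i; exact: hM.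
have -> : size (index_enum 'I_n) = n by rewrite -sum1_size sum1_card card_ord.
by rewrite !mulrA.
Qed.

Lemma schwartz_heat_kernel t x : 0 < t <= 1 -> schwartz (complexify (heat_kernel t x)).
Proof.
move=> t01; apply: schwartz_complexify; first exact: smooth_heat_kernel.
move=> N; have [C [_ H]] := heat_kernel_close x N t01; exists (C / 1) => al s y h1 h2.
have := H 0%N al s y h1 h2.
have [s0 [_ [d0 _]]] := schwartz_combination (@boxseq n 0) (fun mu => decayn t mu * Phi mu x).
rewrite partials_lin//; last exact: smooth_heat_kernel.
have -> : partials s (heat_partial t x 0) y = 0.
  rewrite /heat_partial /boxsum d0 big1_seq// => mu /andP[_].
  by rewrite mem_boxseq => /forallP /(_ (Ordinal hn)).
by rewrite mulr0 add0r.
Qed.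

(** The Hermite expansion of the kernel converges in all Schwartz seminorms, so the continuous
    functional f can be applied to it term by term. *)
Lemma pairing_heat_kernel t x : 0 < t <= 1 ->
  complex.Re (f (complexify (heat_kernel t x))) = heat_sum rcoef t x /\
  complex.Im (f (complexify (heat_kernel t x))) = heat_sum icoef t x.
Proof.
move=> t01; have [N [C [C0 HC]]] := tempered_bound tf.
have [C1 [C10 H1]] := heat_kernel_close x N t01.
have sK := schwartz_heat_kernel x t01.
have H M : modc (f (complexify (heat_kernel t x)) -
    \sum_(mu <- boxseq M) (decayn t mu * Phi mu x)%:C%C * hermite_coef f mu) <= C * (C1 / M.+1%:R).
  have [sP [bP [_ fP]]] := schwartz_combination (@boxseq n M) (fun mu => decayn t mu * Phi mu x).
  have sP' : schwartz (complexify (heat_partial t x M)) by exact: schwartz_complexify.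
  rewrite -fP -mulN1r addrC.
  have -> : -1 = (-1 : R)%:C%C by rewrite rmorphN rmorph1.
  rewrite -(tempered_lin tf (-1) sP' sK); apply: HC; last exact: H1.
  apply: schwartz_complexify; first exact: (smooth_lin (-1) sP (smooth_heat_kernel x t01)).
  by move=> N'; have [C' [_ H']] := heat_kernel_close x N' t01; eexists; exact: (H' M).
have Cz M : C * (C1 / M.+1%:R) <= (C * C1) * @box_tail R n M.
  rewrite mulrA ler_wpM2l ?mulr_ge0// /box_tail mulrA ler_peMl ?invr_ge0//.
  by rewrite -natrX -!natrM ler1n !muln_gt0 expn_gt0 hn.
pose F := f (complexify (heat_kernel t x)).
pose S M := \sum_(mu <- boxseq M) (decayn t mu * Phi mu x)%:C%C * hermite_coef f mu.
rewrite -/F; split.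
  have [C2 [B [C20 H2]]] := heat_sum_tail polybounded_rcoef.
  apply: (@eq_box_tail R n _ _ (C * C1 + C2 / t ^+ B) 0%N) => M _.
  rewrite [X in `|X|](_ : _ = complex.Re (F - S M)
      - (heat_sum rcoef t x - boxsum M (fun mu => decayn t mu * rcoef mu * Phi mu x))).
    apply: le_trans (ler_normB _ _) _; rewrite mulrDl; apply: lerD; last exact: H2.
    by apply: le_trans (Re_le_modc _) _; apply: le_trans (H M) _; exact: Cz.
  rewrite ReB /S Re_combination.
  have -> : boxsum M (fun mu => decayn t mu * rcoef mu * Phi mu x) =
    \sum_(mu <- boxseq M) decayn t mu * Phi mu x * complex.Re (hermite_coef f mu).
    by apply: eq_bigr => mu _; rewrite mulrAC.
  by ring.
have [C2 [B [C20 H2]]] := heat_sum_tail polybounded_icoef.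
apply: (@eq_box_tail R n _ _ (C * C1 + C2 / t ^+ B) 0%N) => M _.
rewrite [X in `|X|](_ : _ = complex.Im (F - S M)
    - (heat_sum icoef t x - boxsum M (fun mu => decayn t mu * icoef mu * Phi mu x))).
  apply: le_trans (ler_normB _ _) _; rewrite mulrDl; apply: lerD; last exact: H2.
  by apply: le_trans (Im_le_modc _) _; apply: le_trans (H M) _; exact: Cz.
rewrite ImB /S Im_combination.
have -> : boxsum M (fun mu => decayn t mu * icoef mu * Phi mu x) =
  \sum_(mu <- boxseq M) decayn t mu * Phi mu x * complex.Im (hermite_coef f mu).
  by apply: eq_bigr => mu _; rewrite mulrAC.
by ring.
Qed.

End HermitePairing.

(** * Level sums and integrals of powers *)

Section LayerCake.
Context {R : realType} {d} {T : measurableType d} (m : {measure set T -> \bar R}).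
Variables (F : T -> \bar R) (p : R).
Hypotheses (mF : measurable_fun setT F) (F0 : forall u, (0 <= F u)%E) (p0 : 0 < p).

Lemma measurable_esuperlevel (l : R) : measurable [set u | (l%:E < F u)%E].
Proof.
rewrite (_ : [set u | _] = setT `&` [set u | (l%:E < F u)%E]); last by rewrite setTI.
by apply: emeasurable_fun_o_infty.
Qed.

Definition superlevel (l : R) : set T := [set u | (l%:E < F u)%E].

Lemma sum_dyadic_level_powR_le K (y : R) : 0 <= y ->
  \sum_(j < 2 * K) (if dyadic_level K j <= y then dyadic_level K j `^ p else 0) <= geo_total (2 `^ p) * y `^ p.
Proof.
move=> y0.
have g1 : 1 < 2 `^ p :> R.
  have E : 1 `^ p = 1 :> R by rewrite powR1.
  by rewrite -[ltLHS]E gt0_ltr_powR ?nnegrE// ltr1n.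
apply: le_trans (geo_sum_cond (2 * K) g1 (powR_ge0 (2 ^- K) p) (powR_ge0 y p)).
apply: ler_sum => j _; rewrite dyadic_level_powR.
case: ifPn => [h|_]; last by case: ifP => // _; rewrite mulr_ge0 ?powR_ge0// exprn_ge0// powR_ge0.
have l0 := @dyadic_level_gt0 R K j.
by rewrite ifT// -dyadic_level_powR ge0_ler_powR ?nnegrE ?(ltW p0) ?(ltW l0).
Qed.

(** The levels below F u form a geometric progression. *)
Lemma dyadic_level_indic_le K u :
  (\sum_(j < 2 * K) (dyadic_level K j `^ p)%:E * (\1_(superlevel (dyadic_level K j)) u)%:E <= (geo_total (2 `^ p))%:E * F u `^ p)%E.
Proof.
have g1 : 1 < 2 `^ p :> R.
  have E : 1 `^ p = 1 :> R by rewrite powR1.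
  by rewrite -[ltLHS]E gt0_ltr_powR ?nnegrE// ltr1n.
have gp : 0 < geo_total (2 `^ p) :> R.
  by rewrite /geo_total divr_gt0 ?subr_gt0// powR_gt0.
have := F0 u; case E : (F u) => [y| |//]; last first.
  by move=> _; rewrite poweRyr ?gt_eqF// gt0_muley ?lte_fin// leey.
rewrite lee_fin => y0; rewrite poweR_EFin -EFinM.
apply: (@le_trans _ _ (\sum_(j < 2 * K) (if dyadic_level K j <= y then dyadic_level K j `^ p else 0))%:E); last first.
  by rewrite lee_fin; exact: sum_dyadic_level_powR_le.
rewrite -sumEFin; apply: lee_sum => j _; rewrite -EFinM lee_fin indicE.
case: ifPn => h; first by case: (_ \in _); rewrite ?mulr1// mulr0 powR_ge0.
rewrite (_ : _ \in _ = false) ?mulr0//; apply/negbTE; apply: contra h.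
by rewrite inE /superlevel /= E lte_fin => /ltW.
Qed.

Lemma measurable_indic_superlevel l : measurable_fun setT (fun u => (\1_(superlevel l) u)%:E : \bar R).
Proof.
by apply/measurable_EFinP; apply: measurable_indic; exact: measurable_esuperlevel.
Qed.

Lemma measurable_powF : measurable_fun setT (fun u => (F u `^ p)%E).
Proof. by apply: (measurableT_comp (measurable_poweR p)). Qed.

(** Chebyshev's inequality. *)
Lemma powR_superlevel_le (l : R) : 0 < l ->
  ((l `^ p)%:E * m (superlevel l) <= \int[m]_u (F u `^ p))%E.
Proof.
move=> l0; rewrite -[superlevel l]setIT -(integral_indic _ measurableT (measurable_esuperlevel l)).
rewrite -ge0_integralZl_EFin ?powR_ge0//; last exact: measurable_indic_superlevel.
apply: ge0_le_integral => //.
- by move=> u _; rewrite -EFinM lee_fin mulr_ge0 ?powR_ge0.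
- by apply: measurable_funeM; exact: measurable_indic_superlevel.
- exact: measurable_powF.
move=> u _; rewrite indicE; case: (boolP (_ \in _)) => h; last by rewrite mule0 poweR_ge0.
rewrite mule1; move: h; rewrite inE /superlevel /= => h.
rewrite -poweR_EFin; apply: gt0_ler_poweR; rewrite ?(ltW p0)// ?in_itv/= ?lee_fin ?(ltW l0) ?leey ?F0//.
exact: ltW.
Qed.

Lemma sum_dyadic_level_superlevel_le K :
  (\sum_(j < 2 * K) (dyadic_level K j `^ p)%:E * m (superlevel (dyadic_level K j)) <= (geo_total (2 `^ p))%:E * \int[m]_u (F u `^ p))%E.
Proof.
have g0 : 0 <= geo_total (2 `^ p) :> R.
  apply: geo_total_ge0; have E : 1 `^ p = 1 :> R by rewrite powR1.
  by rewrite -[ltLHS]E gt0_ltr_powR ?nnegrE// ltr1n.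
have mj j : measurable_fun setT (fun u => ((dyadic_level K j `^ p)%:E * (\1_(superlevel (dyadic_level K j)) u)%:E)%E).
  by apply: measurable_funeM; exact: measurable_indic_superlevel.
rewrite -ge0_integralZl_EFin//; last 2 first.
- by move=> u _; exact: poweR_ge0.
- exact: measurable_powF.
have -> : (\sum_(j < 2 * K) (dyadic_level K j `^ p)%:E * m (superlevel (dyadic_level K j)) =
  \int[m]_u \sum_(j < 2 * K) (dyadic_level K j `^ p)%:E * (\1_(superlevel (dyadic_level K j)) u)%:E)%E.
  rewrite ge0_integral_sum//; last first.
    by move=> j u _; rewrite -EFinM lee_fin mulr_ge0 ?powR_ge0.
  apply: eq_bigr => j _; rewrite ge0_integralZl_EFin ?powR_ge0//; last exact: measurable_indic_superlevel.
  by rewrite integral_indic ?setIT//; exact: measurable_esuperlevel.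
apply: ge0_le_integral => //.
- by move=> u _; apply: sume_ge0 => j _; rewrite -EFinM lee_fin mulr_ge0 ?powR_ge0.
- by apply: emeasurable_sum.
- by apply: measurable_funeM; exact: measurable_powF.
by move=> u _; exact: dyadic_level_indic_le.
Qed.

End LayerCake.

(** * The two maximal functions *)

Section MaximalFunctions.
Context {R : realType} {n : nat}.
Hypothesis hn : (1 <= n)%N.
Local Notation I := {ffun 'I_n -> nat}.
Local Notation T := (n.-tuple (measurableTypeR R)).
Local Notation m := (@lebesgue_tuple R n).
Implicit Types (x y : 'rV[R]_n) (mu : I) (t l : R) (u : T).

Lemma gaussianE (v : R) x : 0 < v -> gaussian (v / 2) x = \prod_(i < n) gauss_pdf v (x 0 i).
Proof.
move=> v0; rewrite /gaussian /gauss_pdf big_split /= prodr_const card_ord; congr (_ * _).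
  have -> : 4 * pi * (v / 2) = 2 * pi * v :> R by field.
  have w0 : 0 <= 2 * pi * v :> R by rewrite !mulr_ge0 ?pi_ge0// ltW.
  rewrite powRN exprVn -powR12_sqrt// -[X in _ = X^-1]powR_mulrn ?powR_ge0// -powRrM.
  by congr ((_ `^ _)^-1); rewrite mulrC.
rewrite -expR_sum sumrN -mulr_suml /euclid_sq; congr expR; congr (- (_ / _)).
by field.
Qed.

Definition gauss_weight t x : R := \prod_(i < n) (Num.sqrt (sech2 t) * expR (- (x 0 i ^+ 2 * tanh2 t / 2))).

Lemma gauss_weight_gt0 t x : 0 < gauss_weight t x.
Proof. by apply: prodr_gt0 => i _; rewrite mulr_gt0 ?expR_gt0 ?sqrtr_gt0 ?sech2_gt0. Qed.

Lemma gauss_weight_le1 t x : 0 < t -> gauss_weight t x <= 1.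
Proof.
move=> t0; apply: le_trans (ler_norm _) _.
have H i : `|Num.sqrt (sech2 t) * expR (- (x 0 i ^+ 2 * tanh2 t / 2))| <= 1.
  by rewrite ger0_norm ?gauss_factor_le1// mulr_ge0 ?sqrtr_ge0 ?expR_ge0.
by apply: le_trans (prod_le_prod _ H) _; rewrite big1.
Qed.

(** Product over the coordinates of heat1_gauss. *)
Lemma heat_kernel_gaussian t x y : 0 < t ->
  heat_kernel t x y = gauss_weight t x * gaussian (tanh2 t / 2) (sech2 t *: x - y).
Proof.
move=> t0; rewrite gaussianE ?tanh2_gt0// /gauss_weight -big_split /=.
by apply: eq_bigr => i _; rewrite heat1_gauss// !mxE.
Qed.

Section Distribution.
Variable f : ('rV[R]_n -> R[i]) -> R[i].
Hypothesis tf : tempered f.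

(** The Gaussian is the kernel divided by its weight, hence again a Schwartz function. *)
Lemma pairing_heat t x : 0 < t <= 1 ->
  f (complexify (heat_kernel t x)) = (gauss_weight t x)%:C%C * heat (tanh2 t / 2) f (sech2 t *: x).
Proof.
move=> t01; have t0 : 0 < t by case/andP: t01.
have c0 := gauss_weight_gt0 t x.
have sK := schwartz_heat_kernel hn tf x t01.
have [s0 [b0 [_ f0]]] := schwartz_combination tf [::] (fun=> 0).
have z0 := schwartz_complexify s0 b0.
have := tempered_lin tf (gauss_weight t x)^-1 sK z0.
rewrite f0 big_nil addr0 => H.
have -> : heat (tanh2 t / 2) f (sech2 t *: x) = ((gauss_weight t x)^-1)%:C%C * f (complexify (heat_kernel t x)).
  rewrite -H /heat; congr f; apply/funext => y; rewrite /complexify big_nil addr0.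
  by rewrite heat_kernel_gaussian// mulrA mulVf ?mul1r// gt_eqF.
by rewrite mulrA -rmorphM mulfV ?gt_eqF// rmorph1 mul1r.
Qed.

Lemma Re_realM (c : R) (z : R[i]) : complex.Re (c%:C%C * z) = c * complex.Re z.
Proof. by case: z => a b /=; rewrite mul0r subr0. Qed.

Lemma Im_realM (c : R) (z : R[i]) : complex.Im (c%:C%C * z) = c * complex.Im z.
Proof. by case: z => a b /=; rewrite mul0r addr0. Qed.

(** The weight is at most 1, so the heat sums are dominated by the classical maximal function,
    evaluated at a dilated point. *)
Lemma heat_sum_le_max_heat t x : 0 < t <= 1 ->
  ((`|heat_sum (rcoef f) t x|)%:E <= max_heat f (sech2 t *: x))%E /\
  ((`|heat_sum (icoef f) t x|)%:E <= max_heat f (sech2 t *: x))%E.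
Proof.
move=> t01; have t0 : 0 < t by case/andP: t01.
have [<- <-] := pairing_heat_kernel hn tf x t01.
have c0 := gauss_weight_gt0 t x; have c1 := gauss_weight_le1 x t0.
have H : ((modc (heat (tanh2 t / 2) f (sech2 t *: x)))%:E <= max_heat f (sech2 t *: x))%E.
  by apply: ereal_sup_ubound; exists (tanh2 t / 2) => //=; rewrite divr_gt0 ?tanh2_gt0.
rewrite pairing_heat// Re_realM Im_realM !normrM (gtr0_norm c0).
split; apply: le_trans H; rewrite lee_fin.
  by apply: le_trans (Re_le_modc _); rewrite ler_piMl.
by apply: le_trans (Im_le_modc _); rewrite ler_piMl.
Qed.

Lemma heatL_heat_sum t x : heatL t f x = (heat_sum (rcoef f) t x +i* heat_sum (icoef f) t x)%C.
Proof.
rewrite /heatL /complex_usum /heat_sum; congr (Complex _ _); congr (real_usum _); apply/funext => mu.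
  by rewrite mulrAC -rmorphM Re_realM mulrAC.
by rewrite mulrAC -rmorphM Im_realM mulrAC.
Qed.

Lemma heat_sum_le_max_heatL t x : 0 < t ->
  ((`|heat_sum (rcoef f) t x|)%:E <= max_heatL f x)%E /\
  ((`|heat_sum (icoef f) t x|)%:E <= max_heatL f x)%E.
Proof.
move=> t0.
have H : ((modc (heatL t f x))%:E <= max_heatL f x)%E by apply: ereal_sup_ubound; exists t.
rewrite heatL_heat_sum in H; split; apply: le_trans H; rewrite lee_fin.
  exact: (@Re_le_modc _ (_ +i* _)%C).
exact: (@Im_le_modc _ (_ +i* _)%C).
Qed.

End Distribution.

Lemma modc_ge0 (z : R[i]) : 0 <= modc z.
Proof. by case: z => a b /=; exact: sqrtr_ge0. Qed.

Lemma modc_le (z : R[i]) : modc z <= `|complex.Re z| + `|complex.Im z|.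
Proof.
case: z => a b /=; rewrite -[leRHS]ger0_norm ?addr_ge0// -sqrtr_sqr ler_wsqrtr//.
by rewrite sqrrD !real_normK ?num_real// -addrA lerD2l lerDr mulrn_wge0// mulr_ge0.
Qed.

Lemma max_heat_ge0 f x : (0 <= max_heat f x :> \bar R)%E.
Proof.
apply: (@le_trans _ _ (modc (heat 1 f x))%:E); first by rewrite lee_fin modc_ge0.
by apply: ereal_sup_ubound; exists 1 => //=.
Qed.

Lemma max_heatL_ge0 f x : (0 <= max_heatL f x :> \bar R)%E.
Proof.
apply: (@le_trans _ _ (modc (heatL 1 f x))%:E); first by rewrite lee_fin modc_ge0.
by apply: ereal_sup_ubound; exists 1 => //=.
Qed.

Lemma sech2_ge t : 0 < t <= 1 -> expR (- 2) <= sech2 t.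
Proof.
move=> /andP[t0 t1]; apply: (@le_trans _ _ (expR (- (2 * t)))).
  by rewrite ler_expR lerN2 ler_piMr.
have /andP[r0 r1] := rho_itv t0; rewrite /sech2; set r := expR _ in r0 r1 *.
rewrite ler_pdivlMr; last by rewrite ltr_wpDr ?sqr_ge0.
rewrite mulrC; apply: ler_wpM2r; first exact: r0.
have r2 : r ^+ 2 <= 1 by rewrite expr_le1// ltW.
lra.
Qed.

Lemma row_of_tuple_dilate (k : R) u : row_of_tuple (@dilate R k n u) = k *: row_of_tuple u.
Proof. by apply/rowP => i; rewrite !mxE tnth_map. Qed.

(** The hypotheses bound the superlevel sets of the heat sums by those of M, whose level sums are
    controlled by the integral of M^p. Real and imaginary parts are added by subadditivity of the
    p-th power. *)
Lemma coef_sum_le (p A : R) : 0 < p -> p <= 1 -> 0 < A -> exists C : R, 0 < C /\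
  forall f (M : 'rV[R]_n -> \bar R), tempered f -> in_Lp p M -> (forall x, 0 <= M x)%E ->
    (forall t l, 0 < t <= 1 -> 0 < l ->
      (m [set u | (l < `|heat_sum (rcoef f) t (row_of_tuple u)|)%R] <= A%:E * m (superlevel (M \o row_of_tuple) l))%E) ->
    (forall t l, 0 < t <= 1 -> 0 < l ->
      (m [set u | (l < `|heat_sum (icoef f) t (row_of_tuple u)|)%R] <= A%:E * m (superlevel (M \o row_of_tuple) l))%E) ->
  (\esum_(mu in [set: I]) (modc (hermite_coef f mu) `^ p / (2 * mdeg mu + n)%N%:R `^ (3 * n%:R / 4 * (2 - p)))%:E
     <= C%:E * Lp_norm p M `^ p)%E.
Proof.
move=> p0 p1 A0; have [C [C0 HC]] := hardy_of_superlevel hn p0 p1.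
have gp : 0 < geo_total (2 `^ p) :> R.
  have := two_powR_gt1 p0; rewrite /geo_total => g1; by rewrite divr_gt0 ?subr_gt0// powR_gt0.
exists (2 * (C * (A * geo_total (2 `^ p)))); split; first by rewrite mulr_gt0// mulr_gt0// mulr_gt0.
move=> f M tf [mM MLp] M0 hr hi.
pose F := M \o row_of_tuple : T -> \bar R.
have F0 u : (0 <= F u)%E by exact: M0.
have SE : (Lp_norm p M `^ p = \int[m]_u (F u `^ p))%E.
  rewrite /Lp_norm poweR_Lnorm ?gt_eqF//; apply: eq_integral => u _.
  by rewrite gee0_abs.
have Sfin : (\int[m]_u (F u `^ p) < +oo)%E by rewrite -SE; exact: poweR_lty.
have S0 : (0 <= \int[m]_u (F u `^ p))%E by apply: integral_ge0 => u _; exact: poweR_ge0.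
set S := fine (\int[m]_u (F u `^ p))%E.
have SF : (\int[m]_u (F u `^ p) = S%:E)%E by rewrite fineK// ge0_fin_numE.
have mfin l : 0 < l -> m (superlevel F l) \is a fin_num.
  move=> l0; have := powR_superlevel_le m mM F0 p0 l0; rewrite SF => H.
  rewrite ge0_fin_numE//; have lp : 0 < l `^ p by rewrite powR_gt0.
  apply: (@le_lt_trans _ _ ((l `^ p)^-1 * S)%:E); last by rewrite ltry.
  by rewrite EFinM lee_pdivlMl.
pose om l := A * fine (m (superlevel F l)).
have om0 l : 0 <= om l by rewrite mulr_ge0 ?(ltW A0)// fine_ge0.
have omE l : 0 < l -> ((om l)%:E = A%:E * m (superlevel F l))%E.
  by move=> l0; rewrite EFinM fineK ?mfin.
have hW K : \sum_(j < 2 * K) dyadic_level K j `^ p * om (dyadic_level K j) <= A * geo_total (2 `^ p) * S.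
  rewrite -lee_fin -sumEFin.
  have -> : (\sum_(j < 2 * K) (dyadic_level K j `^ p * om (dyadic_level K j))%:E =
     A%:E * \sum_(j < 2 * K) (dyadic_level K j `^ p)%:E * m (superlevel F (dyadic_level K j)))%E.
    rewrite ge0_sume_distrr; last by move=> j _; rewrite mule_ge0// lee_fin powR_ge0.
    by apply: eq_bigr => j _; rewrite EFinM omE ?dyadic_level_gt0// muleCA.
  have := sum_dyadic_level_superlevel_le m mM F0 p0 K; rewrite SF => H.
  by rewrite -mulrA EFinM lee_wpmul2l ?lee_fin ?(ltW A0)// EFinM.
have hr' : superlevel_le (rcoef f) om by move=> t l t01 l0; rewrite omE//; exact: hr.
have hi' : superlevel_le (icoef f) om by move=> t l t01 l0; rewrite omE//; exact: hi.
have Br := HC _ om _ (polybounded_rcoef tf) hr' om0 hW.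
have Bi := HC _ om _ (polybounded_icoef tf) hi' om0 hW.
rewrite SE SF -EFinM.
have -> : 2 * (C * (A * geo_total (2 `^ p))) * S = C * (A * geo_total (2 `^ p) * S) + C * (A * geo_total (2 `^ p) * S) by ring.
rewrite EFinD; apply: le_trans (leeD Br Bi).
rewrite -esumD; last 2 first.
- by move=> mu _; rewrite lee_fin divr_ge0 ?powR_ge0.
- by move=> mu _; rewrite lee_fin divr_ge0 ?powR_ge0.
apply: le_esum => mu _; rewrite -EFinD lee_fin -mulrDl ler_wpM2r ?invr_ge0 ?powR_ge0//.
apply: le_trans (powRD_le _ _ _ _); rewrite ?normr_ge0//.
by apply: ge0_ler_powR; rewrite ?nnegrE ?(ltW p0) ?modc_ge0 ?addr_ge0// modc_le.
Qed.

Lemma superlevel_max_heatL f (v : R -> 'rV[R]_n -> R) :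
  measurable_fun setT (max_heatL f \o row_of_tuple : T -> _) ->
  (forall t l, 0 < t <= 1 -> measurable [set u : T | l < `|v t (row_of_tuple u)|]) ->
  (forall t x, 0 < t <= 1 -> ((`|v t x|)%:E <= max_heatL f x)%E) ->
  forall t l, 0 < t <= 1 -> 0 < l ->
    (m [set u | (l < `|v t (row_of_tuple u)|)%R] <= 1%:E * m (superlevel (max_heatL f \o row_of_tuple) l))%E.
Proof.
move=> mM mv H t l t01 l0; rewrite mul1e; apply: le_measure; rewrite ?inE.
- exact: mv.
- exact: measurable_esuperlevel.
by move=> u /= h; apply: lt_le_trans (H t _ t01); rewrite lte_fin.
Qed.

(** The dilation by 1 / cosh (2t) changes the measure by a bounded factor, as t <= 1. *)
Lemma superlevel_max_heat f (v : R -> 'rV[R]_n -> R) :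
  measurable_fun setT (max_heat f \o row_of_tuple : T -> _) ->
  (forall t l, 0 < t <= 1 -> measurable [set u : T | l < `|v t (row_of_tuple u)|]) ->
  (forall t x, 0 < t <= 1 -> ((`|v t x|)%:E <= max_heat f (sech2 t *: x))%E) ->
  forall t l, 0 < t <= 1 -> 0 < l ->
    (m [set u | (l < `|v t (row_of_tuple u)|)%R] <=
      (expR 2 ^+ n)%:E * m (superlevel (max_heat f \o row_of_tuple) l))%E.
Proof.
move=> mM mv H t l t01 l0; have k0 := sech2_gt0 t.
have mS := measurable_esuperlevel mM l.
pose Sk := @dilate R (sech2 t) n @^-1` superlevel (max_heat f \o row_of_tuple) l.
apply: (@le_trans _ _ (m Sk)).
  apply: le_measure; rewrite ?inE; first exact: mv.
    have mt := @measurable_dilate R (sech2 t) n.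
    by rewrite -[Sk]setTI; exact: (mt measurableT _ mS).
  move=> u /= h; rewrite /Sk /superlevel /= row_of_tuple_dilate.
  by apply: lt_le_trans (H t _ t01); rewrite lte_fin.
have gen (X Y : \bar R) : X = ((sech2 t ^+ n)%:E * Y)%E -> (0 <= Y)%E -> (Y <= (expR 2 ^+ n)%:E * X)%E.
  move=> -> Y0; rewrite muleA -EFinM -[leLHS]mul1e lee_wpmul2r// lee_fin -exprMn exprn_ege1//.
  by rewrite -ler_pdivrMl ?expR_gt0// mulr1 -expRN; exact: sech2_ge.
exact: (gen _ _ (lebesgue_tuple_dilate k0 mS) (measure_ge0 _ _)).
Qed.

End MaximalFunctions.

Local Open Scope complex_scope.

Theorem theorem1p1 (R : realType) (n : nat) (p : R) (hn : (1 <= n)%N)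
    (hp0 : 0 < p) (hp1 : p <= 1) :
  (exists C : R, 0 < C /\
     forall f : ('rV[R]_n -> R[i]) -> R[i], in_HpL p f ->
       (\esum_(mu in [set: {ffun 'I_n -> nat}])
          (modc (hermite_coef f mu) `^ p /
           (2 * mdeg mu + n)%N%:R `^ (3 * n%:R / 4 * (2 - p)))%:E
        <= C%:E * HpL_norm p f `^ p)%E) /\
  (exists C : R, 0 < C /\
     forall f : ('rV[R]_n -> R[i]) -> R[i], in_Hp p f ->
       (\esum_(mu in [set: {ffun 'I_n -> nat}])
          (modc (hermite_coef f mu) `^ p /
           (2 * mdeg mu + n)%N%:R `^ (3 * n%:R / 4 * (2 - p)))%:E
        <= C%:E * Hp_norm p f `^ p)%E).
Proof.
split.
  have [C [C0 HC]] := coef_sum_le hn hp0 hp1 (@ltr01 R).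
  exists C; split => // f [tf fLp]; have [mM _] := fLp.
  apply: HC => //; first by move=> x; exact: max_heatL_ge0.
    apply: superlevel_max_heatL => // [t l t01|t x /andP[t0 _]].
      exact: measurable_superlevel (polybounded_rcoef tf) t01.
    by case: (heat_sum_le_max_heatL f x t0).
  apply: superlevel_max_heatL => // [t l t01|t x /andP[t0 _]].
    exact: measurable_superlevel (polybounded_icoef tf) t01.
  by case: (heat_sum_le_max_heatL f x t0).
have A0 : 0 < expR 2 ^+ n :> R by rewrite exprn_gt0 ?expR_gt0.
have [C [C0 HC]] := coef_sum_le hn hp0 hp1 A0.
exists C; split => // f [tf fLp]; have [mM _] := fLp.
apply: HC => //; first by move=> x; exact: max_heat_ge0.
  apply: superlevel_max_heat => // [t l t01|t x t01].
    exact: measurable_superlevel (polybounded_rcoef tf) t01.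
  by case: (heat_sum_le_max_heat hn tf x t01).
apply: superlevel_max_heat => // [t l t01|t x t01].
  exact: measurable_superlevel (polybounded_icoef tf) t01.
by case: (heat_sum_le_max_heat hn tf x t01).
Qed.
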